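(* Let $0<\alpha_1,\alpha_2<1$, let $t>0$, and let $E_{\alpha_1}$ and $E_{\alpha_2}$ be independent inverse stable subordinators of indices $\alpha_1$ and $\alpha_2$. The probability density $h_{\alpha_1,\alpha_2}(x,t)$ of the product $E_{\alpha_1,\alpha_2}(t)=E_{\alpha_1}(t)E_{\alpha_2}(t)$ is given, for $x>0$, by $$\begin{aligned} h_{\alpha_1,\alpha_2}(x,t)&=\sum_{k=1}^{\infty}\frac{x^{k-1}}{\pi^2((k-1)!)^2}\,\Gamma(k\alpha_1)\Gamma(k\alpha_2)\,t^{-k(\alpha_1+\alpha_2)}\sin(\pi\alpha_1k)\sin(\pi\alpha_2k)\\ &\qquad\times\left[2\phi(k)-\alpha_1\phi(k\alpha_1)-\alpha_2\phi(k\alpha_2)-\log(x)+(\alpha_1+\alpha_2)\log(t)\right]\\ &\quad-\frac{1}{2\pi}\sum_{k=1}^{\infty}\frac{x^{k-1}}{((k-1)!)^2}\,\Gamma(k\alpha_1)\Gamma(k\alpha_2)\,t^{-k(\alpha_1+\alpha_2)}\\ &\qquad\times\left[(\alpha_1+\alpha_2)\sin((\alpha_1+\alpha_2)k\pi)-(\alpha_1-\alpha_2)\sin((\alpha_1-\alpha_2)k\pi)\right]. \end{aligned}$$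
   Context: For $0<\alpha<1$, the $\alpha$-stable subordinator $(D_{\alpha}(t))_{t\ge 0}$ is the subordinator (non-decreasing Lévy process started at $0$) with Laplace transform $\mathbb{E}(e^{-sD_{\alpha}(t)})=e^{-ts^{\alpha}}$ for $s>0$. The inverse stable subordinator of index $\alpha$ is $E_{\alpha}(t)=\inf\{w>0: D_{\alpha}(w)>t\}$. $\Gamma$ is the Gamma function and $\phi(s)=\Gamma'(s)/\Gamma(s)$ is the digamma function. *)

(* Defs.v *)
From HB Require Import structures.
From mathcomp Require Import all_boot all_order all_algebra.
From mathcomp Require Import all_classical all_reals all_analysis.
From mathcomp Require Import measurable_realfun.

Set Implicit Arguments.
Unset Strict Implicit.
Unset Printing Implicit Defensive.

Import Order.TTheory GRing.Theory Num.Theory.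
Import numFieldNormedType.Exports.

Local Open Scope classical_set_scope.
Local Open Scope ring_scope.

(* Processes are indexed by R; only indices u >= 0 are ever constrained. *)

(* The clause on [s] and [B] is mutual independence of the increments over
   s 0 <= ... <= s n; subfamilies are obtained with B i = setT. *)
Definition independent_increments d (T : measurableType d) (R : realType)
    (P : probability T R) (X : R -> {RV P >-> R}) : Prop :=
  forall (n : nat) (s : nat -> R) (B : nat -> set R),
    0 <= s 0%N ->
    (forall i, (i < n)%N -> s i <= s i.+1) ->
    (forall i, (i < n)%N -> measurable (B i)) ->
    P (\bigcap_(i < n) [set w | B i (X (s i.+1) w - X (s i) w)]) =
    (\prod_(i < n) P [set w | B i (X (s i.+1) w - X (s i) w)%R])%E.

Definition stationary_increments d (T : measurableType d) (R : realType)
    (P : probability T R) (X : R -> {RV P >-> R}) : Prop :=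
  forall (s h : R) (B : set R), 0 <= s -> 0 <= h -> measurable B ->
    P [set w | B (X (s + h) w - X s w)] = P [set w | B (X h w)].

Definition stochastically_continuous d (T : measurableType d) (R : realType)
    (P : probability T R) (X : R -> {RV P >-> R}) : Prop :=
  forall s e : R, 0 <= s -> 0 < e ->
    P [set w | e < `|X u w - X s w|] @[u --> within [set u | 0 <= u] (nbhs s)]
      --> 0%E.

Definition cadlag (R : realType) (f : R -> R) : Prop :=
  (forall s, 0 <= s -> f u @[u --> s^'+] --> f s) /\
  (forall s, 0 < s -> cvg (f u @[u --> s^'-])).

Definition levy_process d (T : measurableType d) (R : realType)
    (P : probability T R) (X : R -> {RV P >-> R}) : Prop :=
  [/\ {ae P, forall w, X 0 w = 0},
      independent_increments X,
      stationary_increments X,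
      stochastically_continuous X &
      {ae P, forall w, cadlag (fun u => X u w)}].

Definition subordinator d (T : measurableType d) (R : realType)
    (P : probability T R) (X : R -> {RV P >-> R}) : Prop :=
  levy_process X /\
  {ae P, forall w, forall u v, 0 <= u -> u <= v -> X u w <= X v w}.

Definition stable_subordinator d (T : measurableType d) (R : realType)
    (P : probability T R) (alpha : R) (D : R -> {RV P >-> R}) : Prop :=
  subordinator D /\
  forall u s, 0 <= u -> 0 < s ->
    ('E_P[fun w => expR (- s * D u w)%R] = (expR (- u * s `^ alpha)%R)%:E)%E.

(* The infimum is taken in \bar R, so that inf set0 = +oo. *)
Definition inverse_stable_subordinator d (T : measurableType d) (R : realType)
    (P : probability T R) (alpha : R) (E : R -> {RV P >-> \bar R}) : Prop :=
  exists D : R -> {RV P >-> R},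
    stable_subordinator alpha D /\
    forall u w, 0 <= u ->
      E u w = ereal_inf [set v%:E | v in [set v | 0 < v /\ u < D v w]].

Definition process_sigma_algebra d d' (T : measurableType d)
    (T' : measurableType d') (R : realType) (X : R -> T -> T') : set_system T :=
  <<s \bigcup_(u in [set u | 0 <= u])
        preimage_set_system setT (X u) measurable >>.

Definition independent_processes d d' (T : measurableType d)
    (T' : measurableType d') (R : realType) (P : probability T R)
    (X Y : R -> {RV P >-> T'}) : Prop :=
  forall A B : set T,
    process_sigma_algebra X A -> process_sigma_algebra Y B ->
    P (A `&` B) = (P A * P B)%E.

(* Taking B = setT gives \int f = 1, and B = [set -oo; +oo] shows that X is
   almost surely finite. *)
Definition has_density d (T : measurableType d) (R : realType)
    (P : probability T R) (X : T -> \bar R) (f : R -> R) : Prop :=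
  [/\ measurable_fun setT X, measurable_fun setT f, (forall x, 0 <= f x) &
      forall B : set (\bar R), measurable B ->
        P (X @^-1` B) =
        (\int[lebesgue_measure]_(x in EFin @^-1` B) (f x)%:E)%E].

(* For s > 0. *)
Definition Gamma (R : realType) (s : R) : R :=
  \int[lebesgue_measure]_(y in `]0, +oo[) (y `^ (s - 1) * expR (- y)).

Definition digamma (R : realType) (s : R) : R := derive1 (@Gamma R) s / Gamma s.

Definition log_term (R : realType) (a1 a2 t x : R) (k : nat) : R :=
  x ^+ k.-1 / (pi ^+ 2 * (k.-1)`!%:R ^+ 2)
  * Gamma (k%:R * a1) * Gamma (k%:R * a2) * t `^ (- k%:R * (a1 + a2))
  * sin (pi * a1 * k%:R) * sin (pi * a2 * k%:R)
  * (2 * digamma k%:R - a1 * digamma (k%:R * a1) - a2 * digamma (k%:R * a2)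
     - ln x + (a1 + a2) * ln t).

Definition sine_term (R : realType) (a1 a2 t x : R) (k : nat) : R :=
  x ^+ k.-1 / (k.-1)`!%:R ^+ 2
  * Gamma (k%:R * a1) * Gamma (k%:R * a2) * t `^ (- k%:R * (a1 + a2))
  * ((a1 + a2) * sin ((a1 + a2) * k%:R * pi)
     - (a1 - a2) * sin ((a1 - a2) * k%:R * pi)).

(* Main.v *)
Require Import Defs.
From HB Require Import structures.
From mathcomp Require Import all_boot all_order all_algebra.
From mathcomp Require Import all_classical all_reals all_analysis.
From mathcomp Require Import measurable_realfun.
From mathcomp Require Import ring lra.

Set Implicit Arguments.
Unset Strict Implicit.
Unset Printing Implicit Defensive.

Import Order.TTheory GRing.Theory Num.Theory.
Import numFieldNormedType.Exports.

Local Open Scope classical_set_scope.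
Local Open Scope ring_scope.

(** Why the formula holds.

  Law of [E t]. Fix a ray [z = r * exp (i * (th + pi))] of the open left
  half-plane along which [z ^ al] stays in the right half-plane
  ([contour_angle]), so that [exp (t * z - x * z ^ al)] decays rapidly. Bromwich's
  inversion integral for [exp (- x * s ^ al) / s], collapsed onto this ray and
  its conjugate, is [subcdf]. Its Laplace transform in [t] is computed by Cauchy's
  formula at the pole [s]: the ray is turned towards the positive axis, where a
  Poisson kernel concentrates at [s] ([pole_value], [laplace_subcdf]).
  Contour rotation is done in real terms: in polar coordinates the
  Cauchy-Riemann equations say that the angular derivative of a ray integral is
  a boundary term ([ray_integral_dv]). Injectivity of the Laplace transform
  ([laplace_eq0]) identifies [subcdf x t] with [P (D x <= t)]
  ([subordinator_cdfE]); hence [P (E t <= a) = 1 - subcdf a t] ([inverse_cdfE]),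
  and [E t] has the density [invpdf] ([integral_inverse]). By independence and
  Tonelli's theorem the product has as density the multiplicative convolution
  [mulconv] ([product_law]).

  The series. Expanding [exp (- x * z ^ al)] under the integral shows that
  [invpdf] is the restriction of an entire function whose derivatives at the
  origin are, up to sign and a factor [pi], the values at the positive integers of
  [v |-> t ^ (- al v) * Gamma (al v) * sin (pi al v)] ([Gsin], [invfam_series]).
  Its [n]-th derivative decays like any power above [- (n + 1)]
  ([invfam_decay]). By self-similarity, [x * mulconv x] is the integral of
  [f y * g (1 / y) / y] for two such functions ([conv_rescaled]). Splitting at
  [y = 1] and expanding [g (1 / y)] for [y > 1] and [f y] for [y < 1], one meets the
  moments of [f] and [g] over [y > 1]; these are finite parts of divergent
  integrals over the half-line minus series of off-diagonal terms
  [a m / (m - k)], and the off-diagonal terms of [f] and [g] cancel by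
  antisymmetry ([pint_conv_series]). The finite parts, which play the role of
  residues at double poles, are obtained by integrating by parts down to a
  logarithmic moment ([finite_part]), which is the derivative at [1] of a Mellin
  transform of the form [Gamma s * Gsin (n + 1 - s)] ([invfam_log]).
  Differentiating the Gamma factors yields the digamma functions, the powers
  [log x] and [log t], and the sines the second series ([series_term]).

  Convergence. Since [al < 1], [Gamma (al * k)] is smaller than [k!] by any
  geometric factor ([Gamma_growth]), so the series of sines converges absolutely
  ([cvg_sine]); the full series converges to the density ([mulconv_series]), and
  the logarithmic series is what remains. *)

(** * Syntax-directed differentiation and measurability *)

Section calculus.
Context {R : realType}.
Implicit Types (f g : R -> R) (x a d : R).

Lemma dv_eq f x d d' : is_derive x (1:R) f d -> d = d' -> is_derive x (1:R) f d'.
Proof. by move=> H <-. Qed.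
Lemma dv_cst x a : is_derive x (1:R) (fun _ : R => a) 0.
Proof. exact: is_derive_cst. Qed.
Lemma dv_id x : is_derive x (1:R) (fun y : R => y) 1.
Proof. exact: is_derive_id. Qed.
Lemma dvD f g x d e : is_derive x (1:R) f d -> is_derive x (1:R) g e ->
  is_derive x (1:R) (fun y => f y + g y) (d + e).
Proof. by move=> *; exact: is_deriveD. Qed.
Lemma dvN f x d : is_derive x (1:R) f d -> is_derive x (1:R) (fun y => - f y) (- d).
Proof. by move=> *; exact: is_deriveN. Qed.
Lemma dvM f g x d e : is_derive x (1:R) f d -> is_derive x (1:R) g e ->
  is_derive x (1:R) (fun y => f y * g y) (d * g x + f x * e).
Proof.
move=> hf hg; have := is_deriveM hf hg; rewrite /GRing.scale/= addrC => h.
by apply: dv_eq h _; rewrite [d * _]mulrC.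
Qed.
Lemma dv_comp f g x (d e : R) : is_derive (g x) (1:R) f d -> is_derive x (1:R) g e ->
  is_derive x (1:R) (fun y => f (g y)) (d * e).
Proof.
move=> hf hg; have h := is_derive1_comp hf hg.
by apply: dv_eq h _.
Qed.
Lemma dv_exp g x e : is_derive x (1:R) g e ->
  is_derive x (1:R) (fun y => expR (g y)) (e * expR (g x)).
Proof. by move=> h; apply: dv_eq (dv_comp (is_derive_expR _) h) _; rewrite mulrC. Qed.
Lemma dv_sin g x e : is_derive x (1:R) g e ->
  is_derive x (1:R) (fun y => sin (g y)) (e * cos (g x)).
Proof. by move=> h; apply: dv_eq (dv_comp (is_derive_sin _) h) _; rewrite mulrC. Qed.
Lemma dv_cos g x e : is_derive x (1:R) g e ->
  is_derive x (1:R) (fun y => cos (g y)) (- (e * sin (g x))).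
Proof. by move=> h; apply: dv_eq (dv_comp (is_derive_cos _) h) _; rewrite mulNr mulrC. Qed.
Lemma dv_atan g x e : is_derive x (1:R) g e ->
  is_derive x (1:R) (fun y => atan (g y)) (e / (1 + g x ^+ 2)).
Proof. by move=> h; apply: dv_eq (dv_comp (is_derive1_atan _) h) _; rewrite mulrC. Qed.
Lemma dv_ln g x e : 0 < g x -> is_derive x (1:R) g e ->
  is_derive x (1:R) (fun y => ln (g y)) (e / g x).
Proof. by move=> g0 h; apply: dv_eq (dv_comp (is_derive1_ln g0) h) _; rewrite mulrC. Qed.
Lemma dv_pow g x e p : 0 < g x -> is_derive x (1:R) g e ->
  is_derive x (1:R) (fun y => g y `^ p) (e * (p * g x `^ (p - 1))).
Proof. by move=> g0 h; apply: dv_eq (dv_comp (is_derive1_powR p g0) h) _; rewrite mulrC. Qed.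
Lemma dv_inv g x e : g x != 0 -> is_derive x (1:R) g e ->
  is_derive x (1:R) (fun y => (g y)^-1) (- (e / g x ^+ 2)).
Proof.
move=> g0 h; apply: dv_eq (is_deriveV g0 h) _.
by rewrite /GRing.scale/= mulNr mulrC.
Qed.
Lemma dv_ex f n x d : is_derive x (1:R) f d ->
  is_derive x (1:R) (fun y => f y ^+ n) (n%:R * f x ^+ n.-1 * d).
Proof.
move=> h; elim: n => [|n IH].
  by apply: dv_eq (dv_cst x 1) _; rewrite mul0r mul0r.
under eq_fun do rewrite exprS.
apply: dv_eq (dvM h IH) _.
case: n {IH} => [|n]; first by rewrite expr0 !mul0r mulr0 addr0 mulr1 mul1r mul1r.
by rewrite /= exprS -natr1; ring.
Qed.

Lemma dv_cts f x d : is_derive x (1:R) f d -> {for x, continuous f}.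
Proof. by move=> h; apply/differentiable_continuous/derivable1_diffP; case: h. Qed.
Lemma dv_derivable f x d : is_derive x (1:R) f d -> derivable f x 1.
Proof. by case. Qed.
Lemma dv_derive1 f x d : is_derive x (1:R) f d -> derive1 f x = d.
Proof. by case=> _ <-; rewrite derive1E. Qed.
Lemma dv_congr f g x d : (\forall y \near x, f y = g y) ->
  is_derive x (1:R) f d -> is_derive x (1:R) g d.
Proof. by move=> fg h; apply: (near_eq_is_derive _ h) => //; exact: oner_neq0. Qed.

End calculus.

Section measurability.
Context d (T : measurableType d) {R : realType}.
Implicit Types (D : set T) (f g : T -> R).
Lemma mf_comp (h : R -> R) D g : measurable_fun setT h -> measurable_fun D g ->
  measurable_fun D (fun x => h (g x)).
Proof. by move=> mh mg; exact: measurableT_comp. Qed.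
Lemma mf_exp D g : measurable_fun D g -> measurable_fun D (fun x => expR (g x)).
Proof. by apply: mf_comp; exact: measurable_expR. Qed.
Lemma mf_ln D g : measurable_fun D g -> measurable_fun D (fun x => ln (g x)).
Proof. by apply: mf_comp; exact: measurable_ln. Qed.
Lemma mf_pow D g p : measurable_fun D g -> measurable_fun D (fun x => g x `^ p).
Proof. by apply: (@mf_comp (fun y => y `^ p)); exact: measurable_powR. Qed.
Lemma mf_sin D g : measurable_fun D g -> measurable_fun D (fun x => sin (g x)).
Proof. by apply: mf_comp; apply: continuous_measurable_fun; exact: continuous_sin. Qed.
Lemma mf_cos D g : measurable_fun D g -> measurable_fun D (fun x => cos (g x)).
Proof. by apply: mf_comp; apply: continuous_measurable_fun; exact: continuous_cos. Qed.
Lemma mfD D f g : measurable_fun D f -> measurable_fun D g -> measurable_fun D (fun x => f x + g x).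
Proof. exact: measurable_funD. Qed.
Lemma mfM D f g : measurable_fun D f -> measurable_fun D g -> measurable_fun D (fun x => f x * g x).
Proof. exact: measurable_funM. Qed.
Lemma mfN D f : measurable_fun D f -> measurable_fun D (fun x => - f x).
Proof. by move=> mf; apply: (@mf_comp -%R). Qed.
Lemma mfV D f : measurable_fun D f -> measurable_fun D (fun x => (f x)^-1).
Proof.
(* [y `^ (-1)] is [y^-1] for positive [y] only, hence the split by signs. *)
move=> mf; rewrite (_ : (fun x => (f x)^-1) = (fun x => (f x) `^ (-1) * (if 0 < f x then 1 else 0) - (- f x) `^ (-1) * (if 0 < - f x then 1 else 0))).
  have mif g : measurable_fun D g -> measurable_fun D (fun x => if 0 < g x then 1 else 0 : R).
    move=> mg; apply: (@mf_comp (fun y => if 0 < y then 1 else 0 : R)) => //.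
    apply: measurable_fun_if => //; exact: measurable_fun_ltr.
  apply: mfD; first by apply: mfM; [exact: mf_pow|exact: mif].
  by apply: mfN; apply: mfM; [apply: mf_pow; exact: mfN|apply: mif; exact: mfN].
apply/funext => x; rewrite oppr_gt0.
have [h|h|<-] := ltgtP 0 (f x); rewrite ?(ltW h) ?mulr1 ?mulr0 ?subr0 ?sub0r ?invr0//.
  by rewrite powR_inv1 ?ltW.
by rewrite powR_inv1 ?oppr_ge0 1?ltW// invrN opprK.
Qed.
Lemma mfX D f n : measurable_fun D f -> measurable_fun D (fun x => f x ^+ n).
Proof. exact: measurable_funX. Qed.
End measurability.

(** The value of the derivative is left as an existential variable, to be
  compared with the expected one by [dv_eq]; side conditions (positive
  arguments of [ln] and powers, nonzero denominators) come back as subgoals. *)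
Ltac dv := lazymatch goal with
 | |- is_derive _ _ (fun _ => ?a) _ => apply: dv_cst
 | |- is_derive _ _ (fun y => y) _ => apply: dv_id
 | |- is_derive _ _ (fun y => @?f y + @?g y) _ => eapply (@dvD _ f g); [dv|dv]
 | |- is_derive _ _ (fun y => @?f y * @?g y) _ => eapply (@dvM _ f g); [dv|dv]
 | |- is_derive _ _ (fun y => - @?f y) _ => eapply (@dvN _ f); dv
 | |- is_derive _ _ (fun y => expR (@?f y)) _ => eapply (@dv_exp _ f); dv
 | |- is_derive _ _ (fun y => sin (@?f y)) _ => eapply (@dv_sin _ f); dv
 | |- is_derive _ _ (fun y => cos (@?f y)) _ => eapply (@dv_cos _ f); dv
 | |- is_derive _ _ (fun y => atan (@?f y)) _ => eapply (@dv_atan _ f); dv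
 | |- is_derive _ _ (fun y => ln (@?f y)) _ => eapply (@dv_ln _ f); [|dv]
 | |- is_derive _ _ (fun y => @?f y `^ ?p) _ => eapply (@dv_pow _ f); [|dv]
 | |- is_derive _ _ (fun y => (@?f y)^-1) _ => eapply (@dv_inv _ f); [|dv]
 | |- is_derive _ _ (fun y => @?f y ^+ ?n) _ => eapply (@dv_ex _ f n); dv
 | _ => try eassumption
 end.

(** * Integrals over the positive half-line *)

Definition pint (R : realType) (f : R -> R) : R :=
  \int[lebesgue_measure]_(x in `]0, +oo[) f x.
Definition pintegrable (R : realType) (f : R -> R) : Prop :=
  lebesgue_measure.-integrable [set` `](0 : R), +oo[] (EFin \o f).
Definition pmeas (R : realType) (f : R -> R) : Prop :=
  measurable_fun [set` `](0 : R), +oo[] f.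

Ltac mf := lazymatch goal with
 | |- measurable_fun _ (fun _ => ?a) => exact: measurable_cst
 | |- measurable_fun _ (fun y => y) => exact: measurable_id
 | |- measurable_fun _ (fun y => fst y) => exact: measurable_fst
 | |- measurable_fun _ (fun y => snd y) => exact: measurable_snd
 | |- measurable_fun _ (fun y => @?f y + @?g y) => apply: (@mfD _ _ _ _ f g); [mf|mf]
 | |- measurable_fun _ (fun y => @?f y * @?g y) => apply: (@mfM _ _ _ _ f g); [mf|mf]
 | |- measurable_fun _ (fun y => - @?f y) => apply: (@mfN _ _ _ _ f); mf
 | |- measurable_fun _ (fun y => expR (@?f y)) => apply: (@mf_exp _ _ _ _ f); mf
 | |- measurable_fun _ (fun y => sin (@?f y)) => apply: (@mf_sin _ _ _ _ f); mf
 | |- measurable_fun _ (fun y => cos (@?f y)) => apply: (@mf_cos _ _ _ _ f); mf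
 | |- measurable_fun _ (fun y => ln (@?f y)) => apply: (@mf_ln _ _ _ _ f); mf
 | |- measurable_fun _ (fun y => @?f y `^ ?p) => apply: (@mf_pow _ _ _ _ f); mf
 | |- measurable_fun _ (fun y => (@?f y)^-1) => apply: (@mfV _ _ _ _ f); mf
 | |- measurable_fun _ (fun y => @?f y ^+ ?n) => apply: (@mfX _ _ _ _ f); mf
 | |- pmeas _ => rewrite /pmeas; mf
 | _ => try assumption
 end.

Section half_line.
Context {R : realType}.
Implicit Types (f g : R -> R) (x a : R).
Local Notation mu := (@lebesgue_measure R).

Lemma posE x : [set` `](0 : R), +oo[] x <-> 0 < x.
Proof. by rewrite /= in_itv/= andbT. Qed.

Lemma in_posE x : (x \in [set` `](0 : R), +oo[]) = (0 < x).
Proof. by apply/idP/idP; rewrite inE/= in_itv/= andbT. Qed.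

Lemma pintegrable_meas f : pintegrable f -> pmeas f.
Proof. by move=> /integrableP[/measurable_EFinP]. Qed.

Lemma pintegrable_le f g : pmeas f -> pintegrable g ->
  (forall x, 0 < x -> `|f x| <= g x) -> pintegrable f.
Proof.
move=> mf ig fg; apply: le_integrable ig => //= [|x /posE x0 /=].
  exact/measurable_EFinP.
by rewrite lee_fin (le_trans (fg _ x0))// ler_norm.
Qed.

Lemma pintegrable_eq f g : (forall x, 0 < x -> f x = g x) ->
  pintegrable f -> pintegrable g.
Proof.
move=> fg; rewrite /pintegrable => h.
apply: eq_integrable h => //= x; rewrite inE => /posE x0 /=.
by rewrite fg.
Qed.

Lemma pmeas_eq f g : (forall x, 0 < x -> f x = g x) -> pmeas f -> pmeas g.
Proof.
move=> fg; rewrite /pmeas => h; apply: eq_measurable_fun h => x.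
by rewrite inE => /posE; exact: fg.
Qed.

Lemma eq_pint f g : (forall x, 0 < x -> f x = g x) -> pint f = pint g.
Proof.
by move=> fg; apply: eq_Rintegral => x; rewrite inE => /posE; exact: fg.
Qed.

Lemma pintegrableD f g : pintegrable f -> pintegrable g ->
  pintegrable (fun x => f x + g x).
Proof. by move=> hf hg; apply: (@integrableD _ _ _ mu _ _ _ _ hf hg). Qed.
Lemma pintegrableZ k f : pintegrable f -> pintegrable (fun x => k * f x).
Proof. by move=> hf; apply: (@integrableZl _ _ _ mu _ _ k _ hf). Qed.
Lemma pintegrableN f : pintegrable f -> pintegrable (fun x => - f x).
Proof.
move=> /(pintegrableZ (-1)); apply: pintegrable_eq => x _; by rewrite mulN1r.
Qed.
Lemma pintegrableB f g : pintegrable f -> pintegrable g ->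
  pintegrable (fun x => f x - g x).
Proof. by move=> hf /pintegrableN; exact: pintegrableD. Qed.
Lemma pintegrable0 : pintegrable (fun _ : R => 0).
Proof. exact: integrable0. Qed.
Lemma pintegrable_norm f : pintegrable f -> pintegrable (fun x => `|f x|).
Proof. by move=> h; exact: (integrable_abse h). Qed.

Lemma pintD f g : pintegrable f -> pintegrable g ->
  pint (fun x => f x + g x) = pint f + pint g.
Proof. by move=> *; exact: RintegralD. Qed.
Lemma pintB f g : pintegrable f -> pintegrable g ->
  pint (fun x => f x - g x) = pint f - pint g.
Proof. by move=> *; exact: RintegralB. Qed.
Lemma pintZ k f : pintegrable f -> pint (fun x => k * f x) = k * pint f.
Proof. by move=> *; exact: RintegralZl. Qed.
Lemma pintN f : pintegrable f -> pint (fun x => - f x) = - pint f.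
Proof.
move=> h; rewrite -mulN1r -pintZ//; apply: eq_pint => x _; by rewrite mulN1r.
Qed.
Lemma pint0 : pint (fun _ : R => 0) = 0.
Proof. by rewrite /pint Rintegral_cst// mul0r. Qed.
Lemma pint_ge0 f : (forall x, 0 < x -> 0 <= f x) -> 0 <= pint f.
Proof. by move=> f0; apply: Rintegral_ge0 => x /posE; exact: f0. Qed.
Lemma le_pint f g : pintegrable f -> pintegrable g ->
  (forall x, 0 < x -> f x <= g x) -> pint f <= pint g.
Proof. by move=> hf hg fg; apply: le_Rintegral => // x /posE; exact: fg. Qed.
Lemma norm_pint_le f g : pintegrable f -> pintegrable g ->
  (forall x, 0 < x -> `|f x| <= g x) -> `|pint f| <= pint g.
Proof.
move=> hf hg fg; apply: le_trans (le_normr_Rintegral _ hf) _ => //.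
by apply: le_pint => //; exact: pintegrable_norm.
Qed.
Lemma EFin_pint f : pintegrable f ->
  (pint f)%:E = (\int[mu]_(x in [set` `](0:R), +oo[%R]) (f x)%:E)%E.
Proof. by move=> hf; rewrite /pint /Rintegral fineK//; exact: integrable_fin_num. Qed.

Lemma pintegrable_sum (I : Type) (s : seq I) (F : I -> R -> R) :
  (forall i, pintegrable (F i)) -> pintegrable (fun x => \sum_(i <- s) F i x).
Proof.
move=> h; elim: s => [|i s IH].
  by apply: pintegrable_eq pintegrable0 => x _; rewrite big_nil.
apply: pintegrable_eq (pintegrableD (h i) IH) => x _; by rewrite big_cons.
Qed.
Lemma pint_sum (I : Type) (s : seq I) (F : I -> R -> R) :
  (forall i, pintegrable (F i)) ->
  pint (fun x => \sum_(i <- s) F i x) = \sum_(i <- s) pint (F i).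
Proof.
move=> h; elim: s => [|i s IH].
  rewrite big_nil -[RHS]pint0; apply: eq_pint => x _; by rewrite big_nil.
rewrite big_cons -IH -pintD//; last exact: pintegrable_sum.
by apply: eq_pint => x _; rewrite big_cons.
Qed.

Lemma pint_dct (F : nat -> R -> R) f g : (forall n, pmeas (F n)) ->
  pintegrable g -> (forall n x, 0 < x -> `|F n x| <= g x) ->
  (forall x, 0 < x -> F n x @[n --> \oo] --> f x) ->
  pintegrable f /\ pint (F n) @[n --> \oo] --> pint f.
Proof.
move=> mF ig Fg Ff.
have iF n : pintegrable (F n) by exact: pintegrable_le (Fg n).
have mf : measurable_fun [set` `](0 : R), +oo[] (EFin \o f).
  apply: (emeasurable_fun_cvg (fun n => EFin \o F n)).
    by move=> n; apply/measurable_EFinP; exact: mF.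
  move=> x /posE x0; apply: cvg_EFin; last exact: Ff.
  exact: nearW.
have [|||||ifx _ cv] := @dominated_convergence _ _ R mu [set` `](0 : R), +oo[] (measurable_itv _)
  (fun n => EFin \o F n) (EFin \o f) (EFin \o g).
- by move=> n; apply/measurable_EFinP; exact: mF.
- exact: mf.
- apply: aeW => x /posE x0; apply: cvg_EFin; last exact: Ff.
  exact: nearW.
- exact: ig.
- by apply: aeW => x n /posE x0; rewrite /= lee_fin; exact: Fg.
split => //; apply: fine_cvg.
rewrite fineK; last exact: integrable_fin_num.
by apply: cvg_trans cv; apply: near_eq_cvg; near=> n.
Unshelve. all: by end_near. Qed.

Lemma atan_cvg_pinfty : atan x @[x --> +oo%R] --> (pi / 2 : R).
Proof.
apply/cvgrPdist_le => /= e e0; pose y : R := Num.max 0 (pi / 2 - e).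
have y1 : y < pi / 2 by rewrite gt_max divr_gt0 ?pi_gt0//= gtrBl.
have y0 : 0 <= y by rewrite le_max lexx.
near=> x; rewrite ger0_norm ?subr_ge0; last exact/ltW/atan_ltpi2.
rewrite lerBlDr -lerBlDl.
rewrite (@le_trans _ _ y)//; first by rewrite le_max lexx orbT.
rewrite -(@tanK R y); last first.
  by rewrite in_itv/= y1 andbT (lt_le_trans _ y0)// oppr_lt0 divr_gt0 ?pi_gt0.
by apply: le_atan; near: x; apply: nbhs_pinfty_ge; exact: num_real.
Unshelve. all: by end_near. Qed.

End half_line.

Section half_line_ftc.
Context {R : realType}.
Implicit Types (f g F : R -> R) (x a b d k r A B C M : R).
Local Notation mu := (@lebesgue_measure R).

Lemma ftc_segment F f a b : 0 < a -> a < b ->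
  (forall x, 0 < x -> is_derive x (1 : R) F (f x)) ->
  (forall x, 0 < x -> {for x, continuous f}) ->
  (\int[mu]_(x in [set` `[a, b]%R]) (f x)%:E = (F b - F a)%:E)%E.
Proof.
move=> a0 ab dF cf; rewrite EFinB; apply: continuous_FTC2 => //.
- apply: continuous_in_subspaceT => x; rewrite inE/= in_itv/= => /andP[ax _].
  by apply: cf; exact: lt_le_trans ax.
- split.
  + by move=> x; rewrite in_itv/= => /andP[ax _]; have [] := dF x (lt_trans a0 ax).
  + apply: cvg_at_right_filter; apply: dv_cts; exact: dF.
  + by apply: cvg_at_left_filter; apply: dv_cts; apply: dF; exact: lt_trans ab.
- move=> x; rewrite in_itv/= => /andP[ax _].
  by apply: dv_derive1; apply: dF; exact: lt_trans ax.
Qed.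

(** Compact intervals exhausting the half-line, so that Barrow's rule on a segment
  passes to the limit. *)
Definition kseg (n : nat) : set R := [set` `[n.+1%:R^-1, n.+2%:R]%R].

Lemma kseg_lt n : (n.+1%:R^-1 : R) < n.+2%:R.
Proof.
apply: (@le_lt_trans _ _ 1); last by rewrite ltr1n.
by rewrite invf_le1// ler1n.
Qed.

Lemma kseg_nd : nondecreasing_seq kseg.
Proof.
move=> m n mn; apply/subsetPset => x; rewrite /kseg/= !in_itv/= => /andP[h1 h2].
apply/andP; split.
  by rewrite (le_trans _ h1)// lef_pV2 ?posrE// ler_nat.
by rewrite (le_trans h2)// ler_nat.
Qed.

Lemma kseg_cover : \bigcup_n kseg n = [set` `](0 : R), +oo[].
Proof.
apply/seteqP; split => x.
  move=> [n _]; rewrite /kseg/= !in_itv/= andbT => /andP[+ _].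
  by apply: lt_le_trans; rewrite invr_gt0.
move=> /posE x0; pose n := maxn (Num.truncn x) (Num.truncn x^-1).
exists n => //; rewrite /kseg/= in_itv/=; apply/andP; split.
  rewrite -[leRHS]invrK lef_pV2 ?posrE ?invr_gt0//.
  rewrite (le_trans (ltW (truncnS_gt _)))// ler_nat ltnS; exact: leq_maxr.
rewrite (le_trans (ltW (truncnS_gt _)))// ler_nat ltnS.
by rewrite leqW// leq_maxl.
Qed.

Lemma pmeas_cts f : (forall x, 0 < x -> {for x, continuous f}) -> pmeas f.
Proof.
move=> cf; apply: open_continuous_measurable_fun => //.
by move=> x; rewrite inE => /posE; exact: cf.
Qed.

(** For a nonnegative derivative, boundedness of the primitive bounds the
  integrals over the exhausting intervals, hence gives integrability. *)
Lemma pintegrable_ftc F f M : (forall x, 0 < x -> is_derive x (1 : R) F (f x)) ->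
  (forall x, 0 < x -> {for x, continuous f}) -> (forall x, 0 < x -> 0 <= f x) ->
  (forall x, 0 < x -> `|F x| <= M) -> pintegrable f.
Proof.
move=> dF cf f0 FM; apply/integrableP; split; first by apply/measurable_EFinP; exact: pmeas_cts.
apply: (@le_lt_trans _ _ (M + M)%:E); last exact: ltry.
have mfE : measurable_fun [set` `](0 : R), +oo[] (EFin \o f).
  by apply/measurable_EFinP; exact: pmeas_cts.
have -> : (\int[mu]_(x in [set` `](0 : R), +oo[%R]) `|(EFin \o f) x| =
  \int[mu]_(x in \bigcup_n kseg n) (EFin \o f) x)%E.
  rewrite kseg_cover; apply: eq_integral => x; rewrite inE => /posE x0.
  by rewrite gee0_abs// lee_fin f0.
have sub n : kseg n `<=` [set` `](0 : R), +oo[].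
  by rewrite -kseg_cover => x nx; exists n.
have cv : (\int[mu]_(x in kseg n) (EFin \o f) x)%E @[n --> \oo] -->
    (\int[mu]_(x in \bigcup_n kseg n) (EFin \o f) x)%E.
  apply: ge0_nondecreasing_set_cvg_integral; first exact: kseg_nd.
  - by move=> i; exact: measurable_itv.
  - by move=> i; apply: measurable_funS mfE.
  - by move=> i x /sub/posE x0; rewrite lee_fin f0.
rewrite -(cvg_lim _ cv)//; apply: lime_le; first by apply/cvg_ex; eexists; exact: cv.
apply: nearW => n; rewrite [leLHS](_ : _ = (F n.+2%:R - F n.+1%:R^-1)%:E); last first.
  by apply: ftc_segment => //; exact: kseg_lt.
rewrite lee_fin; apply: le_trans (ler_norm _) _; apply: le_trans (ler_normB _ _) _.
by apply: lerD; apply: FM => //; rewrite invr_gt0.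
Qed.

(** Barrow's rule on the half-line for a derivative of arbitrary sign. *)
Lemma pint_ftc F f A B : (forall x, 0 < x -> is_derive x (1 : R) F (f x)) ->
  (forall x, 0 < x -> {for x, continuous f}) -> pintegrable f ->
  F x @[x --> 0^'+] --> A -> F x @[x --> +oo%R] --> B ->
  pint f = B - A.
Proof.
move=> dF cf If FA FB.
pose fn n := f \_ (kseg n).
have sub n : kseg n `<=` [set` `](0 : R), +oo[].
  by rewrite -kseg_cover => x nx; exists n.
have mk n : measurable (kseg n : set (measurableTypeR R)) by exact: measurable_itv.
have [|||_ cv] := @pint_dct R fn f (fun x => `|f x|) _ (pintegrable_norm If).
- move=> n; apply/measurable_restrict => //; first exact: mk.
  by apply: measurable_funS (pintegrable_meas If) => // x [].
- by move=> n x x0; rewrite /fn patchE; case: ifPn => // _; rewrite normr0.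
- move=> x x0; apply: cvg_near_cst.
  have : (\bigcup_n kseg n) x by rewrite kseg_cover; apply/posE.
  move=> [N _ Nx]; near=> n; rewrite /fn patchE mem_set//.
  have /kseg_nd/subsetPset : (N <= n)%N by near: n; exact: nbhs_infty_ge.
  exact.
have E n : pint (fn n) = F n.+2%:R - F n.+1%:R^-1.
  rewrite /pint /fn -Rintegral_mkcondr setIidr; last exact: sub.
  rewrite /Rintegral [X in fine X](_ : _ = (F n.+2%:R - F n.+1%:R^-1)%:E)//.
  by apply: ftc_segment => //; exact: kseg_lt.
have cB : F n.+2%:R @[n --> \oo] --> B.
  have := (cvg_pinftyP _ _).1 FB (fun n => n.+2%:R); apply.
  apply/cvgryPge => M; near=> n.
  by rewrite (@le_trans _ _ n%:R) ?ler_nat ?leqW//; near: n; exact: nbhs_infty_ger.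
have cA : F n.+1%:R^-1 @[n --> \oo] --> A.
  have := (cvg_at_rightP _ _ _).1 FA (fun n => n.+1%:R^-1); apply; split => //.
  exact: cvg_harmonic.
have cAB : pint (fn n) @[n --> \oo] --> B - A.
  by rewrite (funext E); exact: cvgB.
exact: (cvg_unique _ cv cAB).
Unshelve. all: by end_near. Qed.

(** A function with an explicit primitive, [d^-1 * atan (x `^ d)], that is
  comparable to [x `^ (d - 1)] near [0] and to [x `^ (- d - 1)] near infinity:
  it serves as a universal dominating function. *)
Definition hump (d x : R) := x `^ (d - 1) / (1 + (x `^ d) ^+ 2).

Lemma dv_hump d x : 0 < d -> 0 < x ->
  is_derive x (1 : R) (fun y => d^-1 * atan (y `^ d)) (hump d x).
Proof.
move=> d0 x0; eapply dv_eq; first by dv.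
have h : 1 + (x `^ d) ^+ 2 != 0 by rewrite gt_eqF// addr_gt0// exprn_gt0// powR_gt0.
by rewrite /hump; field; rewrite h gt_eqF.
Qed.

Lemma hump_ge0 d x : 0 <= hump d x.
Proof. by rewrite /hump divr_ge0 ?powR_ge0// addr_ge0// sqr_ge0. Qed.

Lemma pintegrable_hump d : 0 < d -> pintegrable (hump d).
Proof.
move=> d0; apply: (@pintegrable_ftc (fun y => d^-1 * atan (y `^ d)) _ (d^-1 * (pi / 2))).
- by move=> x x0; exact: dv_hump.
- move=> x x0; rewrite /hump; eapply dv_cts; dv => //.
  by rewrite gt_eqF// addr_gt0// exprn_gt0// powR_gt0.
- by move=> x _; exact: hump_ge0.
- move=> x _; have d' : 0 <= d^-1 by rewrite invr_ge0 ltW.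
  rewrite normrM (ger0_norm d') ler_wpM2l//.
  by rewrite ler_norml ltW ?atan_gtNpi2//= ltW ?atan_ltpi2.
Qed.

Lemma hump_le1 d x : 0 < d -> 0 < x -> x <= 1 -> x `^ (d - 1) <= 2 * hump d x.
Proof.
move=> d0 x0 x1; rewrite /hump mulrCA ler_peMr ?powR_ge0//.
rewrite ler_pdivlMr ?mul1r; last by rewrite addr_gt0// exprn_gt0// powR_gt0.
suff : (x `^ d) ^+ 2 <= 1 by lra.
rewrite exprn_ile1 ?powR_ge0//.
by rewrite -(@powRr0 R x) ger_powR ?x0// ltW.
Qed.

Lemma hump_ge1 d x : 0 < d -> 1 <= x -> x `^ (- d - 1) <= 2 * hump d x.
Proof.
move=> d0 x1; have x0 : 0 < x by exact: lt_le_trans x1.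
rewrite /hump (_ : x `^ (- d - 1) = x `^ (d - 1) / (x `^ d) ^+ 2); last first.
  rewrite -powR_mulrn ?powR_ge0// -powRrM -powRN -powRD; last by rewrite (gt_eqF x0) implybT.
  by congr (_ `^ _); ring.
have h : 1 <= x `^ d by rewrite -(@powRr0 R x) ler_powR// ltW.
rewrite mulrCA ler_wpM2l ?powR_ge0//.
have h2 : 1 <= (x `^ d) ^+ 2 by rewrite exprn_ege1.
rewrite ler_pdivlMr; last by lra.
by rewrite mulrDr mulr1 mulVf ?gt_eqF//; [|lra]; rewrite (_ : 2 = 1 + 1)// lerD2r invf_le1//; lra.
Qed.

(** Domination by [hump d]. *)
Lemma pintegrable_two_sided f C d : 0 < d -> pmeas f ->
  (forall x, 0 < x -> x <= 1 -> `|f x| <= C * x `^ (d - 1)) ->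
  (forall x, 1 <= x -> `|f x| <= C * x `^ (- d - 1)) -> pintegrable f.
Proof.
move=> d0 mf f1 f2; have C0 : 0 <= C.
  by have := f1 1 ltr01 (lexx _); rewrite powR1 mulr1; apply: le_trans.
apply: (@pintegrable_le _ f (fun x => C * 2 * hump d x)) => //.
  exact/pintegrableZ/pintegrable_hump.
move=> x x0; rewrite -mulrA; have [x1|x1] := leP x 1.
  apply: le_trans (f1 _ x0 x1) _; rewrite ler_wpM2l//; exact: hump_le1.
apply: le_trans (f2 _ (ltW x1)) _; rewrite ler_wpM2l//; apply: hump_ge1 => //; exact: ltW.
Qed.

(** From the term of degree [n > r] of the exponential series. *)
Lemma expR_pow_bound k r : 0 < k -> 0 <= r ->
  exists2 C, 0 <= C & forall x, 0 < x -> expR (- (k * x)) <= C * x `^ (- r).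
Proof.
move=> k0 r0; pose n := (Num.truncn r).+1.
have rn : r <= n%:R by apply/ltW/truncnS_gt.
exists (1 + n`!%:R / k ^+ n) => [|x x0].
  by rewrite addr_ge0// divr_ge0// exprn_ge0// ltW.
rewrite powRN ler_pdivlMr ?powR_gt0// expRN mulrC ler_pdivrMr ?expR_gt0//.
have kx : 0 <= k * x by rewrite mulr_ge0// ltW.
have [x1|x1] := leP x 1.
  apply: (@le_trans _ _ 1); first by rewrite -(@powRr0 R x) ger_powR ?x0.
  apply: mulr_ege1; first by rewrite lerDl divr_ge0// exprn_ge0// ltW.
  by rewrite -expR0 ler_expR.
apply: (@le_trans _ _ (x ^+ n)); first by rewrite -powR_mulrn ?(ltW x0)// ler_powR// ltW.
have h : 1 + (k * x) ^+ n / n`!%:R <= expR (k * x) by exact: expR_ge1Dxn.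
apply: (@le_trans _ _ (n`!%:R / k ^+ n * expR (k * x))); last first.
  by rewrite ler_wpM2r ?expR_ge0// lerDr.
rewrite mulrAC ler_pdivlMr ?exprn_gt0// -exprMn [x * k]mulrC -ler_pdivrMl ?ltr0n ?fact_gt0//.
by rewrite [_^-1 * _]mulrC (le_trans _ h)// lerDr.
Qed.

End half_line_ftc.

Section half_line_parameter.
Context {R : realType}.
Implicit Types (f g F : R -> R) (x y a b d k r u v A B C M : R).
Local Notation mu := (@lebesgue_measure R).

Lemma mposL : measurable ([set` `](0 : R), +oo[] : set (measurableTypeR R)).
Proof. exact: measurable_itv. Qed.

Lemma pint_dv (f f' : R -> R -> R) a u v G : u < a -> a < v ->
  (forall x, u < x -> x < v -> pintegrable (f x)) ->
  (forall x y, u < x -> x < v -> 0 < y ->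
    is_derive x (1 : R) (fun x => f x y) (f' x y)) ->
  pintegrable G ->
  (forall x y, u < x -> x < v -> 0 < y -> `|f' x y| <= G y) ->
  is_derive a (1 : R) (fun x => pint (f x)) (pint (f' a)).
Proof.
move=> ua av If df IG fG.
have E x y : u < x -> x < v -> 0 < y -> partial1of2 f x y = f' x y.
  by move=> ux xv y0; apply: dv_derive1; exact: df.
have Ia : `]u, v[%classic a by rewrite /= in_itv/= ua.
have H1 x : `]u, v[%classic x -> mu.-integrable [set` `](0 : R), +oo[] (EFin \o f x).
  by rewrite /= in_itv/= => /andP[ux xv]; exact: If.
have H2 x y : `]u, v[%classic x -> [set` `](0 : R), +oo[] y -> derivable (f^~ y) x 1.
  rewrite /= in_itv/= => /andP[ux xv] /posE y0.
  by have [] := df x y ux xv y0.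
have H3 x y : `]u, v[%classic x -> [set` `](0 : R), +oo[] y ->
    `|partial1of2 f x y| <= `|G y|.
  rewrite /= in_itv/= => /andP[ux xv] /posE y0.
  by rewrite E// (le_trans (fG _ _ ux xv y0))// ler_norm.
have IG' := pintegrable_norm IG.
apply: DeriveDef.
  exact: (@derivable_under_integral R _ _ mu _ _ mposL _ _ _ Ia H1 H2
    _ (fun y => normr_ge0 (G y)) IG' H3).
rewrite -derive1E (@differentiation_under_integral R _ _ mu _ _ mposL _ _ _ Ia H1 H2
    _ (fun y => normr_ge0 (G y)) IG' H3).
by apply: eq_pint => y y0; exact: E.
Qed.

Lemma pint_swap (f : R -> R -> R) g :
  measurable_fun [set: R * R] (fun p => f p.1 p.2) ->
  (forall x, 0 < x -> pintegrable (f x)) ->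
  (forall y, 0 < y -> pintegrable (f ^~ y)) ->
  (forall x, 0 < x -> pint (fun y => `|f x y|) <= g x) -> pintegrable g ->
  pint (fun x => pint (f x)) = pint (fun y => pint (f ^~ y)).
Proof.
move=> mf f1 f2 fg Ig.
pose D : set (R * R) := [set` `](0 : R), +oo[] `*` [set` `](0 : R), +oo[].
have mD : measurable D by apply: measurableX; exact: measurable_itv.
pose F := (EFin \o (fun p => f p.1 p.2)) \_ D.
have mF : measurable_fun setT F.
  apply/(measurable_restrictT _ mD); apply: measurable_funTS.
  exact/measurable_EFinP.
have FE x y : F (x, y) = if (0 < x) && (0 < y) then (f x y)%:E else 0%E.
  rewrite /F patchE; have [h|h] := boolP ((0 < x) && (0 < y)).
    by rewrite mem_set//; case/andP : h => *; split; exact/posE.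
  by rewrite memNset// => -[/posE/= hx /posE/= hy]; rewrite hx hy in h.
have inner1 x : 0 < x -> (\int[mu]_y F (x, y) = (pint (f x))%:E)%E.
  move=> x0; rewrite EFin_pint; last exact: f1.
  rewrite [RHS]integral_mkcond; apply: eq_integral => y _.
  rewrite FE x0 /= patchE; case: ifPn => y0; first by rewrite mem_set//; exact/posE.
  by rewrite memNset// => /posE y0'; rewrite y0' in y0.
have inner2 y : 0 < y -> (\int[mu]_x F (x, y) = (pint (f ^~ y))%:E)%E.
  move=> y0; rewrite EFin_pint; last exact: f2.
  rewrite [RHS]integral_mkcond; apply: eq_integral => x _.
  rewrite FE y0 andbT /= patchE; case: ifPn => x0; first by rewrite mem_set//; exact/posE.
  by rewrite memNset// => /posE x0'; rewrite x0' in x0.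
have innera x : 0 < x -> (\int[mu]_y `|F (x, y)| = (pint (fun y => `|f x y|))%:E)%E.
  move=> x0; rewrite EFin_pint; last exact/pintegrable_norm/f1.
  rewrite [RHS]integral_mkcond; apply: eq_integral => y _.
  rewrite FE x0 /= patchE; case: ifPn => y0; first by rewrite mem_set//; exact/posE.
  by rewrite memNset ?abse0// => /posE y0'; rewrite y0' in y0.
have outer (h : R -> R -> \bar R) (h' : R -> R) :
    (forall x y, ~~ (0 < x) -> h x y = 0%E) ->
    (forall x, 0 < x -> (\int[mu]_y h x y = (h' x)%:E)%E) ->
    (\int[mu]_x \int[mu]_y h x y =
     \int[mu]_(x in [set` `](0 : R), +oo[%R]) (h' x)%:E)%E.
  move=> h0 hh'; rewrite [RHS]integral_mkcond; apply: eq_integral => x _.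
  rewrite patchE; case: ifPn => [|xn]; first by rewrite inE => /posE x0; exact: hh'.
  rewrite integral0_eq// => y _; apply: h0; apply: contra xn => x0.
  by rewrite inE; exact/posE.
have IF : (mu \x mu)%E.-integrable setT F.
  apply/(@integrable12ltyP _ _ (measurableTypeR R) (measurableTypeR R) R mu mu F mF).
  rewrite (outer (fun x y => `|F (x, y)|)%E (fun x => pint (fun y => `|f x y|))) //; last first.
    by move=> x y /negbTE xn; rewrite FE xn abse0.
  move: (Ig) => /integrableP[_]; apply: le_lt_trans; apply: ge0_le_integral => //=.
  - by move=> x _; rewrite lee_fin; exact: pint_ge0.
  - have : measurable_fun setT (fun x => (\int[mu]_y `|F (x, y)|)%E).
      apply: (@measurable_fun_fubini_tonelli_F _ _ (measurableTypeR R) (measurableTypeR R) R mu (abse \o F)) => //=.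
      exact: measurableT_comp.
    move=> /(measurable_funTS (D := [set` `](0 : R), +oo[])).
    apply: eq_measurable_fun => x; rewrite inE => /posE x0; exact: innera.
  - by apply/measurable_EFinP; apply: measurableT_comp => //; exact: pintegrable_meas.
  - move=> x /posE x0; rewrite lee_fin; apply: le_trans (ler_norm _).
    exact: fg.
have O1 := outer (fun x y => F (x, y)) (fun x => pint (f x)) _ inner1.
have O2 := outer (fun y x => F (x, y)) (fun y => pint (f ^~ y)) _ inner2.
have := Fubini IF; rewrite O1; last by move=> x y /negbTE xn; rewrite FE xn.
rewrite O2; last by move=> y x /negbTE xn; rewrite FE xn andbF.
by rewrite /pint /Rintegral => ->.
Qed.

Let kmul (k : R) : measurableTypeR R -> measurableTypeR R := fun x => k * x.

Let measurable_kmul k : measurable_fun setT (kmul k).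
Proof. by apply: mfM; mf. Qed.

(** Both sides are measures in [A], and they agree on half-open intervals. *)
Lemma lebesgue_scale k (A : set R) : 0 < k -> measurable A ->
  mu (kmul k @^-1` A) = (k^-1%:E * mu A)%E.
Proof.
move=> k0 mA; have mk := measurable_kmul k.
suff -> : mu A = (k%:E * mu (kmul k @^-1` A))%E.
  by rewrite muleA -EFinM mulVf ?gt_eqF// mul1e.
pose kk : {nonneg R} := NngNum (ltW k0).
unshelve refine (@lebesgue_measure_unique R (mscale kk (pushforward mu (kmul k))) _ A mA).
  exact: mk.
move=> _ [[a b] _ <-].
change (mu `]a, b] = k%:E * mu (kmul k @^-1` `]a, b]%classic))%E.
rewrite (_ : _ @^-1` _ = [set` `]k^-1 * a, k^-1 * b]%R]); last first.
  by apply/seteqP; split => x /=; rewrite /kmul !in_itv/= ltr_pdivrMl// ler_pdivlMl.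
rewrite !lebesgue_measure_itv/= !lte_fin ltr_pM2l ?invr_gt0//.
case: ifPn => ab; last by rewrite mule0.
by rewrite -!EFinB -EFinM -mulrBr mulrA divff ?gt_eqF// mul1r.
Qed.

Lemma ge0_integral_scale k (D : set R) (f : R -> \bar R) : 0 < k ->
  measurable D -> measurable_fun D f -> (forall x, D x -> (0 <= f x)%E) ->
  (\int[mu]_(x in kmul k @^-1` D) f (k * x)%R = k^-1%:E * \int[mu]_(x in D) f x)%E.
Proof.
move=> k0 mD mf f0; have mk := measurable_kmul k.
have k'0 : 0 <= k^-1 by rewrite invr_ge0 ltW.
rewrite (_ : k^-1%:E = (NngNum k'0)%:num%:E)//.
rewrite -ge0_integral_mscale//.
rewrite -(@ge0_integral_pushforward _ _ _ _ _ _ mk mu D f)//; last by move=> x; rewrite inE; exact: f0.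
by apply: eq_measure_integral => //= A mA _; exact: lebesgue_scale.
Qed.

Lemma ge0_pint_scale k f : 0 < k -> pmeas f -> (forall x, 0 < x -> 0 <= f x) ->
  pint (fun x => f (k * x)) = k^-1 * pint f.
Proof.
move=> k0 mf f0; rewrite /pint /Rintegral.
have mfE : measurable_fun [set` `](0 : R), +oo[] (EFin \o f) by exact/measurable_EFinP.
have := ge0_integral_scale k0 (measurable_itv _) mfE _.
rewrite (_ : kmul k @^-1` _ = [set` `](0 : R), +oo[]); last first.
  by apply/seteqP; split=> x /=; rewrite /kmul !in_itv/= !andbT pmulr_rgt0.
move=> -> //; last by move=> x /posE x0; rewrite lee_fin f0.
have := @integral_ge0 _ _ _ mu [set` `](0 : R), +oo[] (EFin \o f).
case: (\int[mu]_(x in _) (EFin \o f) x)%E => [r _//|_|].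
  by rewrite gt0_muley ?lte_fin ?invr_gt0//= mulr0.
move=> h; have : (0 <= -oo :> \bar R)%E.
  by apply: h => x /posE x0; rewrite lee_fin f0.
by [].
Qed.

End half_line_parameter.

(** * The Gamma function and rotated Gamma integrals *)

Section powers.
Context {R : realType}.
Implicit Types (f g F U : R -> R) (x y a b d k r u v A B C M e : R).

Lemma powR_mulB1 x a : 0 < x -> x `^ a = x * x `^ (a - 1).
Proof.
by move=> x0; rewrite -[X in X * _](powRr1 (ltW x0)) -powRD ?(gt_eqF x0) ?implybT//; congr (_ `^ _); ring.
Qed.

Lemma powR_add x a b : 0 < x -> x `^ (a + b) = x `^ a * x `^ b.
Proof. by move=> x0; rewrite powRD// (gt_eqF x0) implybT. Qed.

Lemma powR_between x a b c : 0 < x -> a <= b -> b <= c ->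
  x `^ b <= x `^ a + x `^ c.
Proof.
move=> x0 ab bc; have [x1|x1] := leP x 1.
  by rewrite (le_trans (ger_powR _ ab)) ?x0// lerDl powR_ge0.
by rewrite (le_trans (ler_powR (ltW x1) bc))// lerDr powR_ge0.
Qed.

Lemma norm_ln_le x e : 0 < x -> 0 < e ->
  `|ln x| <= e^-1 * (x `^ e + x `^ (- e)).
Proof.
move=> x0 e0; rewrite ler_pdivlMl// -[e in e * _]gtr0_norm// -normrM.
have h (z : R) : 0 < z -> ln z <= z by move=> z0; exact/ltW/ln_sublinear.
have lnp b : ln (x `^ b) = b * ln x by rewrite ln_powR.
rewrite ler_norml; apply/andP; split.
  rewrite lerNl -mulNr -lnp (le_trans (h _ (powR_gt0 _ x0)))// lerDr powR_ge0 //.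
by rewrite -lnp (le_trans (h _ (powR_gt0 _ x0)))// lerDl powR_ge0.
Qed.

Lemma cvg_pow_at0 d : 0 < d -> x `^ d @[x --> 0^'+] --> (0 : R).
Proof.
move=> d0; apply/cvgrPdist_le => /= e e0; near=> x.
have x0 : 0 < x by near: x; exact: nbhs_right_gt.
rewrite sub0r normrN ger0_norm ?powR_ge0//.
have xe : x <= e `^ (d^-1).
  by near: x; apply: nbhs_right_le; rewrite powR_gt0.
apply: le_trans (ge0_ler_powR (ltW d0) _ _ xe) _; rewrite ?nnegrE ?powR_ge0 ?(ltW x0)//.
by rewrite -powRrM mulVf ?gt_eqF// powRr1// ltW.
Unshelve. all: by end_near. Qed.

Lemma cvg_pow_aty d : 0 < d -> x `^ (- d) @[x --> +oo%R] --> (0 : R).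
Proof.
move=> d0; apply/cvgrPdist_le => /= e e0; near=> x.
have x0 : 0 < x by near: x; exact: nbhs_pinfty_gt.
rewrite sub0r normrN ger0_norm ?powR_ge0// powRN.
rewrite -[leRHS]invrK lef_pV2 ?posrE ?invr_gt0 ?powR_gt0//.
have ei : 0 <= e^-1 by rewrite invr_ge0 ltW.
have xe : (e^-1) `^ (d^-1) <= x by near: x; apply: nbhs_pinfty_ge; exact: num_real.
apply: le_trans _ (ge0_ler_powR (ltW d0) _ _ xe); rewrite ?nnegrE ?powR_ge0 ?(ltW x0)//.
by rewrite -powRrM mulVf ?gt_eqF// powRr1.
Unshelve. all: by end_near. Qed.

Lemma squeeze0 {F : set_system R} {FF : Filter F} U (g : R -> R) :
  (\forall x \near F, `|U x| <= g x) -> g x @[x --> F] --> (0 : R) ->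
  U x @[x --> F] --> (0 : R).
Proof.
move=> Ug g0; apply: norm_cvg0.
apply: (@squeeze_cvgr _ F _ R (fun _ => 0) g) => //; last exact: cvg_cst.
by apply: filterS Ug => x ->; rewrite normr_ge0.
Qed.

Lemma cvg_at0_le U C d : 0 < d -> (forall x, 0 < x -> x <= 1 -> `|U x| <= C * x `^ d) ->
  U x @[x --> 0^'+] --> (0 : R).
Proof.
move=> d0 h; apply: (@squeeze0 _ _ U (fun x => C * x `^ d)).
  near=> x; apply: h; first by near: x; exact: nbhs_right_gt.
  by near: x; exact: nbhs_right_le.
by rewrite -[X in _ --> X](mulr0 C); apply: cvgM; [exact: cvg_cst|exact: cvg_pow_at0].
Unshelve. all: by end_near. Qed.

Lemma cvg_aty_le U C d : 0 < d -> (forall x, 1 <= x -> `|U x| <= C * x `^ (- d)) ->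
  U x @[x --> +oo%R] --> (0 : R).
Proof.
move=> d0 h; apply: (@squeeze0 _ _ U (fun x => C * x `^ (- d))).
  by near=> x; apply: h; near: x; apply: nbhs_pinfty_ge; exact: num_real.
by rewrite -[X in _ --> X](mulr0 C); apply: cvgM; [exact: cvg_cst|exact: cvg_pow_aty].
Unshelve. all: by end_near. Qed.

(** Mean value theorem; [m] is the constant slope. *)
Lemma eq_of_derive f m u v : (forall x, u < x -> x < v -> is_derive x (1 : R) f m) ->
  forall x y, u < x -> x < v -> u < y -> y < v -> f y - f x = m * (y - x).
Proof.
move=> df; suff H x y : u < x -> x < y -> y < v -> f y - f x = m * (y - x).
  move=> x y ux xv uy yv; have [xy|yx|->] := ltgtP x y; last by rewrite !subrr mulr0.
    exact: H.
  by rewrite -opprB (H y x)// -mulrN opprB.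
move=> ux xy yv.
have [] := @MVT R f (fun _ => m) x y xy; last by move=> c _ ->.
  move=> c; rewrite in_itv/= => /andP[xc cy].
  by apply: df; [exact: lt_trans xc|exact: lt_trans yv].
apply: continuous_in_subspaceT => c; rewrite inE/= in_itv/= => /andP[xc cy].
by apply: dv_cts; apply: df; [exact: lt_le_trans xc|exact: le_lt_trans yv].
Qed.

(** [U] and [r * V] are the real and imaginary parts, in polar coordinates, of
  a holomorphic function: by the Cauchy-Riemann equations the angular
  derivative of the ray integral of [V] is a boundary term. *)
Lemma ray_integral_dv (U V w : R -> R -> R) G u v A B :
  (forall th, u < th -> th < v -> pintegrable (fun r => V r th)) ->
  (forall th r, u < th -> th < v -> 0 < r -> is_derive th (1 : R) (V r) (w r th)) ->
  (forall th r, u < th -> th < v -> 0 < r ->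
     is_derive r (1 : R) (fun r => U r th) (w r th)) ->
  (forall th r, u < th -> th < v -> 0 < r -> {for r, continuous (fun r => w r th)}) ->
  pintegrable G ->
  (forall th r, u < th -> th < v -> 0 < r -> `|w r th| <= G r) ->
  (forall th, u < th -> th < v -> U r th @[r --> 0^'+] --> A) ->
  (forall th, u < th -> th < v -> U r th @[r --> +oo%R] --> B) ->
  forall th1 th2, u < th1 -> th1 < v -> u < th2 -> th2 < v ->
  pint (fun r => V r th2) - pint (fun r => V r th1) = (B - A) * (th2 - th1).
Proof.
move=> IV dV dU cw IG wG UA UB th1 th2 h1 h2 h3 h4.
apply: (@eq_of_derive (fun th => pint (fun r => V r th)) (B - A) u v) => // th uth thv.
apply: dv_eq.
  apply: (@pint_dv R (fun th r => V r th) (fun th r => w r th) th u v G) => //.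
apply: (@pint_ftc R (fun r => U r th)) => //.
- by move=> r r0; exact: dU.
- by move=> r r0; exact: cw.
- apply: (@pintegrable_le _ _ G) => //; last by move=> r r0; exact: wG.
  by apply: pmeas_cts => r r0; exact: cw.
- exact: UA.
- exact: UB.
Qed.

End powers.

Section gamma.
Context {R : realType}.
Implicit Types (f g F U : R -> R) (x y a b d k r u v A B C M e al : R).

Lemma pintegrable_stretched_exp al b k : 0 < al -> 0 < b -> 0 < k ->
  pintegrable (fun r => r `^ (b - 1) * expR (- (k * r `^ al))).
Proof.
move=> al0 b0 k0; have p0 : 0 <= 2 * b / al by rewrite divr_ge0 ?mulr_ge0// ltW.
have [C C_ge0 hC] := expR_pow_bound k0 p0.
apply: (@pintegrable_two_sided _ _ (1 + C) b) => //; first by mf.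
- move=> r r0 r1; rewrite ger0_norm ?mulr_ge0 ?powR_ge0 ?expR_ge0//.
  rewrite mulrC ler_wpM2r ?powR_ge0// (@le_trans _ _ 1)//; last by rewrite lerDl.
  by rewrite -expR0 ler_expR oppr_le0 mulr_ge0 ?powR_ge0// ltW.
- move=> r r1; have r0 : 0 < r by exact: lt_le_trans r1.
  rewrite ger0_norm ?mulr_ge0 ?powR_ge0 ?expR_ge0//.
  apply: (@le_trans _ _ (r `^ (b - 1) * (C * (r `^ al) `^ (- (2 * b / al))))).
    by rewrite ler_wpM2l ?powR_ge0// hC// powR_gt0.
  rewrite mulrCA -powRrM -powR_add//.
  rewrite (_ : b - 1 + al * - (2 * b / al) = - b - 1); last by field; rewrite gt_eqF.
  by rewrite ler_wpM2r ?powR_ge0// lerDr.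
Qed.

Lemma pintegrable_gamma a k : 0 < a -> 0 < k ->
  pintegrable (fun r => r `^ (a - 1) * expR (- (k * r))).
Proof.
move=> a0 k0; apply: pintegrable_eq (pintegrable_stretched_exp ltr01 a0 k0) => r r0.
by rewrite powRr1 ?(ltW r0).
Qed.

Lemma GammaE a : Gamma a = pint (fun r => r `^ (a - 1) * expR (- r)).
Proof. by []. Qed.

Lemma pintegrable_gamma1 a : 0 < a -> pintegrable (fun r => r `^ (a - 1) * expR (- r)).
Proof.
move=> a0; have := pintegrable_gamma a0 ltr01.
by apply: pintegrable_eq => r _; rewrite mul1r.
Qed.

Lemma pint_gamma a k : 0 < a -> 0 < k ->
  pint (fun r => r `^ (a - 1) * expR (- (k * r))) = k `^ (- a) * Gamma a.
Proof.
move=> a0 k0; pose f r := r `^ (a - 1) * expR (- r).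
have f0 r : 0 < r -> 0 <= f r by move=> r0; rewrite mulr_ge0 ?powR_ge0 ?expR_ge0.
have mf : pmeas f by exact: pintegrable_meas (pintegrable_gamma1 a0).
have := ge0_pint_scale k0 mf f0.
rewrite (_ : pint (fun x => f (k * x)) = k `^ (a - 1) *
    pint (fun r => r `^ (a - 1) * expR (- (k * r)))); last first.
  rewrite -pintZ; last exact: pintegrable_gamma.
  by apply: eq_pint => r r0; rewrite /f powRM ?ltW// mulrA.
rewrite GammaE -/f => h.
have kp : k `^ (a - 1) != 0 by rewrite gt_eqF// powR_gt0.
apply: (mulfI kp); rewrite h mulrA -powR_add//.
by congr (_ * _); rewrite (_ : a - 1 - a = - 1); [rewrite powR_inv1 ?ltW|ring].
Qed.

(** The integrand is bounded below by a positive constant between [1] and [2]. *)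
Lemma Gamma_gt0 a : 0 < a -> 0 < Gamma a.
Proof.
move=> a0; pose c := expR (- (2 * `|a - 1|) - 2).
have c0 : 0 < c by exact: expR_gt0.
pose I : set R := [set` `[1, 2]%R].
have mI : measurable I by exact: measurable_itv.
have subI : I `<=` [set` `](0 : R), +oo[].
  by move=> x; rewrite /I/= !in_itv/= andbT => /andP[h _]; exact: lt_le_trans h.
have e2 : pint (cst c \_ I) = c.
  have mI1 : (lebesgue_measure I = 1)%E.
    rewrite /I lebesgue_measure_itv/= lte_fin ltr1n -EFinB; congr EFin; lra.
  by rewrite /pint -Rintegral_mkcondr setIidr// Rintegral_cst//= mI1 mulr1.
have rI r : 0 < r -> (cst c \_ I) r = if (1 <= r) && (r <= 2) then c else 0.
  move=> r0; rewrite patchE; case: ifPn => [|].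
    by rewrite inE /I/= in_itv/= => ->.
  by rewrite notin_setE /I/= in_itv/= => /negP/negbTE ->.
have i2 : pintegrable (cst c \_ I).
  apply: (@pintegrable_le _ _ (fun x => (5 * c) * hump 1 x)).
  - apply/measurable_restrict => //.
  - exact/pintegrableZ/pintegrable_hump.
  - move=> r r0; rewrite rI//; case: ifPn => [/andP[r1 r2]|_]; last first.
      by rewrite normr0 mulr_ge0 ?hump_ge0// mulr_ge0// ltW.
    rewrite gtr0_norm// /hump powRr1 ?(ltW r0)// subrr powRr0 mul1r ler_pdivlMr.
      by rewrite mulrC ler_wpM2r ?(ltW c0)//; nra.
    by rewrite addr_gt0// exprn_gt0.
apply: (lt_le_trans c0); rewrite -e2 GammaE; apply: le_pint => //.
  exact: pintegrable_gamma1.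
move=> r r0; rewrite rI//; case: ifPn => [/andP[r1 r2]|_]; last first.
  by rewrite mulr_ge0 ?powR_ge0 ?expR_ge0.
rewrite /powR gt_eqF// -expRD ler_expR lerD ?lerN2//.
have l0 : 0 <= ln r by exact: ln_ge0.
have l2 : ln r <= 2 by rewrite (le_trans _ r2)// ltW// ln_sublinear.
rewrite (@le_trans _ _ (- (ln r * `|a - 1|)))//.
  by rewrite lerN2 ler_wpM2r.
by rewrite mulrC -mulNr ler_wpM2r// lerNnormlW.
Qed.

Lemma Gamma_rec a : 0 < a -> Gamma (a + 1) = a * Gamma a.
Proof.
move=> a0; pose F r := r `^ a * expR (- r).
pose f r := a * (r `^ (a - 1) * expR (- r)) - r `^ (a + 1 - 1) * expR (- r).
have a1 : 0 < a + 1 by rewrite addr_gt0.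
have I1 := pintegrable_gamma1 a0; have I2 := pintegrable_gamma1 a1.
have a20 : 0 <= 2 * a by lra.
have [C C0 hC] := expR_pow_bound ltr01 a20.
have : pint f = 0 - 0.
  apply: (@pint_ftc _ F).
  - move=> r r0; rewrite /F /f addrK; eapply dv_eq; first by dv.
    by ring.
  - move=> r r0; rewrite /f; eapply dv_cts; dv => //.
  - by apply: pintegrableB => //; exact: pintegrableZ.
  - apply: (@cvg_at0_le _ _ 1 a) => // r r0 r1.
    rewrite mul1r /F ger0_norm ?mulr_ge0 ?powR_ge0 ?expR_ge0// ler_piMr ?powR_ge0//.
    by rewrite -expR0 ler_expR oppr_le0 ltW.
  - apply: (@cvg_aty_le _ _ C a) => // r r1.
    have r0 : 0 < r by exact: lt_le_trans r1.
    rewrite /F ger0_norm ?mulr_ge0 ?powR_ge0 ?expR_ge0//.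
    apply: (@le_trans _ _ (r `^ a * (C * r `^ (- (2 * a))))).
      by rewrite ler_wpM2l ?powR_ge0//; have := hC r r0; rewrite mul1r.
    rewrite mulrCA -powR_add// (_ : a - 2 * a = - a); last by ring.
    exact: lexx.
rewrite subrr /f pintB//; last exact: pintegrableZ.
by rewrite pintZ// -!GammaE => /eqP; rewrite subr_eq0 => /eqP.
Qed.

Definition Gamma' a := pint (fun r => r `^ (a - 1) * ln r * expR (- r)).

(** Dominating function for the [a]-derivatives of [r `^ (a - 1)]. *)
Lemma powR_ln_le r b u v e : 0 < r -> 0 < e -> u <= b -> b <= v ->
  `|r `^ (b - 1) * ln r| <= e^-1 *
   ((r `^ (u + e - 1) + r `^ (u - e - 1)) + (r `^ (v + e - 1) + r `^ (v - e - 1))).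
Proof.
move=> r0 e0 ub bv; rewrite normrM ger0_norm ?powR_ge0// mulrC.
have h : r `^ (b - 1) <= r `^ (u - 1) + r `^ (v - 1) by apply: powR_between; rewrite ?lerD2r.
apply: le_trans (ler_pM _ _ (norm_ln_le r0 e0) h) _; rewrite ?powR_ge0//.
rewrite -mulrA ler_wpM2l ?invr_ge0 ?(ltW e0)//.
rewrite mulrDl !mulrDr -!powR_add//.
rewrite (_ : e + (u - 1) = u + e - 1); last by ring.
rewrite (_ : - e + (u - 1) = u - e - 1); last by ring.
rewrite (_ : e + (v - 1) = v + e - 1); last by ring.
rewrite (_ : - e + (v - 1) = v - e - 1); last by ring.
by rewrite addrACA.
Qed.

Lemma dv_powR_exponent r b : 0 < r -> is_derive b (1 : R) (fun b => r `^ (b - 1)) (r `^ (b - 1) * ln r).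
Proof.
move=> r0; rewrite (_ : (fun b => r `^ (b - 1)) = (fun b => expR ((b - 1) * ln r))).
  eapply dv_eq; first by dv.
  by rewrite /powR gt_eqF//; ring.
by apply/funext => b'; rewrite /powR gt_eqF.
Qed.

Lemma dv_Gamma a : 0 < a -> is_derive a (1 : R) (@Gamma R) (Gamma' a).
Proof.
move=> a0; have u0 : 0 < a / 2 by lra.
have ua : a / 2 < a by lra.
have av : a < 2 * a by lra.
pose e := a / 4; have e0 : 0 < e by rewrite /e; lra.
pose G r := e^-1 * (((r `^ (a / 2 + e - 1) * expR (- r) + r `^ (a / 2 - e - 1) * expR (- r)) +
  (r `^ (2 * a + e - 1) * expR (- r) + r `^ (2 * a - e - 1) * expR (- r)))).
apply: (@pint_dv R (fun a r => r `^ (a - 1) * expR (- r))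
  (fun a r => r `^ (a - 1) * ln r * expR (- r)) a (a / 2) (2 * a) G) => //.
- by move=> x ux xv; apply: pintegrable_gamma1; exact: lt_trans ux.
- move=> x y ux xv y0; eapply dv_eq; first by eapply dvM; [exact: dv_powR_exponent|exact: dv_cst].
  by rewrite mulr0 addr0.
- apply: pintegrableZ; apply: pintegrableD; apply: pintegrableD; apply: pintegrable_gamma1; rewrite /e; lra.
- move=> x y ux xv y0; rewrite normrM (ger0_norm (expR_ge0 _)).
  rewrite /G -!mulrDl mulrA ler_wpM2r ?expR_ge0//.
  by apply: powR_ln_le => //; exact: ltW.
Qed.

End gamma.

Section rotated_gamma.
Context {R : realType}.
Implicit Types (f g F U : R -> R) (x y a b d k r u v A B C M e th : R).

Lemma ler_cos_norm x y : `|x| <= y -> y <= pi -> cos y <= cos x.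
Proof.
move=> xy ypi; rewrite -(cos_norm x).
have h z : 0 <= z -> z <= pi -> z \in `[0 : R, pi].
  by move=> z0 z1; rewrite in_itv/= z0.
have y0 : 0 <= y by exact: le_trans xy.
move: xy; rewrite le_eqVlt => /orP[/eqP ->//|xy].
by apply/ltW; rewrite ltr_cos//; apply: h => //; exact: le_trans (ltW xy) ypi.
Qed.

Lemma norm_mul_sin_le k x : 0 <= k -> `|k * sin x| <= k.
Proof. by move=> k0; rewrite normrM ger0_norm// ler_piMr// sin_max. Qed.
Lemma norm_mul_cos_le k x : 0 <= k -> `|k * cos x| <= k.
Proof. by move=> k0; rewrite normrM ger0_norm// ler_piMr// cos_max. Qed.

Lemma pintegrable_rotated_gamma a k th B : 0 < a -> 0 < k -> `|th| < pi / 2 ->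
  pintegrable (fun r => r `^ (a - 1) * expR (- (k * r * cos th)) *
                        sin (B - k * r * sin th)).
Proof.
move=> a0 k0 hth; have c0 : 0 < cos th by apply: cos_gt0_pihalf; rewrite -ltr_norml.
apply: (@pintegrable_le _ _ _ _ (pintegrable_gamma a0 (mulr_gt0 k0 c0))).
  by mf.
move=> r r0; rewrite [k * r * cos th]mulrAC.
by apply: norm_mul_sin_le; rewrite mulr_ge0 ?powR_ge0 ?expR_ge0.
Qed.

(** Euler's integral along the ray of argument [th]. Written in polar
  coordinates, the integrand is the imaginary part of
  [exp (i * (B - a * th)) * z ^ a * exp (- k * z)], divided by [r]; it is
  independent of the ray by [ray_integral_dv], both boundary terms being zero,
  and on the positive axis it is [Gamma]. *)
Lemma rotated_gamma a k th B : 0 < a -> 0 < k -> `|th| < pi / 2 ->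
  pint (fun r => r `^ (a - 1) * expR (- (k * r * cos th)) *
                 sin (B - k * r * sin th)) =
  k `^ (- a) * Gamma a * sin (B - a * th).
Proof.
move=> a0 k0 hth; pose A := B - a * th.
have pi0 := pi_gt0 R.
(* On the sector of half-angle [th0] the exponential decay is uniform. *)
pose th0 := (`|th| + pi / 2) / 2.
have th01 : `|th| < th0 by rewrite /th0; lra.
have th02 : th0 < pi / 2 by rewrite /th0; lra.
have th00 : 0 < th0 by apply: le_lt_trans th01.
pose c := cos th0.
have c0 : 0 < c by apply: cos_gt0_pihalf; rewrite th02 andbT; lra.
have cle t : - th0 < t -> t < th0 -> c <= cos t.
  move=> h1 h2; apply: ler_cos_norm; last by lra.
  by rewrite ler_norml; apply/andP; split; apply/ltW.
pose q r t := A + a * t - k * r * sin t.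
pose V r t := r `^ (a - 1) * expR (- (k * r * cos t)) * sin (q r t).
pose U r t := r `^ a * expR (- (k * r * cos t)) * cos (q r t).
pose w r t := r `^ (a - 1) * expR (- (k * r * cos t)) *
  (k * r * sin t * sin (q r t) + (a - k * r * cos t) * cos (q r t)).
pose G r := a * (r `^ (a - 1) * expR (- (k * c * r))) +
   2 * k * (r `^ (a + 1 - 1) * expR (- (k * c * r))).
have a1 : 0 < a + 1 by lra.
have kc : 0 < k * c by exact: mulr_gt0.
have IG : pintegrable G by apply: pintegrableD; apply: pintegrableZ; exact: pintegrable_gamma.
have Ebound t r : - th0 < t -> t < th0 -> 0 < r ->
    expR (- (k * r * cos t)) <= expR (- (k * c * r)).
  move=> h1 h2 r0; rewrite ler_expR lerN2 mulrAC ler_wpM2l ?cle//.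
  by rewrite mulr_ge0// ltW.
have Ubound t r : - th0 < t -> t < th0 -> 0 < r ->
    `|U r t| <= r `^ a * expR (- (k * c * r)).
  move=> h1 h2 r0; apply: le_trans (norm_mul_cos_le _ _) _.
    by rewrite mulr_ge0 ?powR_ge0 ?expR_ge0.
  by rewrite ler_wpM2l ?powR_ge0// Ebound.
have hth' : - th0 < th /\ th < th0 by move: th01; rewrite ltr_norml => /andP.
have key : pint (fun r => V r th) - pint (fun r => V r 0) = (0 - 0) * (th - 0).
  apply: (@ray_integral_dv R U V w G (- th0) th0 0 0) => //.
  - move=> t h1 h2; have ht : `|t| < pi / 2.
      by rewrite ltr_norml; apply/andP; split; lra.
    have := @pintegrable_rotated_gamma a k t (A + a * t) a0 k0 ht.
    by apply: pintegrable_eq => r r0.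
  - move=> t r h1 h2 r0; rewrite /V /w /q; eapply dv_eq; first by dv.
    by ring.
  - move=> t r h1 h2 r0; rewrite /U /w /q; eapply dv_eq; first by dv.
    by rewrite (powR_mulB1 a r0); ring.
  - move=> t r h1 h2 r0; rewrite /w /q; eapply dv_cts; dv => //.
  - move=> t r h1 h2 r0; rewrite /w normrM.
    rewrite (ger0_norm (mulr_ge0 (powR_ge0 _ _) (expR_ge0 _))).
    rewrite (_ : G r = r `^ (a - 1) * expR (- (k * c * r)) * (k * r + (a + k * r))); last first.
      by rewrite /G addrK (powR_mulB1 a r0); ring.
    apply: ler_pM => //; first by rewrite mulr_ge0 ?powR_ge0 ?expR_ge0.
      by rewrite ler_wpM2l ?powR_ge0// Ebound.
    have kr : 0 <= k * r by rewrite mulr_ge0// ltW.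
    apply: le_trans (ler_normD _ _) _; apply: lerD.
      rewrite normrM -[leRHS]mulr1 ler_pM ?sin_max//; exact: norm_mul_sin_le.
    rewrite normrM -[leRHS]mulr1 ler_pM ?cos_max//.
    apply: le_trans (ler_normB _ _) _; apply: lerD; first by rewrite gtr0_norm.
    exact: norm_mul_cos_le.
  - move=> t h1 h2; apply: (@cvg_at0_le _ _ 1 a) => // r r0 r1.
    apply: le_trans (Ubound _ _ h1 h2 r0) _; rewrite mul1r ler_piMr ?powR_ge0//.
    by rewrite -expR0 ler_expR oppr_le0 mulr_ge0// ltW.
  - move=> t h1 h2.
    have a20 : 0 <= 2 * a by lra.
    have [C C0 hC] := expR_pow_bound kc a20.
    apply: (@cvg_aty_le _ _ C a) => // r r1; have r0 : 0 < r by exact: lt_le_trans r1.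
    apply: le_trans (Ubound _ _ h1 h2 r0) _.
    apply: (@le_trans _ _ (r `^ a * (C * r `^ (- (2 * a))))).
      by rewrite ler_wpM2l ?powR_ge0// hC.
    rewrite mulrCA -powR_add// (_ : a - 2 * a = - a); last by ring.
    exact: lexx.
  - by rewrite oppr_lt0.
  - by case: hth'.
  - by case: hth'.
move: key; rewrite subrr mul0r => /eqP; rewrite subr_eq0 => /eqP.
rewrite (_ : pint (fun r => V r 0) = k `^ (- a) * Gamma a * sin A) => [<-|].
  by apply: eq_pint => r r0; rewrite /V /q /A subrK.
rewrite -pint_gamma// mulrC -pintZ; last exact: pintegrable_gamma.
apply: eq_pint => r r0; rewrite /V /q cos0 sin0 !mulr0 mulr1 subr0 addr0.
by rewrite mulrC.
Qed.

End rotated_gamma.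

(** * The contour kernel *)

Lemma powR_natX (R : realType) (x a : R) m : (x `^ a) ^+ m = x `^ (a * m%:R).
Proof. by rewrite -powR_mulrn ?powR_ge0// powRrM. Qed.

(** Below [r0] the constant absorbs the power, above it the linear term does. *)
Lemma powR_sublinear (R : realType) (al x k : R) : 0 < al -> al < 1 -> 0 <= x -> 0 < k ->
  exists M, forall r, 0 < r -> x * r `^ al <= M + k * r.
Proof.
move=> al0 al1 x0 k0; have c0 : 0 < 1 - al by rewrite subr_gt0.
pose r0 := (x / k) `^ ((1 - al)^-1); exists (x * r0 `^ al) => r r0'.
have [rr|rr] := leP r r0.
  rewrite (@le_trans _ _ (x * r0 `^ al))//.
    by rewrite ler_wpM2l// ge0_ler_powR ?nnegrE ?(ltW r0') ?powR_ge0// ltW.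
  by rewrite lerDl mulr_ge0 ?(ltW r0')// ltW.
rewrite (@le_trans _ _ (k * r))//; last by rewrite lerDr mulr_ge0 ?powR_ge0.
have q0 : 0 <= x / k by rewrite divr_ge0// ltW.
have h : x / k <= r `^ (1 - al).
  have -> : x / k = r0 `^ (1 - al) by rewrite /r0 -powRrM mulVf ?powRr1 // gt_eqF.
  by rewrite ge0_ler_powR ?nnegrE ?powR_ge0 ?(ltW r0') ?(ltW rr)// ltW.
have e : r = r `^ (1 - al) * r `^ al by rewrite -powR_add// subrK powRr1// ltW.
rewrite [in leRHS]e mulrA ler_wpM2r ?powR_ge0//.
by move: h; rewrite ler_pdivrMr// mulrC.
Qed.

Lemma partial_sum_le_expR (R : realType) (x : R) n : 0 <= x ->
  \sum_(0 <= m < n) x ^+ m / m`!%:R <= expR x.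
Proof.
move=> x0; rewrite -[leLHS]/(series (exp_coeff x) n).
apply: nondecreasing_cvgn_le; last exact: is_cvg_series_exp_coeff.
by apply: nondecreasing_series => m _ _; exact: exp_coeff_ge0.
Qed.

Section exp_sin.
Context {R : realType}.
Implicit Types (u v q p x : R).

Lemma le_of_derive (f g f' g' : R -> R) u : 0 <= u ->
  (forall v, is_derive v (1 : R) f (f' v)) ->
  (forall v, is_derive v (1 : R) g (g' v)) ->
  (forall v, 0 <= v -> v <= u -> f' v <= g' v) -> f 0 <= g 0 -> f u <= g u.
Proof.
move=> u0 df dg fg h0; move: u0; rewrite le_eqVlt => /orP[/eqP <-//|u0].
have dh v : is_derive v (1 : R) (fun v => g v - f v) (g' v - f' v).
  by eapply dvD; [exact: dg|eapply dvN; exact: df].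
have [] := @MVT R (fun v => g v - f v) (fun v => g' v - f' v) 0 u u0 (fun v _ => dh v).
  by apply: continuous_subspaceT => v; exact: dv_cts (dh v).
move=> c; rewrite in_itv/= => /andP[c0 cu] e.
have : 0 <= (g' c - f' c) * (u - 0).
  by rewrite mulr_ge0 ?subr_ge0 ?(ltW u0)// fg// ltW.
by rewrite -e; lra.
Qed.

(** Taylor's formula for the imaginary part of
  [exp (i * q) * exp (u * exp (i * p))]: each derivative in [u] advances the
  phase [q] by [p], so induction on [n] integrates the bound of the previous
  order. The bound is first proved with [expR N] uniformly for [u <= N], which
  is what the integration needs. *)
Lemma exp_sin_taylor p n : forall u q, 0 <= u ->
  `|expR (u * cos p) * sin (q + u * sin p) -
    \sum_(0 <= m < n) u ^+ m / m`!%:R * sin (q + p * m%:R)| <=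
  expR u * (u ^+ n / n`!%:R).
Proof.
suff H (N : R) : 0 <= N -> forall u q, 0 <= u -> u <= N ->
  `|expR (u * cos p) * sin (q + u * sin p) -
    \sum_(0 <= m < n) u ^+ m / m`!%:R * sin (q + p * m%:R)| <=
  expR N * (u ^+ n / n`!%:R).
  by move=> u q u0; apply: H.
move=> N0; elim: n => [|n IH] u q u0 uN.
  rewrite big_nil subr0 expr0 fact0 divr1 mulr1.
  apply: le_trans (norm_mul_sin_le _ (expR_ge0 _)) _; rewrite ler_expR.
  apply: le_trans (ler_norm _) _; apply: le_trans (norm_mul_cos_le _ u0) _.
  exact: uN.
pose f v := expR (v * cos p) * sin (q + v * sin p) -
    \sum_(0 <= m < n.+1) v ^+ m / m`!%:R * sin (q + p * m%:R).
pose f' v := expR (v * cos p) * sin (q + p + v * sin p) -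
    \sum_(0 <= m < n) v ^+ m / m`!%:R * sin (q + p + p * m%:R).
pose g v := expR N * (v ^+ n.+1 / n.+1`!%:R).
pose g' v := expR N * (v ^+ n / n`!%:R).
have facS m : m.+1`!%:R = m.+1%:R * m`!%:R :> R by rewrite factS natrM.
have fac0 m : m`!%:R != 0 :> R by rewrite pnatr_eq0 -lt0n fact_gt0.
have dg v : is_derive v (1 : R) g (g' v).
  rewrite /g /g'; eapply dv_eq; first by dv.
  by rewrite /= facS; have := fac0 n => h; field; rewrite h addrC natr1 pnatr_eq0.
have dsum v : is_derive v (1 : R)
    (fun v => \sum_(0 <= m < n.+1) v ^+ m / m`!%:R * sin (q + p * m%:R))
    (\sum_(0 <= m < n) v ^+ m / m`!%:R * sin (q + p + p * m%:R)).
  have -> : (fun v => \sum_(0 <= m < n.+1) v ^+ m / m`!%:R * sin (q + p * m%:R)) =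
      (fun v => sin q + \sum_(0 <= m < n) v ^+ m.+1 / m.+1`!%:R * sin (q + p * m.+1%:R)).
    apply/funext => w; rewrite big_nat_recl//= expr0 fact0 divr1 mul1r mulr0 addr0.
    by [].
  rewrite -[X in is_derive _ _ _ X]add0r; eapply dvD; first exact: dv_cst.
  elim: n {IH f f' g g' dg} => [|n IHn].
    rewrite big_nil; under eq_fun do rewrite big_nil; exact: dv_cst.
  rewrite big_nat_recr//=; under eq_fun do rewrite big_nat_recr//=.
  eapply dvD; first exact: IHn.
  eapply dv_eq; first by dv.
  rewrite /= facS (_ : q + p * n.+1%:R = q + p + p * n%:R); last by rewrite -natr1; ring.
  by have := fac0 n => h; field; rewrite h addrC natr1 pnatr_eq0.
have df v : is_derive v (1 : R) f (f' v).
  eapply dvD; last by eapply dvN; exact: dsum.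
  eapply dv_eq; first by dv.
  rewrite (_ : q + p + v * sin p = q + v * sin p + p); last by ring.
  by rewrite [sin (_ + p)]sinD; ring.
have f0 : f 0 = 0.
  rewrite /f mul0r expR0 mul1r mul0r addr0 big_nat_recl//= expr0 fact0 divr1 mul1r mulr0 addr0.
  rewrite big1 ?addr0 ?subrr// => m _; by rewrite expr0n/= !mul0r.
have g0 : g 0 = 0 by rewrite /g expr0n/= mul0r mulr0.
have fg v : 0 <= v -> v <= u -> `|f' v| <= g' v.
  by move=> v0 vu; apply: IH => //; exact: le_trans uN.
rewrite -[X in `|X|]/(f u) -[leRHS]/(g u) ler_norml; apply/andP; split.
  rewrite lerNl; apply: (@le_of_derive (fun v => - f v) g (fun v => - f' v) g') => //.
  - by move=> v v0 vu; have := fg v v0 vu; rewrite ler_norml => /andP[]; lra.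
  - by rewrite f0 g0 oppr0.
apply: (@le_of_derive f g f' g') => //.
- by move=> v v0 vu; have := fg v v0 vu; rewrite ler_norml => /andP[].
- by rewrite f0 g0.
Qed.

Lemma sinD_natpi x m : sin (x + pi * m%:R) = (-1) ^+ m * sin x.
Proof.
elim: m => [|m IH]; first by rewrite mulr0 addr0 expr0 mul1r.
rewrite -natr1 mulrDr mulr1 addrA sinDpi IH exprS; ring.
Qed.

(** The exponential series of [- u * exp (i * p)], multiplied by [exp (i * q)],
  in imaginary parts. *)
Lemma exp_sin_series u q p : 0 <= u ->
  \sum_(0 <= m < n) (- u) ^+ m / m`!%:R * sin (q + p * m%:R) @[n --> \oo] -->
  expR (- (u * cos p)) * sin (q - u * sin p).
Proof.
move=> u0; set L := expR _ * _.
(* the signs are absorbed in the phase: [- exp (i * p) = exp (i * (p + pi))] *)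
have E n : \sum_(0 <= m < n) (- u) ^+ m / m`!%:R * sin (q + p * m%:R) =
    \sum_(0 <= m < n) u ^+ m / m`!%:R * sin (q + (p + pi) * m%:R).
  apply: eq_bigr => m _; rewrite exprNn mulrDl addrA.
  by rewrite sinD_natpi; ring.
have c0 : expR u * exp_coeff u n @[n --> \oo] --> 0.
  by rewrite -(mulr0 (expR u)); apply: cvgM; [exact: cvg_cst|exact: cvg_exp_coeff].
under eq_fun do rewrite E.
have LE : L = expR (u * cos (p + pi)) * sin (q + u * sin (p + pi)).
  by rewrite cosDpi sinDpi !mulrN.
apply/cvgrPdist_le => /= e e0.
have /cvgr0_norm_le/(_ e e0) := c0; apply: filterS => n; apply: le_trans.
by rewrite LE (le_trans (exp_sin_taylor _ _ _ u0))// ler_norm.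
Qed.

End exp_sin.

(** With [z = r * exp (i * (th + pi))], this is
  [Im (exp (i * B) * r ^ (a - 1) * exp (t * z - x * z ^ al))]; [th] will lie in
  ]- pi / 2, 0[, so that [z] runs over a ray of the open left half-plane while
  [z ^ al] stays in the right half-plane. *)
Definition ker (R : realType) (al th t a x B r : R) : R :=
  r `^ (a - 1) * expR (- (t * r * cos th)) *
  expR (- (x * r `^ al * cos (al * (th + pi)))) *
  sin (B - t * r * sin th - x * r `^ al * sin (al * (th + pi))).

(** The two constraints [pi / 2 < th + pi] and [al * (th + pi) < pi / 2] make
  [exp (t * z)] and [exp (- x * z ^ al)] both decrease along the ray; they are
  compatible because [al < 1]. *)
Definition contour_angle (R : realType) (al th : R) : Prop :=
  [/\ 0 < al < 1, - (pi / 2) < th, th < 0 & al * (th + pi) < pi / 2].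

Lemma contour_angle_exists (R : realType) (al : R) : 0 < al < 1 ->
  exists th, contour_angle al th.
Proof.
move=> /andP[al0 al1]; have pi0 := pi_gt0 R.
(* [th + pi] must lie strictly between [pi / 2] and [pi / (2 * al)]. *)
pose m := Num.min 1 (al^-1 - 1); exists (pi / 2 * (m / 2 - 1)).
have m0 : 0 < m by rewrite lt_min ltr01 subr_gt0 invf_gt1.
have m1 : m <= 1 by rewrite ge_min lexx.
have m2 : m <= al^-1 - 1 by rewrite ge_min lexx orbT.
have am : al * m <= 1 - al.
  by apply: le_trans (ler_wpM2l (ltW al0) m2) _; rewrite mulrBr mulr1 divff ?gt_eqF.
split; first by rewrite al0.
- rewrite mulrBr mulr1; have h : 0 < pi / 2 * (m / 2) by apply: mulr_gt0; lra.
  lra.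
- by rewrite pmulr_rlt0; lra.
- rewrite (_ : al * _ = pi / 2 * (al * (1 + m / 2))); last by field.
  by rewrite gtr_pMr; lra.
Qed.

Section kernel.
Context {R : realType}.
Variables (al th : R).
Implicit Types (f g F U : R -> R) (x y a b d k r u v A B C M e t s : R).
Hypothesis angle : contour_angle al th.

Local Notation phi := (al * (th + pi)).
Local Notation kerr := (ker al th).

Lemma al_gt0 : 0 < al. Proof. by case: angle => /andP[]. Qed.
Lemma al_lt1 : al < 1. Proof. by case: angle => /andP[]. Qed.
Let al0 := al_gt0.

Lemma costh_gt0 : 0 < cos th.
Proof.
by case: angle => _ h1 h2 _; apply: cos_gt0_pihalf; have pi0 := pi_gt0 R; rewrite h1/=; lra.
Qed.

Lemma phi_gt0 : 0 < phi.
Proof. by case: angle => _ h1 h2 _; apply: mulr_gt0 => //; have pi0 := pi_gt0 R; lra. Qed.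

Lemma cosphi_gt0 : 0 < cos phi.
Proof.
case: angle => _ _ _ alth; apply: cos_gt0_pihalf; rewrite alth andbT; have p0 := phi_gt0; have pi0 := pi_gt0 R; lra. Qed.

Lemma norm_th : `|th| < pi / 2.
Proof. by case: angle => _ thN h2 _; rewrite ltr_norml thN/=; have pi0 := pi_gt0 R; lra. Qed.

Lemma norm_phi : `|phi| < pi / 2.
Proof. by case: angle => _ _ _ alth; rewrite ltr_norml alth andbT; have p0 := phi_gt0; have pi0 := pi_gt0 R; lra. Qed.

Lemma pmeas_ker t a x B : pmeas (kerr t a x B).
Proof. by rewrite /ker; mf. Qed.

Lemma expker_le1 x r : 0 <= x -> expR (- (x * r `^ al * cos phi)) <= 1.
Proof.
move=> x0; rewrite -expR0 ler_expR oppr_le0 mulr_ge0 ?(ltW cosphi_gt0)//.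
by rewrite mulr_ge0 ?powR_ge0.
Qed.

Lemma ker_le_exp t a x B r :
  `|kerr t a x B r| <= r `^ (a - 1) * expR (- (t * cos th * r)) *
    expR (- (x * r `^ al * cos phi)).
Proof.
rewrite /ker [t * r * cos th]mulrAC.
by apply: norm_mul_sin_le; rewrite !mulr_ge0 ?powR_ge0 ?expR_ge0.
Qed.

Lemma ker_le t a x B r : 0 <= x ->
  `|kerr t a x B r| <= r `^ (a - 1) * expR (- (t * cos th * r)).
Proof.
move=> x0; apply: le_trans (ker_le_exp _ _ _ _ _) _.
by rewrite ler_piMr ?expker_le1// mulr_ge0 ?powR_ge0 ?expR_ge0.
Qed.

Lemma pintegrable_kerdom t a : 0 < t -> 0 < a ->
  pintegrable (fun r => r `^ (a - 1) * expR (- (t * cos th * r))).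
Proof. by move=> t0 a0; apply: pintegrable_gamma => //; rewrite mulr_gt0 ?costh_gt0. Qed.

Lemma pintegrable_ker t a x B : 0 < t -> 0 < a -> 0 <= x -> pintegrable (kerr t a x B).
Proof.
move=> t0 a0 x0; apply: pintegrable_le (pintegrable_kerdom t0 a0) _.
  exact: pmeas_ker.
by move=> r _; exact: ker_le.
Qed.

Lemma dv_ker t a x B r : 0 < r ->
  is_derive x (1 : R) (fun x => kerr t a x B r) (- kerr t (a + al) x (B + phi) r).
Proof.
move=> r0; rewrite /ker; eapply dv_eq; first by dv.
rewrite (_ : B + phi - t * r * sin th - x * r `^ al * sin phi =
  (B - t * r * sin th - x * r `^ al * sin phi) + phi); last by ring.
rewrite [sin (_ + phi)]sinD (_ : a + al - 1 = al + (a - 1)); last by ring.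
by rewrite (powR_add al (a - 1) r0); ring.
Qed.

(** Differentiating [exp (- x * z ^ al)] multiplies it by [- z ^ al], that is,
  raises the exponent by [al] and the phase by [al * (th + pi)]. *)
Lemma dv_pint_ker t a x B : 0 < t -> 0 < a -> 0 < x ->
  is_derive x (1 : R) (fun x => pint (kerr t a x B)) (- pint (kerr t (a + al) x (B + phi))).
Proof.
move=> t0 a0 x0; have a'0 : 0 < a + al by rewrite addr_gt0.
rewrite -pintN; last by apply: pintegrable_ker => //; exact: ltW.
apply: (@pint_dv R (fun x r => kerr t a x B r) (fun x r => - kerr t (a + al) x (B + phi) r)
  x 0 (x + 1) _ x0 _ _ _ (pintegrable_kerdom t0 a'0)).
- by rewrite ltrDl.
- by move=> y y0 _; apply: pintegrable_ker => //; exact: ltW.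
- by move=> y r y0 _ r0; exact: dv_ker.
- by move=> y r y0 _ r0; rewrite normrN; apply: ker_le; exact: ltW.
Qed.

(** At [x = 0] only a rotated Gamma integral is left. *)
Lemma pint_ker0 t a B : 0 < t -> 0 < a ->
  pint (kerr t a 0 B) = t `^ (- a) * Gamma a * sin (B - a * th).
Proof.
move=> t0 a0; rewrite -(rotated_gamma B a0 t0 norm_th); apply: eq_pint => r r0.
by rewrite /ker !mul0r oppr0 expR0 mulr1 addr0.
Qed.

(** Polynomial decay in [x], from [exp (- u) <= C * u ^ (- p)]. *)
Lemma pint_ker_decay t a p : 0 < t -> 0 <= p -> al * p < a ->
  exists2 C, 0 <= C & forall x B, 0 < x -> `|pint (kerr t a x B)| <= C * x `^ (- p).
Proof.
move=> t0 p0 pa; have [C C0 hC] := expR_pow_bound cosphi_gt0 p0.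
have a'0 : 0 < a - al * p by rewrite subr_gt0.
have a0 : 0 < a by apply: le_lt_trans pa; rewrite mulr_ge0// ltW.
have I := pintegrable_kerdom t0 a'0.
exists (C * pint (fun r => r `^ (a - al * p - 1) * expR (- (t * cos th * r)))).
  by rewrite mulr_ge0// pint_ge0// => r _; rewrite mulr_ge0 ?powR_ge0 ?expR_ge0.
move=> x B x0; rewrite mulrAC -pintZ//; apply: norm_pint_le => //.
- by apply: pintegrable_ker => //; exact: ltW.
- exact: pintegrableZ.
move=> r r0; apply: le_trans (ker_le_exp _ _ _ _ _) _.
have h := hC (x * r `^ al) (mulr_gt0 x0 (powR_gt0 _ r0)).
rewrite powRM ?powR_ge0 ?(ltW x0)// in h.
rewrite mulrC [_ * cos phi]mulrC.
apply: le_trans (ler_wpM2r _ h) _; first by rewrite mulr_ge0 ?powR_ge0 ?expR_ge0.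
rewrite -powRrM !mulrA le_eqVlt; apply/orP; left; apply/eqP.
rewrite (_ : a - al * p - 1 = al * - p + (a - 1)); last by ring.
by rewrite (powR_add (al * - p) (a - 1) r0); ring.
Qed.

(** Expand [exp (- x * z ^ al)] under the integral; the sum of the absolute
  values is dominated since [x * r `^ al] grows more slowly than the linear
  exponent [t * r * cos th]. *)
Lemma pint_ker_series t a x B : 0 < t -> 0 < a -> 0 <= x ->
  \sum_(0 <= m < n) (- x) ^+ m / m`!%:R * pint (kerr t (a + al * m%:R) 0 (B + phi * m%:R))
    @[n --> \oo] --> pint (kerr t a x B).
Proof.
move=> t0 a0 x0.
have am m : 0 < a + al * m%:R by rewrite ltr_wpDr// mulr_ge0// ltW.
pose kap := t * cos th; have kap0 : 0 < kap by rewrite mulr_gt0 ?costh_gt0.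
pose F n r := \sum_(0 <= m < n) (- x) ^+ m / m`!%:R *
  kerr t (a + al * m%:R) 0 (B + phi * m%:R) r.
have E n : pint (F n) = \sum_(0 <= m < n) (- x) ^+ m / m`!%:R *
    pint (kerr t (a + al * m%:R) 0 (B + phi * m%:R)).
  rewrite /F pint_sum => [|m]; last first.
    by apply: pintegrableZ; apply: pintegrable_ker.
  by apply: eq_bigr => m _; rewrite pintZ//; apply: pintegrable_ker.
under eq_fun do rewrite -E.
have k20 : 0 < kap / 2 by rewrite divr_gt0.
have [M HM] := powR_sublinear al0 al_lt1 x0 k20.
pose g r := expR M * (r `^ (a - 1) * expR (- (kap / 2 * r))).
have Ig : pintegrable g by apply: pintegrableZ; apply: pintegrable_gamma => //; rewrite divr_gt0.
have [|||_ //] := @pint_dct R F (kerr t a x B) g _ Ig.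
- by move=> n; apply: pintegrable_meas; apply: pintegrable_sum => m;
    apply: pintegrableZ; apply: pintegrable_ker.
- move=> n r r0.
  apply: (@le_trans _ _ (\sum_(0 <= m < n) (x * r `^ al) ^+ m / m`!%:R *
     (r `^ (a - 1) * expR (- (kap * r))))).
    apply: le_trans (ler_norm_sum _ _ _) _; apply: ler_sum => m _.
    rewrite normrM normf_div normrX normrN (ger0_norm x0) (ger0_norm (ler0n _ _)).
    rewrite exprMn powR_natX.
    apply: le_trans (ler_wpM2l _ (ker_le _ _ _ _ (lexx 0))) _.
      by rewrite divr_ge0// exprn_ge0.
    rewrite (_ : a + al * m%:R - 1 = al * m%:R + (a - 1)); last by ring.
    rewrite (powR_add (al * m%:R) (a - 1) r0) le_eqVlt; apply/orP; left; apply/eqP.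
    by rewrite /kap; ring.
  rewrite -mulr_suml.
  have xr0 : 0 <= x * r `^ al by rewrite mulr_ge0// powR_ge0.
  apply: (@le_trans _ _ (expR (x * r `^ al) * (r `^ (a - 1) * expR (- (kap * r))))).
    rewrite ler_wpM2r ?mulr_ge0 ?powR_ge0 ?expR_ge0//.
    exact: partial_sum_le_expR.
  rewrite /g mulrCA [leRHS]mulrCA ler_wpM2l ?powR_ge0// -!expRD ler_expR.
  by have := HM r r0; lra.
- move=> r r0; pose u := x * r `^ al.
  have u0 : 0 <= u by rewrite mulr_ge0 ?powR_ge0.
  pose K := r `^ (a - 1) * expR (- (t * r * cos th)).
  pose q := B - t * r * sin th.
  have FE : F ^~ r = fun n => K * \sum_(0 <= m < n) (- u) ^+ m / m`!%:R * sin (q + phi * m%:R).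
    apply/funext => n; rewrite /F mulr_sumr; apply: eq_bigr => m _.
    rewrite /ker !mul0r oppr0 expR0 mulr1 addr0 /K /q /u.
    rewrite -(mulNr x) exprMn powR_natX.
    rewrite (_ : a + al * m%:R - 1 = al * m%:R + (a - 1)); last by ring.
    by rewrite (powR_add (al * m%:R) (a - 1) r0) [B + phi * m%:R - _]addrAC; ring.
  rewrite FE (_ : kerr t a x B r = K * (expR (- (u * cos phi)) * sin (q - u * sin phi))); last first.
    by rewrite /ker /K /q /u !mulrA.
  apply: cvgM; first exact: cvg_cst.
  exact: exp_sin_series.
Qed.

(** Integrating in [x] first, the inner integral is a rotated Gamma integral
  with rate [r `^ al] and angle [al * (th + pi)]; what remains is the kernel at
  [x = 0] with the exponent lowered by [al * s]. *)
Lemma mellin_ker t a s B : 0 < t -> 0 < s -> al * s < a ->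
  pint (fun x => x `^ (s - 1) * pint (kerr t a x B)) =
  Gamma s * (t `^ (- (a - al * s)) * Gamma (a - al * s) *
    sin (B - s * phi - (a - al * s) * th)).
Proof.
move=> t0 s0 sa; have a0 : 0 < a by apply: le_lt_trans sa; rewrite mulr_ge0// ltW.
have a'0 : 0 < a - al * s by rewrite subr_gt0.
pose f r x := x `^ (s - 1) * kerr t a x B r.
have step x : 0 < x -> x `^ (s - 1) * pint (kerr t a x B) = pint (f ^~ x).
  by move=> x0; rewrite -pintZ//; apply: pintegrable_ker => //; exact: ltW.
rewrite (eq_pint step).
have fle r x : 0 < r -> 0 < x -> `|f r x| <= r `^ (a - 1) * expR (- (t * cos th * r)) *
     (x `^ (s - 1) * expR (- (r `^ al * cos phi * x))).
  move=> r0 x0; rewrite /f normrM ger0_norm ?powR_ge0//.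
  apply: le_trans (ler_wpM2l (powR_ge0 _ _) (ker_le_exp _ _ _ _ _)) _.
  rewrite le_eqVlt; apply/orP; left; apply/eqP.
  by rewrite (_ : x * r `^ al * cos phi = r `^ al * cos phi * x); ring.
have rc r : 0 < r -> 0 < r `^ al * cos phi by move=> r0; rewrite mulr_gt0 ?powR_gt0 ?cosphi_gt0.
have mfr r : pmeas (f r) by rewrite /f /ker; mf.
have If r : 0 < r -> pintegrable (f r).
  move=> r0; apply: (@pintegrable_le _ _ _ (mfr r)
    (pintegrableZ (r `^ (a - 1) * expR (- (t * cos th * r))) (pintegrable_gamma s0 (rc r r0)))).
  by move=> x x0; exact: fle.
rewrite -(@pint_swap R f (fun r => (cos phi) `^ (- s) * Gamma s *
     (r `^ (a - al * s - 1) * expR (- (t * cos th * r))))); first last.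
- exact/pintegrableZ/pintegrable_kerdom.
- move=> r r0; apply: (@le_trans _ _ (pint (fun x => r `^ (a - 1) * expR (- (t * cos th * r)) *
     (x `^ (s - 1) * expR (- (r `^ al * cos phi * x)))))).
    apply: le_pint.
    + exact/pintegrable_norm/If.
    + exact/pintegrableZ/pintegrable_gamma/rc.
    + by move=> x x0; exact: fle.
  rewrite pintZ; last exact/pintegrable_gamma/rc.
  rewrite pint_gamma//; last exact: rc.
  rewrite powRM ?powR_ge0 ?(ltW cosphi_gt0)// -powRrM.
  rewrite (_ : a - al * s - 1 = al * - s + (a - 1)); last by ring.
  rewrite (powR_add (al * - s) (a - 1) r0); rewrite le_eqVlt; apply/orP; left; apply/eqP; ring.
- move=> x x0; apply: pintegrableZ; apply: pintegrable_ker => //; exact: ltW.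
- exact: If.
- rewrite /f /ker; mf.
rewrite -pint_ker0// -pintZ; last exact: pintegrable_ker.
apply: eq_pint => r r0; rewrite /f /ker.
transitivity (pint (fun x => r `^ (a - 1) * expR (- (t * r * cos th)) *
   (x `^ (s - 1) * expR (- (r `^ al * x * cos phi)) *
    sin (B - t * r * sin th - r `^ al * x * sin phi)))).
  by apply: eq_pint => x x0; rewrite [x * r `^ al]mulrC; ring.
rewrite pintZ; last by apply: pintegrable_rotated_gamma => //; [exact: powR_gt0|exact: norm_phi].
rewrite rotated_gamma//; [|exact: powR_gt0|exact: norm_phi].
rewrite !mul0r oppr0 expR0 mulr1 addr0 -powRrM.
rewrite (_ : a - al * s - 1 = al * - s + (a - 1)); last by ring.
rewrite (powR_add (al * - s) (a - 1) r0).
rewrite (_ : B - s * phi - t * r * sin th = B - t * r * sin th - s * phi); last by ring.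
by ring.
Qed.

End kernel.

(** * Cauchy's formula at a pole on the positive axis *)

Lemma cvg_cont (R : realType) {F : set_system R} {FF : Filter F} (h f : R -> R) l :
  {for l, continuous h} -> f x @[x --> F] --> l -> h (f x) @[x --> F] --> h l.
Proof. by move=> ch fl; exact: (cvg_comp _ _ fl ch). Qed.

Section elementary_trig.
Context {R : realType}.
Implicit Types (x y u v s r : R).

Lemma sin_le_id y : 0 <= y -> sin y <= y.
Proof.
move=> y0; apply: (@le_of_derive R sin id cos (fun _ => 1) y y0).
- by move=> v _ _; exact: cos_le1.
- by rewrite sin0.
Qed.

Lemma norm_sin_le y : `|sin y| <= `|y|.
Proof.
have h z : 0 <= z -> `|sin z| <= z :> R.
  move=> z0; rewrite ler_norml sin_le_id// andbT.
  rewrite -[leRHS]opprK lerN2 -sinN -[leRHS]/(id z).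
  apply: (@le_of_derive R (fun v => sin (- v)) id (fun v => -1 * cos (- v)) (fun _ => 1) z z0).
  - by move=> v; eapply dv_eq; [dv|rewrite mulN1r].
  - by move=> v _ _; rewrite mulN1r lerNl cos_geN1.
  - by rewrite oppr0 sin0.
have [y0|y0] := leP 0 y; first by rewrite (ger0_norm y0) h.
by rewrite -normrN -sinN (ltr0_norm y0) h// oppr_ge0 ltW.
Qed.

Lemma oneBcos_le y : 0 <= y -> 1 - cos y <= y.
Proof.
move=> y0; apply: (@le_of_derive R (fun v => 1 - cos v) id sin (fun _ => 1) y y0).
- by move=> v; eapply dv_eq; [dv|rewrite mul1r opprK add0r].
- by move=> v _ _; exact: sin_le1.
- by rewrite cos0 subrr.
Qed.

Lemma sin_ge_half y : 0 <= y -> y <= 1 -> y / 2 <= sin y.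
Proof.
move=> y0 y1; apply: (@le_of_derive R (fun v => v / 2) sin (fun _ => 1 / 2) cos y y0).
- by move=> v; eapply dv_eq; [dv|rewrite mulr0 addr0].
- move=> v v0 vy; have h : 1 - cos v <= v ^+ 2 / 2.
    apply: (@le_of_derive R (fun v => 1 - cos v) (fun v => v ^+ 2 / 2) sin id v v0).
    + by move=> z; eapply dv_eq; [dv|rewrite mul1r opprK add0r].
    + by move=> z; eapply dv_eq; [dv|rewrite /=; field].
    + by move=> z z0 _; exact: sin_le_id.
    + by rewrite cos0 subrr expr0n/= mul0r.
  nra.
- by rewrite mul0r sin0.
Qed.

End elementary_trig.

Section pole.
Context {R : realType}.
Variables (al x s : R).
Implicit Types (r t th et A B C M : R).

Local Notation Xc r t := (s - r * cos t).
Local Notation Yc r t := (r * sin t).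
Local Notation den r t := ((s - r * cos t) ^+ 2 + (r * sin t) ^+ 2).
Local Notation E r t := (expR (- (x * r `^ al * cos (al * t)))).
Local Notation be r t := (x * r `^ al * sin (al * t)).

(** Imaginary and real part of [exp (- x * z ^ al) / (s - z)] at
  [z = r * exp (i * t)], the former divided by [r]. *)
Definition poleV r t : R :=
  (E r t * (- sin (be r t)) * Xc r t / r + E r t * cos (be r t) * sin t) / den r t.
Definition poleU r t : R :=
  (E r t * cos (be r t) * Xc r t + E r t * sin (be r t) * Yc r t) / den r t.
(** The common value of the angular derivative of [poleV] and the radial
  derivative of [poleU]: their equality is the Cauchy-Riemann equation. *)
Definition polew r t : R :=
  - (x * al * r `^ (al - 1) * E r t *
     (Xc r t * cos (al * t - be r t) - Yc r t * sin (al * t - be r t)) / den r t) +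
  E r t * ((Xc r t ^+ 2 - Yc r t ^+ 2) * cos (t - be r t) -
           2 * Xc r t * Yc r t * sin (t - be r t)) / den r t ^+ 2.

(** The squared distance from [s] to [r * exp (i * t)], seen from [s * cos t]
  here and from [s] in [den_dist]. *)
Lemma den_center r t : den r t = (r - s * cos t) ^+ 2 + (s * sin t) ^+ 2.
Proof.
have h := cos2Dsin2 t; rewrite !exprMn.
transitivity (s ^+ 2 - 2 * s * r * cos t + r ^+ 2 * (cos t ^+ 2 + sin t ^+ 2)); first by ring.
transitivity (r ^+ 2 - 2 * s * r * cos t + s ^+ 2 * (cos t ^+ 2 + sin t ^+ 2)); last by ring.
by rewrite h; ring.
Qed.

Lemma den_dist r t : den r t = (r - s) ^+ 2 + 2 * (s * r) * (1 - cos t).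
Proof.
have h := cos2Dsin2 t; rewrite !exprMn.
transitivity (s ^+ 2 - 2 * s * r * cos t + r ^+ 2 * (cos t ^+ 2 + sin t ^+ 2)); first by ring.
by rewrite h; ring.
Qed.

Hypothesis s0 : 0 < s.
Hypothesis x0 : 0 < x.
Hypothesis al0 : 0 < al.

Lemma den_gt0 r t : 0 < t -> t < pi -> 0 < den r t.
Proof.
move=> t0 tpi; rewrite den_center ltr_wpDl ?sqr_ge0// exprn_gt0// mulr_gt0//.
by apply: sin_gt0_pi; rewrite t0.
Qed.

Lemma dv_poleV r t : 0 < r -> 0 < t -> t < pi ->
  is_derive t (1 : R) (poleV r) (polew r t).
Proof.
move=> r0 t0 tpi; have d0 := den_gt0 r t0 tpi.
rewrite /poleV; eapply dv_eq; first by dv; rewrite gt_eqF.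
rewrite /polew (powR_mulB1 al r0) [cos (al * t - _)]cosB [sin (al * t - _)]sinB.
rewrite [cos (t - _)]cosB [sin (t - _)]sinB /=.
set b := x * (r * _) * sin (al * t); set EE := expR _.
have dn : den r t != 0 by rewrite gt_eqF.
by field; rewrite dn gt_eqF.
Qed.

Lemma dv_poleU r t : 0 < r -> 0 < t -> t < pi ->
  is_derive r (1 : R) (fun r => poleU r t) (polew r t).
Proof.
move=> r0 t0 tpi; have d0 := den_gt0 r t0 tpi.
rewrite /poleU; eapply dv_eq; first by dv => //; rewrite gt_eqF.
rewrite /polew (powR_mulB1 al r0) [cos (al * t - _)]cosB [sin (al * t - _)]sinB.
rewrite [cos (t - _)]cosB [sin (t - _)]sinB /=.
set b := x * (r * _) * sin (al * t); set EE := expR _.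
have dn : den r t != 0 by rewrite gt_eqF.
by field; rewrite dn.
Qed.

Lemma cts_polew r t : 0 < r -> 0 < t -> t < pi -> {for r, continuous (fun r => polew r t)}.
Proof.
move=> r0 t0 tpi; have d0 := den_gt0 r t0 tpi.
have dn : den r t != 0 by rewrite gt_eqF.
by rewrite /polew; eapply dv_cts; dv; rewrite ?expf_neq0.
Qed.

Lemma pmeas_poleV t : pmeas (fun r => poleV r t).
Proof. by rewrite /poleV; mf. Qed.

Section bounds.
Variables (et tm : R).
Hypothesis et0 : 0 < et.
Hypothesis et2 : et < pi / 2.
Hypothesis ettm : et < tm.
Hypothesis tmpi : tm < pi.
Hypothesis altm : al * tm < pi / 2.

Local Notation kap := (1 - cos et).
Local Notation C0 := (cos (al * tm)).

Lemma kap_gt0 : 0 < kap.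
Proof.
rewrite subr_gt0 -cos0 ltr_cos ?in_itv/= ?lexx ?pi_ge0//.
have h1 := et0; have h2 := et2; have pi0 := pi_gt0 R.
by apply/andP; split; lra.
Qed.

Lemma C0_gt0 : 0 < C0.
Proof.
apply: cos_gt0_pihalf; rewrite altm andbT.
have h : 0 < al * tm by rewrite mulr_gt0// (lt_trans et0).
by have pi0 := pi_gt0 R; lra.
Qed.

Lemma C0_le t : et < t -> t < tm -> C0 <= cos (al * t).
Proof.
move=> h1 h2; have t0 : 0 < t by exact: lt_trans h1.
apply: ler_cos_norm.
  by rewrite ger0_norm ?mulr_ge0 ?(ltW t0) ?(ltW al0)// ler_wpM2l ?(ltW al0)// ltW.
by have h := altm; have pi0 := pi_gt0 R; lra.
Qed.

Lemma kap_le r t : et < t -> t < tm -> 0 < r -> kap * (s ^+ 2 + r ^+ 2) <= den r t.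
Proof.
move=> h1 h2 r0; rewrite den_dist.
have h3 : cos t <= cos et.
  apply: ler_cos_norm; first by rewrite gtr0_norm// ltW.
  by have h := tmpi; lra.
have ce : 0 <= cos et.
  by apply: cos_ge0_pihalf; have h := et2; have h' := et0; apply/andP; split; lra.
have sr : 0 < s * r by rewrite mulr_gt0.
have q := sqr_ge0 (s - r); nra.
Qed.

(** For angles away from [0] the pole stays at a distance comparable to
  [s + r], so the kernel is dominated by a stretched exponential, controlling
  the singularity at [0], and by a Cauchy density at infinity. *)
Definition poledom r : R :=
  (4 * x * (1 + al) / (kap * s)) * (r `^ (al - 1) * expR (- (x * C0 * r `^ al))) +
  (2 / kap) * (s ^+ 2 + r ^+ 2)^-1.

Lemma pintegrable_cauchy : pintegrable (fun r => (s ^+ 2 + r ^+ 2)^-1).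
Proof.
have s20 : 0 < s ^+ 2 by rewrite exprn_gt0.
have pos r : 0 < s ^+ 2 + r ^+ 2 by rewrite ltr_wpDr ?sqr_ge0.
apply: (@pintegrable_two_sided _ _ (1 + (s ^+ 2)^-1) 1) => //; first by mf.
- move=> r r0 r1; rewrite subrr powRr0 mulr1 ger0_norm ?invr_ge0 ?(ltW (pos _))//.
  rewrite (@le_trans _ _ (s ^+ 2)^-1)//; last by rewrite lerDr.
  by rewrite lef_pV2 ?posrE// lerDl sqr_ge0.
- move=> r r1; have r0 : 0 < r by exact: lt_le_trans r1.
  rewrite ger0_norm ?invr_ge0 ?(ltW (pos _))//.
  rewrite (_ : - 1 - 1 = - 2%:R :> R); last by ring.
  rewrite powRN powR_mulrn ?(ltW r0)//.
  rewrite (@le_trans _ _ (r ^+ 2)^-1)//.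
    by rewrite lef_pV2 ?posrE ?exprn_gt0// lerDr sqr_ge0.
  by rewrite ler_peMl ?invr_ge0 ?sqr_ge0// lerDl invr_ge0 sqr_ge0.
Qed.

Lemma pintegrable_poledom : pintegrable poledom.
Proof.
apply: pintegrableD; apply: pintegrableZ; last exact: pintegrable_cauchy.
by apply: pintegrable_stretched_exp => //; rewrite mulr_gt0// C0_gt0.
Qed.

Section pointwise.
Variables (r t : R).
Hypothesis ht1 : et < t.
Hypothesis ht2 : t < tm.
Hypothesis r0 : 0 < r.

Let t0 : 0 < t. Proof. exact: lt_trans et0 ht1. Qed.
Let tpi : t < pi. Proof. exact: lt_trans ht2 tmpi. Qed.

Lemma E_le : E r t <= expR (- (x * C0 * r `^ al)).
Proof.
rewrite ler_expR lerN2 mulrAC ler_wpM2l ?C0_le// mulr_ge0 ?powR_ge0//; exact: ltW.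
Qed.

Lemma E_le1 : E r t <= 1.
Proof.
apply: le_trans E_le _; rewrite -expR0 ler_expR oppr_le0.
by rewrite !mulr_ge0 ?powR_ge0// ltW// C0_gt0.
Qed.

Lemma invden_le : (den r t)^-1 <= kap^-1 * (s ^+ 2 + r ^+ 2)^-1.
Proof.
have pos : 0 < s ^+ 2 + r ^+ 2 by rewrite ltr_wpDr ?sqr_ge0// exprn_gt0.
rewrite -invfM lef_pV2 ?posrE ?kap_le// ?mulr_gt0 ?kap_gt0//.
exact: den_gt0.
Qed.

Lemma normX_le : `|Xc r t| <= s + r.
Proof.
apply: le_trans (ler_normB _ _) _; rewrite gtr0_norm// lerD2l.
by apply: norm_mul_cos_le; exact: ltW.
Qed.

Lemma normY_le : `|Yc r t| <= s + r.
Proof.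
apply: le_trans (norm_mul_sin_le _ (ltW r0)) _; by rewrite lerDr ltW.
Qed.

Lemma sr_invden_le : (s + r) * (den r t)^-1 <= 2 / (kap * s).
Proof.
have pos : 0 < s ^+ 2 + r ^+ 2 by rewrite ltr_wpDr ?sqr_ge0// exprn_gt0.
apply: le_trans (ler_wpM2l _ invden_le) _; first by rewrite addr_ge0// ltW.
rewrite invfM mulrCA [2 * _]mulrCA ler_wpM2l ?invr_ge0 ?(ltW kap_gt0)//.
rewrite ler_pdivrMr// mulrAC ler_pdivlMr//.
by have h1 := s0; have h2 := r0; nra.
Qed.

Lemma norm_poleV_le : `|poleV r t| <= poledom r.
Proof.
have d0 := den_gt0 r t0 tpi; have k0 := kap_gt0.
rewrite /poleV mulrDl; apply: le_trans (ler_normD _ _) _; apply: lerD; last first.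
  rewrite normrM [`|_^-1|]ger0_norm ?invr_ge0 ?(ltW d0)//.
  apply: (@le_trans _ _ (1 * (den r t)^-1)).
    rewrite ler_wpM2r ?invr_ge0 ?(ltW d0)// !normrM -[leRHS]mulr1 ler_pM//.
      rewrite -[leRHS]mulr1 ler_pM ?cos_max//.
      by rewrite ger0_norm ?expR_ge0// E_le1.
    exact: sin_max.
  rewrite mul1r; apply: le_trans invden_le _; rewrite ler_wpM2r//.
    by rewrite invr_ge0 addr_ge0 ?sqr_ge0.
  by rewrite ler_peMl ?invr_ge0 ?(ltW k0)// ler1n.
rewrite (_ : _ / den r t = - (E r t * (sin (be r t) / r) * (Xc r t / den r t))); last first.
  by field; rewrite !gt_eqF.
rewrite normrN !normrM [`|_^-1|]gtr0_norm ?invr_gt0// (ger0_norm (expR_ge0 _)).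
have hs : `|sin (be r t)| / r <= x * r `^ (al - 1).
  rewrite ler_pdivrMr// (_ : x * r `^ (al - 1) * r = x * r `^ al); last first.
    by rewrite (powR_mulB1 al r0); ring.
  apply: le_trans (norm_sin_le _) _; apply: norm_mul_sin_le.
  by rewrite mulr_ge0 ?powR_ge0// ltW.
have hX : `|Xc r t| * `|(den r t)^-1| <= 2 / (kap * s).
  rewrite [`|_^-1|]gtr0_norm ?invr_gt0//.
  apply: le_trans sr_invden_le; rewrite ler_wpM2r ?invr_ge0 ?(ltW d0)//.
  exact: normX_le.
apply: (@le_trans _ _ (expR (- (x * C0 * r `^ al)) * (x * r `^ (al - 1)) * (2 / (kap * s)))).
  apply: ler_pM => //; first by rewrite !mulr_ge0 ?expR_ge0// invr_ge0 ltW.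
  apply: ler_pM => //; rewrite ?expR_ge0 ?E_le// mulr_ge0// invr_ge0 ltW//.
rewrite [leLHS](_ : _ = (2 * x / (kap * s)) * (r `^ (al - 1) * expR (- (x * C0 * r `^ al)))); last first.
  by ring.
rewrite ler_wpM2r ?mulr_ge0 ?powR_ge0 ?expR_ge0//.
rewrite ler_wpM2r ?invr_ge0 ?mulr_ge0 ?(ltW k0) ?(ltW s0)//.
by have h := x0; have h' := al0; nra.
Qed.

Lemma norm_polew_le : `|polew r t| <= poledom r.
Proof.
have d0 := den_gt0 r t0 tpi; have k0 := kap_gt0.
rewrite /polew; apply: le_trans (ler_normD _ _) _; apply: lerD.
  rewrite normrN -mulrA normrM ger0_norm; last first.
    by rewrite !mulr_ge0 ?powR_ge0 ?expR_ge0 ?(ltW x0) ?(ltW al0).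
  have hXY : `|(Xc r t * cos (al * t - be r t) - Yc r t * sin (al * t - be r t)) / den r t| <=
      4 / (kap * s).
    rewrite normrM [`|_^-1|]gtr0_norm ?invr_gt0//.
    apply: (@le_trans _ _ (2 * ((s + r) * (den r t)^-1))).
      rewrite mulrA ler_wpM2r ?invr_ge0 ?(ltW d0)//.
      apply: le_trans (ler_normB _ _) _; rewrite [leRHS]mulr_natl [leRHS]mulr2n; apply: lerD.
        rewrite normrM -[leRHS]mulr1 ler_pM ?cos_max//; exact: normX_le.
      rewrite normrM -[leRHS]mulr1 ler_pM ?sin_max//; exact: normY_le.
    rewrite (_ : 4 / (kap * s) = 2 * (2 / (kap * s))); last by rewrite mulrA -natrM.
    by rewrite ler_wpM2l// sr_invden_le.
  apply: (@le_trans _ _ (x * al * r `^ (al - 1) * expR (- (x * C0 * r `^ al)) * (4 / (kap * s)))).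
    apply: ler_pM => //; first by rewrite !mulr_ge0 ?powR_ge0 ?expR_ge0 ?(ltW x0) ?(ltW al0).
    by rewrite ler_wpM2l ?E_le// !mulr_ge0 ?powR_ge0 ?(ltW x0) ?(ltW al0).
  rewrite [leLHS](_ : _ = (4 * x * al / (kap * s)) * (r `^ (al - 1) * expR (- (x * C0 * r `^ al)))); last first.
    by ring.
  rewrite ler_wpM2r ?mulr_ge0 ?powR_ge0 ?expR_ge0//.
  rewrite ler_wpM2r ?invr_ge0 ?mulr_ge0 ?(ltW k0) ?(ltW s0)//.
  by have h := x0; have h' := al0; nra.
rewrite normrM [`|_^-1|]gtr0_norm ?invr_gt0 ?exprn_gt0//.
rewrite (_ : (den r t ^+ 2)^-1 = (den r t)^-1 * (den r t)^-1); last by rewrite [den r t ^+ 2]expr2 invfM.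
rewrite [leLHS]mulrA.
have hd : `|E r t * ((Xc r t ^+ 2 - Yc r t ^+ 2) * cos (t - be r t) -
           2 * Xc r t * Yc r t * sin (t - be r t))| <= 2 * den r t.
  rewrite normrM -[leRHS]mul1r ler_pM//; first by rewrite ger0_norm ?expR_ge0// E_le1.
  apply: le_trans (ler_normB _ _) _; rewrite [leRHS]mulr_natl [leRHS]mulr2n; apply: lerD.
    rewrite normrM -[leRHS]mulr1 ler_pM ?cos_max//.
    apply: le_trans (ler_normB _ _) _.
    by rewrite !ger0_norm ?sqr_ge0.
  rewrite normrM -[leRHS]mulr1 ler_pM ?sin_max//.
  rewrite ler_norml; apply/andP; split.
    by have h := sqr_ge0 (Xc r t + Yc r t); lra.
  by have h := sqr_ge0 (Xc r t - Yc r t); lra.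
apply: (@le_trans _ _ (2 * (den r t)^-1)).
  rewrite ler_wpM2r ?invr_ge0 ?(ltW d0)// ler_pdivrMr//.
by rewrite -mulrA ler_wpM2l// invden_le.
Qed.

Lemma norm_poleU_le : 1 <= r -> `|poleU r t| <= 4 / kap * r `^ (- 1).
Proof.
move=> r1; have d0 := den_gt0 r t0 tpi; have k0 := kap_gt0.
rewrite /poleU normrM [`|_^-1|]gtr0_norm ?invr_gt0//.
rewrite (_ : E r t * cos (be r t) * Xc r t + E r t * sin (be r t) * Yc r t =
  E r t * (cos (be r t) * Xc r t + sin (be r t) * Yc r t)); last by ring.
rewrite normrM.
apply: (@le_trans _ _ (1 * (2 * (s + r)) * (den r t)^-1)).
  rewrite ler_wpM2r ?invr_ge0 ?(ltW d0)// ler_pM//.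
    by rewrite ger0_norm ?expR_ge0// E_le1.
  apply: le_trans (ler_normD _ _) _; rewrite [leRHS]mulr_natl [leRHS]mulr2n; apply: lerD.
    rewrite normrM mulrC -[leRHS]mulr1 ler_pM ?cos_max//; exact: normX_le.
  rewrite normrM mulrC -[leRHS]mulr1 ler_pM ?sin_max//; exact: normY_le.
rewrite mul1r; apply: le_trans (ler_wpM2l _ invden_le) _.
  by rewrite mulr_ge0// addr_ge0// ltW.
have pos : 0 < s ^+ 2 + r ^+ 2 by rewrite ltr_wpDr ?sqr_ge0// exprn_gt0.
rewrite powR_inv1 ?(ltW r0)// (_ : 4 / kap / r = kap^-1 * (4 / r)); last by ring.
rewrite [leLHS]mulrCA ler_wpM2l ?invr_ge0 ?(ltW k0)//.
rewrite ler_pdivrMr// mulrAC ler_pdivlMr//.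
by have h1 := s0; have h2 := r0; have h3 := sqr_ge0 (s - r); nra.
Qed.

End pointwise.

Lemma poleU_cvg0 t : et < t -> t < tm -> poleU r t @[r --> 0^'+] --> s^-1.
Proof.
move=> h1 h2; rewrite /poleU.
have rr : (fun r : R => r) r @[r --> 0^'+] --> (0 : R) by exact: cvg_at_right_filter.
have ra : x * r `^ al @[r --> 0^'+] --> (0 : R).
  by rewrite -[X in _ --> X](mulr0 x); apply: cvgM; [exact: cvg_cst|exact: cvg_pow_at0].
have cE : E r t @[r --> 0^'+] --> (1 : R).
  rewrite -(@expR0 R); apply: (@cvg_cont _ _ _ (@expR R)).
    exact: continuous_expR.
  by rewrite -[Z in _ --> Z]oppr0 -[Z in _ --> - Z](mul0r (cos (al * t))); apply: cvgN; apply: cvgM => //; exact: cvg_cst.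
have cb : be r t @[r --> 0^'+] --> (0 : R).
  by rewrite -[X in _ --> X](mul0r (sin (al * t))); apply: cvgM => //; exact: cvg_cst.
have cc : cos (be r t) @[r --> 0^'+] --> (1 : R).
  rewrite -(@cos0 R); apply: (@cvg_cont _ _ _ (@cos R)) => //.
  exact: continuous_cos.
have cs : sin (be r t) @[r --> 0^'+] --> (0 : R).
  rewrite -[X in _ --> X](@sin0 R); apply: (@cvg_cont _ _ _ (@sin R)) => //.
  exact: continuous_sin.
have cX : Xc r t @[r --> 0^'+] --> s.
  rewrite -[Z in _ --> Z]subr0 -[Z in _ --> _ - Z](mul0r (cos t)); apply: cvgB; first exact: cvg_cst.
  by apply: cvgM => //; exact: cvg_cst.
have cY : Yc r t @[r --> 0^'+] --> (0 : R).
  by rewrite -[X in _ --> X](mul0r (sin t)); apply: cvgM => //; exact: cvg_cst.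
have cd : den r t @[r --> 0^'+] --> s ^+ 2.
  rewrite (_ : s ^+ 2 = s * s + 0 * 0); last by rewrite mulr0 addr0 expr2.
  by under eq_fun do rewrite !expr2; apply: cvgD; apply: cvgM.
rewrite (_ : s^-1 = (1 * 1 * s + 1 * 0 * 0) * (s ^+ 2)^-1); last first.
  by rewrite mulr0 addr0 !mul1r expr2 invfM mulrA divff ?gt_eqF// mul1r.
apply: cvgM; last by apply: cvgV => //; rewrite gt_eqF// exprn_gt0.
by apply: cvgD; apply: cvgM => //; apply: cvgM.
Qed.

(** The integral over a ray is affine in the angle of the ray: the slope is the
  boundary term at the origin, where [poleU] tends to [s^-1]. *)
Lemma pole_rotation t1 t2 : et < t1 -> t1 < tm -> et < t2 -> t2 < tm ->
  pint (fun r => poleV r t2) - pint (fun r => poleV r t1) = - (t2 - t1) / s.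
Proof.
move=> h1 h2 h3 h4.
have t0 t : et < t -> 0 < t by exact: lt_trans.
have tp t : t < tm -> t < pi by move=> h; exact: lt_trans tmpi.
transitivity ((0 - s^-1) * (t2 - t1)); last by rewrite sub0r mulNr mulrC mulNr.
have H1 t : et < t -> t < tm -> pintegrable (fun r => poleV r t).
  move=> ht1 ht2; apply: (@pintegrable_le _ _ _ (pmeas_poleV t) pintegrable_poledom).
  by move=> r r0; exact: norm_poleV_le.
have H2 t r : et < t -> t < tm -> 0 < r -> is_derive t (1 : R) (poleV r) (polew r t).
  by move=> ht1 ht2 r0; apply: dv_poleV => //; [exact: t0|exact: tp].
have H3 t r : et < t -> t < tm -> 0 < r -> is_derive r (1 : R) (fun r => poleU r t) (polew r t).
  by move=> ht1 ht2 r0; apply: dv_poleU => //; [exact: t0|exact: tp].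
have H4 t r : et < t -> t < tm -> 0 < r -> {for r, continuous (fun r => polew r t)}.
  by move=> ht1 ht2 r0; apply: cts_polew => //; [exact: t0|exact: tp].
have H5 t r : et < t -> t < tm -> 0 < r -> `|polew r t| <= poledom r.
  by move=> ht1 ht2 r0; exact: norm_polew_le.
have H6 t : et < t -> t < tm -> poleU r t @[r --> 0^'+] --> s^-1.
  by move=> ht1 ht2; exact: poleU_cvg0.
have H7 t : et < t -> t < tm -> poleU r t @[r --> +oo%R] --> (0 : R).
  move=> ht1 ht2; apply: (@cvg_aty_le _ _ (4 / kap) 1) => // r r1.
  by apply: norm_poleU_le => //; exact: lt_le_trans r1.
exact: (@ray_integral_dv R poleU poleV polew poledom et tm s^-1 0 H1 H2 H3 H4
  pintegrable_poledom H5 H6 H7 t1 t2 h1 h2 h3 h4).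
Qed.

End bounds.
End pole.

Section pole_limit.
Context {R : realType}.
Implicit Types (al x s r t th ph A B C M : R).
Local Notation mu := (@lebesgue_measure R).
Local Notation den s r t := ((s - r * cos t) ^+ 2 + (r * sin t) ^+ 2).

(** A point is negligible; the kernels below have no limit at the pole when the
  ray approaches it. *)
Lemma pint_except_point (f g : R -> R) c : pmeas f -> pmeas g ->
  (forall r, 0 < r -> r != c -> f r = g r) -> pint f = pint g.
Proof.
move=> mf mg fg; rewrite /pint /Rintegral; congr fine.
apply: ae_eq_integral => //.
- exact/measurable_EFinP.
- exact/measurable_EFinP.
exists [set c]; split => //; first exact: lebesgue_measure_set1.
move=> r /= /not_implyP[/posE r0 h]; apply: contrapT => rc; apply: h.
by rewrite fg//; apply/eqP.
Qed.

(** Up to the factor [pi / s], the mass that the Poisson kernel of the upper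
  half-plane, based at [s * exp (i * t)], gives to the positive half-axis. *)
Lemma poisson s t : 0 < s -> 0 < t -> t < pi ->
  pintegrable (fun r => sin t / den s r t) /\
  pint (fun r => sin t / den s r t) = (pi - t) / s.
Proof.
move=> s0 t0 tpi; have sin0t : 0 < sin t by apply: sin_gt0_pi; rewrite t0.
have pi0 := pi_gt0 R.
have d0 r : 0 < den s r t by exact: den_gt0.
pose F r := s^-1 * atan ((r - s * cos t) / (s * sin t)).
have ssin : 0 < s * sin t by rewrite mulr_gt0.
have dF r : is_derive r (1 : R) F (sin t / den s r t).
  rewrite /F; eapply dv_eq; first by dv.
  rewrite den_center; set a := r - s * cos t; set b := s * sin t.
  have ab : a ^+ 2 + b ^+ 2 != 0 by rewrite /a /b -den_center gt_eqF.
  have b0 : b != 0 by rewrite gt_eqF.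
  have ab' : 1 + (a / b) ^+ 2 != 0.
    by rewrite gt_eqF// ltr_wpDr ?sqr_ge0.
  rewrite (_ : sin t = b / s); last by rewrite /b; field; rewrite gt_eqF.
  by field; rewrite ?b0 ?ab ?gt_eqF// addrC.
have cf r : {for r, continuous (fun r => sin t / den s r t)}.
  by eapply dv_cts; dv; rewrite gt_eqF.
have If : pintegrable (fun r => sin t / den s r t).
  apply: (@pintegrable_ftc R F _ (s^-1 * (pi / 2))) => //.
  - by move=> r _; rewrite divr_ge0// ltW.
  - move=> r _; have s'0 : 0 <= s^-1 by rewrite invr_ge0 ltW.
    rewrite /F normrM (ger0_norm s'0) ler_wpM2l//.
    by rewrite ler_norml ltW ?atan_gtNpi2//= ltW ?atan_ltpi2.
split => //.
have at0 : atan ((0 - s * cos t) / (s * sin t)) = t - pi / 2.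
  rewrite -[RHS]tanK; last by rewrite in_itv/=; apply/andP; split; lra.
  congr atan; rewrite /tan sinBpihalf cosBpihalf sub0r -mulNr.
  by field; rewrite !gt_eqF.
rewrite (@pint_ftc R F _ (s^-1 * (t - pi / 2)) (s^-1 * (pi / 2))) //; first by field; rewrite gt_eqF.
- rewrite -at0; apply: cvg_at_right_filter; rewrite -[_ * _]/(F 0).
  exact: (dv_cts (dF 0)).
- apply: cvgM; first exact: cvg_cst.
  apply: (cvg_comp _ _ _ atan_cvg_pinfty).
  apply/cvgryPge => M; near=> r.
  rewrite ler_pdivlMr// lerBrDr; near: r; apply: nbhs_pinfty_ge; exact: num_real.
Unshelve. all: by end_near. Qed.

Lemma oneBexp_le A : 1 - expR (- A) <= A.
Proof. by have := expR_ge1Dx (- A); lra. Qed.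

Lemma exp_cos_near A ph : 0 <= A -> 0 <= ph -> ph <= pi / 2 ->
  `|expR (- (A * cos ph)) * cos (A * sin ph) - expR (- A)| <= 2 * (A * ph).
Proof.
move=> A0 p0 p1; have pi0 := pi_gt0 R.
have c0 : 0 <= cos ph by apply: cos_ge0_pihalf; apply/andP; split; lra.
have c1 := cos_le1 ph.
rewrite (_ : _ - _ = expR (- (A * cos ph)) * (cos (A * sin ph) - 1) +
  expR (- (A * cos ph)) * (1 - expR (- (A * (1 - cos ph))))); last first.
  have -> : expR (- A) = expR (- (A * cos ph)) * expR (- (A * (1 - cos ph))).
    by rewrite -expRD; congr expR; ring.
  by ring.
have e1 : expR (- (A * cos ph)) <= 1 by rewrite -expR0 ler_expR oppr_le0 mulr_ge0.
apply: le_trans (ler_normD _ _) _; rewrite mulr_natl mulr2n; apply: lerD.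
  rewrite normrM -[leRHS]mul1r ler_pM// ?(ger0_norm (expR_ge0 _))//.
  rewrite -normrN opprB ger0_norm ?subr_ge0 ?cos_le1//.
  rewrite -cos_norm; apply: le_trans (oneBcos_le (normr_ge0 _)) _.
  rewrite normrM (ger0_norm A0) ler_wpM2l// (le_trans (norm_sin_le _))//.
  by rewrite ger0_norm.
rewrite normrM -[leRHS]mul1r ler_pM// ?(ger0_norm (expR_ge0 _))//.
have h : 0 <= A * (1 - cos ph) by rewrite mulr_ge0// subr_ge0.
rewrite ger0_norm; last by rewrite subr_ge0 -[leRHS]expR0 ler_expR oppr_le0.
apply: le_trans (oneBexp_le _) _; rewrite ler_wpM2l//; exact: oneBcos_le.
Qed.

Lemma mul_le_of_sqr_le A B M : A ^+ 2 <= M -> B ^+ 2 <= M -> A * B <= M.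
Proof. by move=> hA hB; have := sqr_ge0 (A - B); nra. Qed.

(** Near [s] by the mean value theorem, near [0] because the difference is at
  most [1] while [r - s] is bounded away from [0]. *)
Lemma exp_powR_lipschitz al x s : 0 < al -> al <= 1 -> 0 < x -> 0 < s ->
  exists2 L, 0 <= L & forall r, 0 < r ->
    `|expR (- (x * r `^ al)) - expR (- (x * s `^ al))| <= L * `|r - s|.
Proof.
move=> al0 al1 x0 s0; have s20 : 0 < s / 2 by lra.
pose L1 := x * al * (s / 2) `^ (al - 1).
have L10 : 0 <= L1 by rewrite !mulr_ge0 ?powR_ge0// ltW.
exists (L1 + 2 / s) => [|r r0]; first by rewrite addr_ge0// divr_ge0// ltW.
have e1 (v : R) : 0 < v -> 0 <= expR (- (x * v `^ al)) <= 1.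
  move=> v0; rewrite expR_ge0/= -expR0 ler_expR oppr_le0 mulr_ge0 ?powR_ge0//; exact: ltW.
have [rs|rs] := leP r (s / 2).
  apply: (@le_trans _ _ 1).
    have := e1 r r0; have := e1 s s0 => /andP[h1 h2] /andP[h3 h4].
    rewrite ler_norml; move: (expR _) (expR _) h1 h2 h3 h4 => u v h1 h2 h3 h4.
    by clear -h1 h2 h3 h4; apply/andP; split; lra.
  have h : s / 2 <= `|r - s| by rewrite -normrN opprB ger0_norm; lra.
  apply: (@le_trans _ _ (2 / s * (s / 2))); first by rewrite mulrA divfK ?gt_eqF// divff.
  by apply: ler_pM; rewrite ?lerDr// divr_ge0// ltW.
apply: (@le_trans _ _ (L1 * `|r - s|)); last by rewrite ler_wpM2r// lerDl divr_ge0// ltW.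
pose f (v : R) := expR (- (x * v `^ al)).
pose f' (v : R) := - (x * al * v `^ (al - 1)) * expR (- (x * v `^ al)).
have df (v : R) : 0 < v -> is_derive v (1 : R) f (f' v).
  move=> v0; rewrite /f /f'; eapply dv_eq; first by dv.
  by ring.
have f'L (v : R) : s / 2 <= v -> `|f' v| <= L1.
  move=> sv; have v0 : 0 < v by exact: lt_le_trans sv.
  rewrite /f' normrM normrN -[leRHS]mulr1; apply: ler_pM => //; last first.
    by rewrite ger0_norm ?expR_ge0//; have /andP[] := e1 v v0.
  rewrite ger0_norm; last by rewrite !mulr_ge0 ?powR_ge0// ltW.
  rewrite /L1 ler_wpM2l ?mulr_ge0 ?(ltW x0) ?(ltW al0)//.
  rewrite -[al - 1]opprB !powRN lef_pV2 ?posrE ?powR_gt0//.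
  by rewrite ge0_ler_powR ?nnegrE ?(ltW s20) ?(ltW v0)//; lra.
have mvt (a b : R) : s / 2 <= a -> a < b -> `|f b - f a| <= L1 * `|b - a|.
  move=> sa ab; have a0 : 0 < a by exact: lt_le_trans sa.
  have [] := @MVT R f f' a b ab.
  - by move=> v; rewrite in_itv/= => /andP[av _]; apply: df; exact: lt_trans av.
  - apply: continuous_in_subspaceT => v; rewrite inE/= in_itv/= => /andP[av _].
    by apply: dv_cts; apply: df; exact: lt_le_trans av.
  move=> c; rewrite in_itv/= => /andP[ac _] ->.
  by rewrite normrM ler_wpM2r// f'L// (le_trans sa)// ltW.
rewrite -[X in `|X|]/(f r - f s); have [h|h|->] := ltgtP r s.
- by rewrite -normrN opprB -[`|r - s|]normrN opprB mvt// ltW.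
- by apply: mvt => //; lra.
- by rewrite !subrr normr0 mulr0.
Qed.

Section limit.
Variables (al x s tm : R).
Hypothesis al0 : 0 < al.
Hypothesis al1 : al <= 1.
Hypothesis x0 : 0 < x.
Hypothesis s0 : 0 < s.
Hypothesis tmpi : tm < pi.
Hypothesis altm : al * tm < pi / 2.

Local Notation E r t := (expR (- (x * r `^ al * cos (al * t)))).
Local Notation be r t := (x * r `^ al * sin (al * t)).
Local Notation Ps := (expR (- (x * s `^ al))).
Local Notation C0 := (cos (al * tm)).

(** [D] is what is left of the integrand once the value [Ps] at the pole has been
  subtracted: it is bounded by an integrable function uniformly in the angle
  and tends to [0] with it. *)
Let D r t := (E r t * (- sin (be r t)) * (s - r * cos t) / r +
   (E r t * cos (be r t) - Ps) * sin t) / den s r t.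

Let poleV_split r t : poleV al x s r t = D r t + Ps * (sin t / den s r t).
Proof. by rewrite /poleV /D; ring. Qed.

Let pmeasD t : pmeas (D ^~ t).
Proof. by rewrite /D; mf. Qed.

(** Near the pole the difference with [Ps] is Lipschitz in [r - s], up to an
  error of the order of the angle, and both are compensated by the squared
  distance in the denominator; beyond [2 * s] crude bounds suffice. *)
Let Dbound : exists2 G : R -> R, pintegrable G &
  forall r t, 0 < t -> t < 1 -> t < tm -> 0 < r -> `|D r t| <= G r.
Proof.
have [L L0 hL] := exp_powR_lipschitz al0 al1 x0 s0.
pose A0 := x * (2 * s) `^ al.
have A00 : 0 <= A0 by rewrite mulr_ge0 ?powR_ge0// ltW.
pose K := 4 * A0 * al / s ^+ 2 + L / s.
have s2 : 0 < s ^+ 2 by rewrite exprn_gt0.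
have K0 : 0 <= K.
  rewrite /K; apply: addr_ge0; apply: divr_ge0; rewrite ?(ltW s2) ?(ltW s0)//.
  exact: mulr_ge0 (mulr_ge0 (ler0n _ 4) A00) (ltW al0).
have [tm0|tm0] := ltP 0 tm; last first.
  exists (fun=> 0) => [|r t t0 _ ttm]; first exact: pintegrable0.
  by move: (lt_le_trans (lt_trans t0 ttm) tm0); rewrite ltxx.
have pi0 := pi_gt0 R.
have C00 : 0 < C0.
  apply: cos_gt0_pihalf; rewrite altm andbT.
  by have h : 0 < al * tm by [exact: mulr_gt0]; lra.
exists (fun r => (x * al * (2 / s)) * (r `^ (al - 1) * expR (- (x * C0 * r `^ al))) +
   (5 * s ^+ 2 * K + 10) * (s ^+ 2 + r ^+ 2)^-1).
  apply: pintegrableD; apply: pintegrableZ; last exact: pintegrable_cauchy.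
  by apply: pintegrable_stretched_exp => //; rewrite mulr_gt0.
move=> r t t0 t1 ttm r0.
have tpi : t < pi by exact: lt_trans tmpi.
have d0 : 0 < den s r t by exact: den_gt0.
have al_t : 0 <= al * t by rewrite mulr_ge0 ?ltW.
have al_t2 : al * t <= al * tm by rewrite ler_wpM2l ?ltW.
have al_t3 : al * t <= t by rewrite ler_piMl// ltW.
have C0t : C0 <= cos (al * t).
  by have h := altm; apply: ler_cos_norm; [rewrite ger0_norm|lra].
have rho0 : 0 <= r `^ al by exact: powR_ge0.
have xr0 : 0 <= x * r `^ al by rewrite mulr_ge0// ltW.
have EE : E r t <= expR (- (x * C0 * r `^ al)).
  by rewrite ler_expR lerN2 mulrAC ler_wpM2l.
have E1 : E r t <= 1.
  by apply: le_trans EE _; rewrite -expR0 ler_expR oppr_le0 !mulr_ge0// ltW.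
have sint : t / 2 <= sin t by apply: sin_ge_half; exact: ltW.
have sint0 : 0 < sin t by lra.
have sint1 : sin t <= 1 by exact: sin_le1.
have ssin : 0 < s * sin t by rewrite mulr_gt0.
have dc := den_center s r t; have dd := den_dist s r t.
have den_ge1 : (s * sin t) ^+ 2 <= den s r t by rewrite dc lerDr sqr_ge0.
have den_ge2 : (r - s) ^+ 2 <= den s r t.
  by rewrite dd lerDl !mulr_ge0 ?(ltW s0) ?(ltW r0)// subr_ge0 cos_le1.
rewrite /D mulrDl; apply: le_trans (ler_normD _ _) _; apply: lerD.
  rewrite (_ : _ / den s r t = - (E r t * (sin (be r t) / r) * ((s - r * cos t) / den s r t))); last first.
    by field; rewrite !gt_eqF.
  rewrite normrN !normrM [`|r^-1|]gtr0_norm ?invr_gt0// (ger0_norm (expR_ge0 _)).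
  rewrite [`|(den s r t)^-1|]gtr0_norm ?invr_gt0//.
  have h1 : `|sin (be r t)| / r <= x * al * r `^ (al - 1) * t.
    rewrite ler_pdivrMr//; apply: le_trans (norm_sin_le _) _.
    rewrite (_ : _ * r = x * (r * r `^ (al - 1)) * (al * t)); last by ring.
    rewrite -powR_mulB1// normrM (ger0_norm xr0) ler_wpM2l//.
    by apply: le_trans (norm_sin_le _) _; rewrite ger0_norm.
  have h2 : `|s - r * cos t| / den s r t <= (s * sin t)^-1.
    rewrite ler_pdivrMr// ler_pdivlMl//.
    have hX : (s - r * cos t) ^+ 2 <= den s r t by rewrite lerDl sqr_ge0.
    have q := sqr_ge0 (s * sin t - `|s - r * cos t|).
    have q2 : `|s - r * cos t| ^+ 2 = (s - r * cos t) ^+ 2 by rewrite real_normK ?num_real.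
    by nra.
  apply: (@le_trans _ _ (expR (- (x * C0 * r `^ al)) * (x * al * r `^ (al - 1) * t) * (s * sin t)^-1)).
    apply: ler_pM => //; first by rewrite !mulr_ge0 ?expR_ge0// invr_ge0 ltW.
      by rewrite mulr_ge0// invr_ge0 ltW.
    by apply: ler_pM => //; rewrite ?expR_ge0// mulr_ge0// invr_ge0 ltW.
  rewrite [leLHS](_ : _ = (x * al * (t / (s * sin t))) * (r `^ (al - 1) * expR (- (x * C0 * r `^ al)))); last first.
    by ring.
  rewrite ler_wpM2r ?mulr_ge0 ?powR_ge0 ?expR_ge0//.
  rewrite ler_wpM2l ?mulr_ge0 ?(ltW x0) ?(ltW al0)//.
  rewrite ler_pdivrMr// mulrA divfK ?gt_eqF//; lra.
have cau0 : 0 < s ^+ 2 + r ^+ 2 by rewrite ltr_wpDr ?sqr_ge0.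
rewrite -mulrA normrM [`|_ / den s r t|]gtr0_norm; last by rewrite divr_gt0.
have Ps01 : 0 <= Ps <= 1.
  by rewrite expR_ge0/= -expR0 ler_expR oppr_le0 mulr_ge0 ?powR_ge0// ltW.
have P1 : `|E r t * cos (be r t)| <= 1.
  rewrite normrM -[leRHS]mulr1 ler_pM ?cos_max//.
  by rewrite ger0_norm ?expR_ge0.
have [rs|rs] := leP r (2 * s).
  apply: (@le_trans _ _ K); last first.
    rewrite ler_pdivlMr//; have r2 : r ^+ 2 <= 4 * s ^+ 2 by have := r0; nra.
    by have := K0; nra.
  rewrite mulrA ler_pdivrMr//.
  have h1 : `|E r t * cos (be r t) - expR (- (x * r `^ al))| <= 2 * (A0 * (al * t)).
    apply: le_trans (exp_cos_near xr0 al_t _) _; first by have h := altm; lra.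
    rewrite ler_wpM2l// ler_wpM2r// /A0 ler_wpM2l ?(ltW x0)//.
    by rewrite ge0_ler_powR ?nnegrE ?(ltW r0) ?(ltW al0)// mulr_ge0// ltW.
  have h2 := hL r r0.
  have h3 : `|E r t * cos (be r t) - Ps| <= 2 * (A0 * (al * t)) + L * `|r - s|.
    rewrite -[X in `|X|](subrKA (expR (- (x * r `^ al)))).
    by apply: le_trans (ler_normD _ _) _; exact: lerD.
  apply: le_trans (ler_wpM2r (ltW sint0) h3) _.
  rewrite /K mulrDl [K in _ <= K]mulrDl; apply: lerD.
    rewrite [leRHS](_ : _ = 4 * A0 * al * den s r t / s ^+ 2); last by ring.
    rewrite ler_pdivlMr//.
    have A1 : 0 <= A0 * al by rewrite mulr_ge0// ltW.
    have h4 : t * sin t * s ^+ 2 <= 2 * den s r t.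
      apply: (@le_trans _ _ (2 * (s * sin t) ^+ 2)); last by rewrite ler_wpM2l.
      rewrite [leRHS](_ : _ = 2 * sin t * sin t * s ^+ 2); last by ring.
      rewrite ler_wpM2r ?(ltW s2)// ler_wpM2r ?(ltW sint0)//.
      by rewrite mulrC -ler_pdivrMr.
    rewrite (_ : _ * s ^+ 2 = 2 * (A0 * al) * (t * sin t * s ^+ 2)); last by ring.
    rewrite (_ : 4 * A0 * al * _ = 2 * (A0 * al) * (2 * den s r t)); last by ring.
    by rewrite ler_wpM2l// mulr_ge0.
  rewrite [leRHS](_ : _ = L * den s r t / s); last by ring.
  rewrite ler_pdivlMr// -!mulrA ler_wpM2l//.
  rewrite [sin t * s]mulrC; apply: mul_le_of_sqr_le => //.
  by rewrite real_normK ?num_real.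
have rs0 : 0 < (r - s) ^+ 2 by rewrite exprn_gt0// subr_gt0; have := s0; lra.
apply: (@le_trans _ _ (2 * ((r - s) ^+ 2)^-1)).
  apply: ler_pM => //; first by rewrite divr_ge0// ltW.
    apply: le_trans (ler_normB _ _) _.
    by rewrite [`|Ps|]ger0_norm ?expR_ge0//; case/andP: Ps01 => *; lra.
  rewrite ler_pdivrMr// mulrC ler_pdivlMr//; nra.
apply: (@le_trans _ _ (10 * (s ^+ 2 + r ^+ 2)^-1)); last first.
  by rewrite ler_wpM2r ?invr_ge0 ?(ltW cau0)// lerDr !mulr_ge0// ltW.
rewrite ler_pdivrMr// mulrAC ler_pdivlMr//.
by have := s0; nra.
Qed.

(** Cauchy's integral formula for [exp (- x * z ^ al)] at the point [s]: turn the
  ray towards the positive axis; in the limit the Poisson kernel concentrates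
  at the pole and picks the value [Ps]. *)
Lemma pole_value ps : 0 < ps -> ps < tm ->
  pint (fun r => poleV al x s r ps) = (pi * Ps - ps) / s.
Proof.
move=> ps0 pstm; have [G IG DG] := Dbound.
have pi0 := pi_gt0 R.
pose e := Num.min ps 1 / 2.
have e0 : 0 < e by rewrite divr_gt0// lt_min ps0 ltr01.
have eps : e < ps.
  have : Num.min ps 1 <= ps by rewrite ge_min lexx.
  by rewrite /e; lra.
have e1 : e < 1.
  have : Num.min ps 1 <= 1 by rewrite ge_min lexx orbT.
  by rewrite /e; lra.
(* Rays turning towards the positive axis. *)
pose t_ (n : nat) := e * n.+1%:R^-1.
have t0 n : 0 < t_ n by rewrite mulr_gt0 ?invr_gt0.
have te n : t_ n <= e by rewrite /t_ ler_piMr ?(ltW e0)// invf_le1 ?ler1n.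
have tps n : t_ n < ps by exact: le_lt_trans eps.
have t1 n : t_ n < 1 by exact: le_lt_trans e1.
have ttm n : t_ n < tm by exact: lt_trans pstm.
have tc : t_ n @[n --> \oo] --> (0 : R).
  by rewrite -[Z in _ --> Z](mulr0 e); apply: cvgM; [exact: cvg_cst|exact: cvg_harmonic].
pose D' n r := if r == s then 0 else D r (t_ n).
have mD' n : pmeas (D' n).
  apply: measurable_fun_if => //.
  - exact: measurable_fun_eqr.
  - by apply: measurable_funS (pmeasD (t_ n)) => // r [].
have [||_ cD] := @pint_dct R D' (fun=> 0) G mD' IG.
- move=> n r r0; rewrite /D'; case: eqP => _; last exact: DG.
  by rewrite normr0; apply: le_trans (normr_ge0 _) (DG r (t_ 0%N) _ _ _ r0).
- move=> r r0; rewrite /D'; case: eqP => rs; first exact: cvg_cst.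
  have dn : den s r 0 != 0.
    rewrite den_dist cos0 subrr mulr0 addr0 expf_neq0// subr_eq0; exact/eqP.
  have cts : {for 0, continuous (D r)}.
    by rewrite /D; eapply dv_cts; dv.
  have D0 : D r 0 = 0 by rewrite /D !(mulr0, sin0, oppr0, mul0r, addr0).
  by rewrite -[Z in _ --> Z]D0; exact: (cvg_comp _ _ tc cts).
rewrite pint0 in cD.
have J n : pint (fun r => poleV al x s r ps) = pint (D' n) + (Ps * (pi - t_ n) - (ps - t_ n)) / s.
  have [IP EP] := poisson s0 (t0 n) (lt_trans (ttm n) tmpi).
  have -> : pint (D' n) = pint (D ^~ (t_ n)).
    apply: (@pint_except_point _ _ s) => // r r0 rs; by rewrite /D' (negbTE rs).
  have ID : pintegrable (D ^~ (t_ n)).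
    by apply: (@pintegrable_le _ _ G) => // r r0; apply: DG.
  have e2 : pint (fun r => poleV al x s r (t_ n)) = pint (D ^~ (t_ n)) + Ps * ((pi - t_ n) / s).
    rewrite -EP -pintZ// -pintD//; last exact: pintegrableZ.
    by apply: eq_pint => r _; exact: poleV_split.
  have et0 : 0 < t_ n / 2 by rewrite divr_gt0.
  have pi2 := pihalf_ge1 R; have tn0 := t0 n; have tn1 := t1 n.
  have tnps := tps n; have tntm := ttm n.
  have h1 : t_ n / 2 < pi / 2 by lra.
  have h2 : t_ n / 2 < tm by lra.
  have h3 : t_ n / 2 < t_ n by lra.
  have h4 : t_ n / 2 < ps by lra.
  have /eqP := @pole_rotation R al x s s0 x0 al0 (t_ n / 2) tm et0 h1 h2 tmpi altm
    (t_ n) ps h3 tntm h4 pstm.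
  rewrite subr_eq => /eqP ->.
  by rewrite e2; field; rewrite gt_eqF.
have cJ : pint (D' n) + (Ps * (pi - t_ n) - (ps - t_ n)) / s @[n --> \oo] -->
    0 + (Ps * (pi - 0) - (ps - 0)) / s.
  apply: cvgD => //; apply: cvgM; last exact: cvg_cst.
  apply: cvgB; last by apply: cvgB => //; exact: cvg_cst.
  by apply: cvgM; [exact: cvg_cst|apply: cvgB => //; exact: cvg_cst].
have cJ' : pint (fun r => poleV al x s r ps) @[n --> \oo] --> 0 + (Ps * (pi - 0) - (ps - 0)) / s.
  by apply: cvg_trans cJ; apply: near_eq_cvg; near=> n; rewrite -J.
have := cvg_lim (@Rhausdorff R) cJ'; rewrite lim_cst; last exact: Rhausdorff.
by move=> ->; rewrite add0r !subr0 mulrC [pi * _]mulrC mulrC.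
Unshelve. all: by end_near. Qed.

End limit.
End pole_limit.

(** * The distribution function of the subordinator as a contour integral *)

Lemma laplace_sin (R : realType) (p q b : R) : 0 < p ->
  pint (fun t => expR (- (p * t)) * sin (b - t * q)) =
  (p * sin b - q * cos b) / (p ^+ 2 + q ^+ 2).
Proof.
move=> p0; have d0 : 0 < p ^+ 2 + q ^+ 2 by rewrite ltr_wpDr ?sqr_ge0// exprn_gt0.
pose F (t : R) := - (expR (- (p * t)) * (p * sin (b - t * q) - q * cos (b - t * q)) /
  (p ^+ 2 + q ^+ 2)).
have F0 : F 0 = - ((p * sin b - q * cos b) / (p ^+ 2 + q ^+ 2)).
  by rewrite /F mulr0 mul0r oppr0 expR0 mul1r addr0.
have dF (t : R) : is_derive t (1 : R) F (expR (- (p * t)) * sin (b - t * q)).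
  by rewrite /F; eapply dv_eq; [dv|]; field; rewrite gt_eqF.
have I : pintegrable (fun t => expR (- (p * t)) * sin (b - t * q)).
  apply: pintegrable_le (pintegrable_gamma ltr01 p0) _; first by mf.
  move=> t t0; rewrite subrr powRr0 mul1r; apply: norm_mul_sin_le; exact: expR_ge0.
rewrite (@pint_ftc R F _ (F 0) 0) // ?F0 ?opprK ?add0r//.
- by move=> t _; eapply dv_cts; dv.
- by rewrite -F0; apply: cvg_at_right_filter; exact: (dv_cts (dF 0)).
have [C C0 hC] := expR_pow_bound p0 (@ler01 R).
apply: (@cvg_aty_le _ _ (C * (p + `|q|) / (p ^+ 2 + q ^+ 2)) 1) => // t t1.
have t0 : 0 < t by exact: lt_le_trans t1.
rewrite /F normrN !normrM (ger0_norm (expR_ge0 _)) [`|_^-1|]gtr0_norm ?invr_gt0//.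
rewrite [leRHS]mulrAC ler_wpM2r ?invr_ge0 ?(ltW d0)//.
rewrite [leRHS]mulrAC; apply: ler_pM; rewrite ?expR_ge0 ?hC//.
apply: le_trans (ler_normB _ _) _; apply: lerD.
  by apply: norm_mul_sin_le; exact: ltW.
by rewrite normrM ler_piMr// cos_max.
Qed.

Lemma pintegrable_expN (R : realType) (s : R) : 0 < s -> pintegrable (fun t => expR (- (s * t))).
Proof.
move=> s0; apply: pintegrable_eq (pintegrable_gamma ltr01 s0) => t t0.
by rewrite subrr powRr0 mul1r.
Qed.

Lemma pint_expN (R : realType) (s : R) : 0 < s -> pint (fun t => expR (- (s * t))) = s^-1.
Proof.
move=> s0; have := laplace_sin 0 (pi / 2) s0.
rewrite sin_pihalf cos_pihalf mulr0 subr0 mulr1 expr0n addr0 expr2 invfM mulVKf ?gt_eqF// => <-.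
by apply: eq_pint => t _; rewrite mulr0 subr0 sin_pihalf mulr1.
Qed.

Lemma Gamma1 (R : realType) : Gamma (1 : R) = 1.
Proof.
rewrite GammaE; transitivity (pint (fun t : R => expR (- (1 * t)))).
  by apply: eq_pint => t _; rewrite subrr powRr0 mul1r mul1r.
by rewrite pint_expN// invr1.
Qed.

Section subordinator_cdf.
Context {R : realType}.
Variables (al th : R).
Implicit Types (x t s r a b p q B C : R).
Hypothesis angle : contour_angle al th.

Local Notation phi := (al * (th + pi)).
Local Notation kerr := (ker al th).
Local Notation "'al0'" := (al_gt0 angle).
Local Notation "'al1'" := (al_lt1 angle).

(** Differentiating [exp (t * z)] raises the exponent by [1] and turns the phase;
  the half-turn in the argument [th + pi] accounts for the sign. *)
Lemma dv_ker_time t a x B r : 0 < r ->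
  is_derive t (1 : R) (fun t => kerr t a x B r) (- kerr t (a + 1) x (B + th) r).
Proof.
move=> r0; rewrite /ker; eapply dv_eq; first by dv.
rewrite (_ : B + th - t * r * sin th - x * r `^ al * sin phi =
  (B - t * r * sin th - x * r `^ al * sin phi) + th); last by ring.
rewrite [sin (_ + th)]sinD (_ : a + 1 - 1 = (a - 1) + 1); last by ring.
by rewrite (powR_add (a - 1) 1 r0) powRr1 ?(ltW r0)//; ring.
Qed.

(** [sin] vanishes at the origin, which compensates the factor [1 / r]. *)
Lemma ker0_le t x r : 0 <= t -> 0 <= x -> 0 < r ->
  `|kerr t 0 x 0 r| <= (t + x * r `^ (al - 1)) * (expR (- (t * cos th * r)) *
     expR (- (x * cos phi * r `^ al))).
Proof.
move=> t0 x0 r0; rewrite /ker !normrM !(ger0_norm (expR_ge0 _)) (ger0_norm (powR_ge0 _ _)).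
rewrite (_ : t * r * cos th = t * cos th * r); last by ring.
rewrite (_ : x * r `^ al * cos phi = x * cos phi * r `^ al); last by ring.
set e1 := expR _; set e2 := expR _.
rewrite (_ : _ * e1 * e2 * _ = (e1 * e2) * (`|sin (0 - t * r * sin th - x * r `^ al * sin phi)| *
  r `^ (0 - 1))); last by ring.
rewrite [leRHS]mulrC ler_wpM2l ?mulr_ge0 ?expR_ge0// -[x * _ * _]mulrA.
have h : `|sin (0 - t * r * sin th - x * (r `^ al * sin phi))| <= t * r + x * r `^ al.
  apply: le_trans (norm_sin_le _) _; rewrite sub0r -opprD normrN.
  apply: le_trans (ler_normD _ _) _; apply: lerD; last rewrite mulrA.
    by apply: norm_mul_sin_le; rewrite mulr_ge0// ltW.
  by apply: norm_mul_sin_le; rewrite mulr_ge0// powR_ge0.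
apply: le_trans (ler_wpM2r (powR_ge0 _ _) h) _.
rewrite (powR_mulB1 al r0) sub0r powRN powRr1 ?(ltW r0)// le_eqVlt.
by apply/orP; left; apply/eqP; field; rewrite gt_eqF.
Qed.

Lemma pintegrable_ker0 t x : 0 <= t -> 0 < x -> pintegrable (kerr t 0 x 0).
Proof.
move=> t0 x0; have c0 := cosphi_gt0 angle; have k0 : 0 < x * cos phi by rewrite mulr_gt0.
have a0 := al0.
have I b : 0 < b -> pintegrable (fun r => r `^ (b - 1) * expR (- (x * cos phi * r `^ al))).
  by move=> b0; exact: pintegrable_stretched_exp.
apply: (@pintegrable_le _ _ _ (pmeas_ker al th t 0 x 0) (pintegrableD
  (pintegrableZ t (I 1 ltr01)) (pintegrableZ x (I al a0)))).
move=> r r0; apply: le_trans (ker0_le t0 (ltW x0) r0) _.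
rewrite subrr powRr0 mul1r [X in _ <= _ + X]mulrA -mulrDl ler_wpM2l//.
  by rewrite addr_ge0 ?mulr_ge0 ?powR_ge0 ?(ltW x0).
rewrite ler_piMl ?expR_ge0// -[leRHS]expR0 ler_expR oppr_le0.
by rewrite !mulr_ge0 ?(ltW (costh_gt0 angle)) ?(ltW r0).
Qed.

Lemma dv_pint_ker0 t x : 0 < t -> 0 < x ->
  is_derive x (1 : R) (fun x => pint (kerr t 0 x 0)) (- pint (kerr t al x phi)).
Proof.
move=> t0 x0; have a0 := al0.
rewrite -pintN; last by apply: pintegrable_ker => //; exact: ltW.
apply: (@pint_dv R (fun x r => kerr t 0 x 0 r) (fun x r => - kerr t al x phi r)
  x 0 (x + 1) _ x0 _ _ _ (pintegrable_kerdom angle t0 a0)).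
- by rewrite ltrDl.
- by move=> y y0 _; apply: pintegrable_ker0 => //; exact: ltW.
- by move=> y r y0 _ r0; have := dv_ker al th t 0 y 0 r0; rewrite !add0r.
- by move=> y r y0 _ r0; rewrite normrN; apply: (ker_le angle); exact: ltW.
Qed.

Lemma dv_pint_ker0_time t x : 0 < t -> 0 < x ->
  is_derive t (1 : R) (fun t => pint (kerr t 0 x 0)) (- pint (kerr t 1 x th)).
Proof.
move=> t0 x0; have a0 := al0; have t20 : 0 < t / 2 by rewrite divr_gt0.
rewrite -pintN; last by apply: pintegrable_ker => //; exact: ltW.
apply: (@pint_dv R (fun t r => kerr t 0 x 0 r) (fun t r => - kerr t 1 x th r)
  t (t / 2) (t + 1) _ _ _ _ _ (pintegrable_kerdom angle t20 ltr01)).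
- by lra.
- by rewrite ltrDl.
- by move=> y y0 _; apply: pintegrable_ker0 => //; lra.
- by move=> y r y0 _ r0; have := dv_ker_time y 0 x 0 r0; rewrite !add0r.
- move=> y r y0 _ r0; rewrite normrN.
  apply: le_trans (ker_le angle y 1 th r (ltW x0)) _.
  rewrite ler_wpM2l ?powR_ge0// ler_expR lerN2 ler_wpM2r ?(ltW r0)//.
  by rewrite ler_wpM2r ?(ltW (costh_gt0 angle))// ltW.
Qed.

(** [P (D x <= t)], where [D] is the stable subordinator of index [al]: the
  inverse Laplace transform of [exp (- x * s ^ al) / s]. *)
Definition subcdf x t : R := (th + pi) / pi + pi^-1 * pint (kerr t 0 x 0).

Lemma dv_subcdf t x : 0 < t -> 0 < x ->
  is_derive x (1 : R) (fun x => subcdf x t) (- (pi^-1 * pint (kerr t al x phi))).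
Proof.
move=> t0 x0; have d := dv_pint_ker0 t0 x0; rewrite /subcdf.
eapply dv_eq; first by eapply dvD; [dv|eapply dvM; [dv|exact: d]].
by rewrite mul0r !add0r mulrN.
Qed.

Lemma cts_subcdf_time x t : 0 < t -> 0 < x -> {for t, continuous (subcdf x)}.
Proof.
move=> t0 x0; have d := dv_pint_ker0_time t0 x0; rewrite /subcdf.
by eapply dv_cts; eapply dvD; [dv|eapply dvM; [dv|exact: d]].
Qed.

Local Notation J x b := (pint (fun r => r `^ (b - 1) * expR (- (x * cos phi * r `^ al)))).

Let pintegrable_J x b : 0 < x -> 0 < b ->
  pintegrable (fun r => r `^ (b - 1) * expR (- (x * cos phi * r `^ al))).
Proof.
move=> x0 b0; apply: pintegrable_stretched_exp => //; first exact: al0.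
by rewrite mulr_gt0// (cosphi_gt0 angle).
Qed.

Let pint_norm_ker0_le x t : 0 < x -> 0 < t ->
  pint (fun r => `|kerr t 0 x 0 r|) <= t * J x 1 + x * J x al.
Proof.
move=> x0 t0; have a0 := al0.
have I1 := pintegrable_J x0 ltr01; have I2 := pintegrable_J x0 a0.
rewrite -pintZ// -pintZ// -pintD//; try exact: pintegrableZ.
apply: le_pint.
- by apply: pintegrable_norm; apply: pintegrable_ker0 => //; exact: ltW.
- by apply: pintegrableD; exact: pintegrableZ.
move=> r r0; apply: le_trans (ker0_le (ltW t0) (ltW x0) r0) _.
rewrite subrr powRr0 mul1r [X in _ <= _ + X]mulrA -mulrDl ler_wpM2l//.
  by rewrite addr_ge0 ?mulr_ge0 ?powR_ge0 ?(ltW x0) ?(ltW t0).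
rewrite ler_piMl ?expR_ge0// -[leRHS]expR0 ler_expR oppr_le0.
by rewrite !mulr_ge0 ?(ltW (costh_gt0 angle)) ?(ltW r0) ?(ltW t0).
Qed.

Let pmeas_pint_ker0 x : 0 < x -> pmeas (fun t => pint (kerr t 0 x 0)).
Proof. by move=> x0; apply: pmeas_cts => t t0; apply: dv_cts (dv_pint_ker0_time t0 x0). Qed.

Let pintegrable_texp A B s : 0 < s -> pintegrable (fun t => expR (- (s * t)) * (t * A + B)).
Proof.
move=> s0; have s2 : 0 < 2 :> R by [].
apply: pintegrable_eq (pintegrableD (pintegrableZ A (pintegrable_gamma s2 s0))
  (pintegrableZ B (pintegrable_gamma ltr01 s0))) => t t0.
rewrite subrr powRr0 (_ : 2 - 1 = 1 :> R) ?powRr1 ?(ltW t0)//; last by ring.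
by ring.
Qed.

(** Laplace transform in time: the inner integral is elementary and leaves the
  kernel of Cauchy's formula with a pole at [s]. *)
Lemma laplace_subcdf x s : 0 < x -> 0 < s ->
  pintegrable (fun t => expR (- (s * t)) * subcdf x t) /\
  pint (fun t => expR (- (s * t)) * subcdf x t) = expR (- (x * s `^ al)) / s.
Proof.
move=> x0 s0; have a0 := al0; have pi0 := pi_gt0 R.
pose f t r := expR (- (s * t)) * kerr t 0 x 0 r.
pose g t := expR (- (s * t)) * (t * J x 1 + x * J x al).
have Ig : pintegrable g by exact: pintegrable_texp.
have I1 t : 0 < t -> pintegrable (f t).
  by move=> t0; apply: pintegrableZ; apply: pintegrable_ker0 => //; exact: ltW.
have fg t : 0 < t -> pint (fun r => `|f t r|) <= g t.
  move=> t0; apply: le_trans (ler_wpM2l (expR_ge0 (- (s * t))) (pint_norm_ker0_le x0 t0)).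
  rewrite -pintZ; last by apply: pintegrable_norm; apply: pintegrable_ker0 => //; exact: ltW.
  rewrite le_eqVlt; apply/orP; left; apply/eqP; apply: eq_pint => r _.
  by rewrite /f normrM ger0_norm// expR_ge0.
have Ef t : 0 < t -> expR (- (s * t)) * pint (kerr t 0 x 0) = pint (f t).
  by move=> t0; rewrite pintZ//; apply: pintegrable_ker0 => //; exact: ltW.
have If : pintegrable (fun t => expR (- (s * t)) * pint (kerr t 0 x 0)).
  apply: (@pintegrable_le _ _ g) => //.
    by apply: measurable_funM; [mf|exact: pmeas_pint_ker0].
  move=> t t0; rewrite Ef//; apply: le_trans (fg t t0).
  by apply: norm_pint_le => //; [exact: I1|exact/pintegrable_norm/I1].
have Ie := pintegrable_expN s0.
have Ee := pint_expN s0.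
have D t : expR (- (s * t)) * subcdf x t = (th + pi) / pi * expR (- (s * t)) +
    pi^-1 * (expR (- (s * t)) * pint (kerr t 0 x 0)).
  by rewrite /subcdf; ring.
split.
  by apply: pintegrable_eq (pintegrableD (pintegrableZ ((th + pi) / pi) Ie)
    (pintegrableZ pi^-1 If)) => t _; rewrite D.
under eq_pint do rewrite D.
rewrite pintD ?pintZ //; [|exact: pintegrableZ|exact: pintegrableZ].
rewrite Ee (eq_pint Ef) (@pint_swap R f g _ _ _ fg Ig); last first.
- move=> r r0; apply: pintegrable_le (pintegrableZ r^-1 Ie) _.
    by rewrite /f /ker; mf.
  move=> t t0; rewrite /f normrM (ger0_norm (expR_ge0 _)) [leRHS]mulrC ler_wpM2l ?expR_ge0//.
  apply: le_trans (ker_le angle t 0 0 r (ltW x0)) _.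
  rewrite sub0r powRN powRr1 ?(ltW r0)// ler_piMr ?invr_ge0 ?(ltW r0)//.
  rewrite -[leRHS]expR0 ler_expR oppr_le0.
  by rewrite !mulr_ge0 ?(ltW (costh_gt0 angle)) ?(ltW r0) ?(ltW t0).
- exact: I1.
- by rewrite /f /ker; mf.
have [_ thN th0 alth] := angle.
have ps0 : 0 < th + pi by lra.
(* Room for an angle beyond [th + pi] that still meets both constraints. *)
pose d := Num.min (pi - (th + pi)) (pi / 2 - al * (th + pi)) / 2.
have d0 : 0 < d by rewrite divr_gt0// lt_min; apply/andP; split; lra.
have d1 : d * 2 <= pi - (th + pi) by rewrite /d divfK// ge_min lexx.
have d2 : d * 2 <= pi / 2 - al * (th + pi) by rewrite /d divfK// ge_min lexx orbT.
have tmpi : th + pi + d < pi by lra.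
have altm : al * (th + pi + d) < pi / 2.
  have h : al * d <= d by rewrite ler_piMl ?ltW//; exact: al1.
  by rewrite mulrDr; lra.
have pstm : th + pi < th + pi + d by rewrite ltrDl.
have pv := pole_value a0 (ltW al1) x0 s0 tmpi altm ps0 pstm.
rewrite (_ : pint (fun r => pint (f ^~ r)) = pint (fun r => poleV al x s r (th + pi))).
  have pn : pi != 0 :> R by rewrite gt_eqF.
  have sn : s != 0 by rewrite gt_eqF.
  rewrite pv; move: (@pi R) pn => p pn; field.
  by rewrite pn sn.
apply: eq_pint => r r0.
have p0 : 0 < s + r * cos th by rewrite addr_gt0// mulr_gt0// (costh_gt0 angle).
pose K := r^-1 * expR (- (x * r `^ al * cos phi)).
rewrite (_ : pint (f ^~ r) = pint (fun t => K * (expR (- ((s + r * cos th) * t)) *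
   sin (- (x * r `^ al * sin phi) - t * (r * sin th))))); last first.
  apply: eq_pint => t t0; rewrite /f /ker sub0r powRN powRr1 ?(ltW r0)// /K.
  rewrite (_ : - ((s + r * cos th) * t) = - (s * t) + - (t * r * cos th)); last by ring.
  rewrite expRD (_ : 0 - t * r * sin th - _ = - (x * r `^ al * sin phi) - t * (r * sin th)); ring.
rewrite pintZ; last first.
  apply: pintegrable_le (pintegrable_gamma ltr01 p0) _; first by mf.
  move=> t t0; rewrite subrr powRr0 mul1r; apply: norm_mul_sin_le; exact: expR_ge0.
rewrite laplace_sin// sinN cosN /poleV cosDpi sinDpi /K.
have n0 : (s + r * cos th) ^+ 2 + (r * sin th) ^+ 2 != 0.
  by rewrite gt_eqF// ltr_wpDr ?sqr_ge0// exprn_gt0.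
rewrite (_ : s - r * - cos th = s + r * cos th); last by ring.
rewrite (_ : (r * - sin th) ^+ 2 = (r * sin th) ^+ 2); last by ring.
move: n0; set b := x * _ * _; set den := (_ + _ ^+ 2 : R) => n0.
by field; rewrite n0 gt_eqF.
Qed.

End subordinator_cdf.

(** * Injectivity of the Laplace transform *)

Section laplace_injective.
Context {R : realType}.
Implicit Types (g h : R -> R) (t y a b c d : R).
Local Notation mu := (@lebesgue_measure R).

Lemma bernoulli_lower y N : 0 <= y -> y <= 1 -> 1 - N%:R * y <= (1 - y) ^+ N.
Proof.
move=> y0 y1; elim: N => [|N IH]; first by rewrite mul0r subr0 expr0.
rewrite exprS; have y1' : 0 <= 1 - y by rewrite subr_ge0.
apply: le_trans (ler_wpM2l y1' IH); rewrite -natr1.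
have := ler0n R N; set n := N%:R => n0; have := mulr_ge0 n0 (sqr_ge0 y); nra.
Qed.

Lemma bernoulli_upper y N : 0 <= y -> y <= 1 -> (1 - y) ^+ N <= (1 + N%:R * y)^-1.
Proof.
move=> y0 y1; have pos M : 0 < 1 + M%:R * y by rewrite ltr_wpDr ?mulr_ge0.
rewrite -[leRHS]mul1r ler_pdivlMr//; elim: N => [|N IH]; first by rewrite mul0r addr0 mulr1.
apply: le_trans IH; rewrite exprS mulrAC mulrC ler_wpM2l ?exprn_ge0 ?subr_ge0//.
rewrite -natr1; have := ler0n R N; set n := N%:R => n0.
have := mulr_ge0 n0 (sqr_ge0 y); nra.
Qed.

(** The powers [(1 - exp (- n t)) ^ N] with [N] close to [exp (n t0)] select
  the half-line [t > t0]. *)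
Definition laplace_step t0 n t : R :=
  (1 - expR (- (n%:R * t))) ^+ Num.truncn (expR (n%:R * t0)).

Lemma laplace_step_ge0 t0 n t : 0 < t -> 0 <= laplace_step t0 n t <= 1.
Proof.
move=> t_gt0; have h : 0 <= n%:R * t by rewrite mulr_ge0// ltW.
have e1 : expR (- (n%:R * t)) <= 1 by rewrite -[leRHS]expR0 ler_expR oppr_le0.
have e0 := expR_ge0 (- (n%:R * t)).
by rewrite exprn_ge0 ?exprn_ile1//; lra.
Qed.

Lemma cvg_expN d : 0 < d -> expR (- (n%:R * d)) @[n --> \oo] --> (0 : R).
Proof.
move=> d0; have -> : (fun n => expR (- (n%:R * d))) = (fun n => expR (- d) ^+ n).
  by apply/funext => n; rewrite -expRM_natl mulrN.
by apply: cvg_expr; rewrite ger0_norm ?expR_ge0// -expR0 ltr_expR oppr_lt0.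
Qed.

Lemma laplace_step_cvg t0 t : 0 < t -> t != t0 ->
  laplace_step t0 n t @[n --> \oo] --> (if t0 < t then 1 else 0 : R).
Proof.
move=> t_gt0 tt0.
have y0 n := expR_ge0 (- (n%:R * t)).
have y1 n : expR (- (n%:R * t)) <= 1.
  by rewrite -[leRHS]expR0 ler_expR oppr_le0 mulr_ge0// ltW.
have N1 n : (Num.truncn (expR (n%:R * t0)))%:R <= expR (n%:R * t0).
  by rewrite truncn_le expR_ge0.
have N2 n : expR (n%:R * t0) <= (Num.truncn (expR (n%:R * t0)))%:R + 1.
  by rewrite natr1; exact/ltW/truncnS_gt.
have [lt0|gt0] := ltP t0 t.
  have c : 1 - expR (- (n%:R * (t - t0))) @[n --> \oo] --> (1 : R).
    rewrite -[Z in _ --> Z]subr0; apply: cvgB; first exact: cvg_cst.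
    by apply: cvg_expN; rewrite subr_gt0.
  apply: (@squeeze_cvgr _ _ _ _ (fun n => 1 - expR (- (n%:R * (t - t0)))) (fun=> 1) _ _ _ c);
    last exact: cvg_cst.
  near=> n; have /andP[_ ->] := laplace_step_ge0 t0 n t_gt0; rewrite andbT.
  apply: le_trans (bernoulli_lower _ (y0 n) (y1 n)); rewrite lerD2l lerN2.
  apply: le_trans (ler_wpM2r (y0 n) (N1 n)) _.
  by rewrite -expRD le_eqVlt; apply/orP; left; apply/eqP; congr expR; ring.
have ltt0 : t < t0 by rewrite lt_neqAle tt0.
apply: (@squeeze_cvgr _ _ _ _ (fun=> 0) (fun n => expR (- (n%:R * (t0 - t))))).
- near=> n; have /andP[-> _] := laplace_step_ge0 t0 n t_gt0.
  apply: le_trans (bernoulli_upper _ (y0 n) (y1 n)) _.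
  have pos : 0 < 1 + (Num.truncn (expR (n%:R * t0)))%:R * expR (- (n%:R * t)).
    by rewrite ltr_wpDr ?mulr_ge0.
  rewrite [leRHS]expRN lef_pV2 ?posrE ?expR_gt0//.
  rewrite (_ : n%:R * (t0 - t) = n%:R * t0 + - (n%:R * t)); last by ring.
  rewrite expRD; apply: le_trans (ler_wpM2r (y0 n) (N2 n)) _.
  by rewrite mulrDl mul1r addrC lerD2r.
- exact: cvg_cst.
- by apply: cvg_expN; rewrite subr_gt0.
Unshelve. all: by end_near. Qed.

(** Polynomials in [exp (- t)] without constant term are orthogonal to [g], hence
  so is [exp (- t)] times a [laplace_step]; pass to the limit. *)
Lemma laplace_tail g a : pintegrable (fun t => expR (- t) * g t) ->
  (forall m : nat, pint (fun t => expR (- (m.+1%:R * t)) * g t) = 0) ->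
  pint (fun t => if a < t then expR (- t) * g t else 0) = 0.
Proof.
move=> Ih h0; set h := fun t => _ in Ih.
have mh := pintegrable_meas Ih.
have E m t : expR (- (m.+1%:R * t)) * g t = expR (- (m%:R * t)) * h t.
  by rewrite /h mulrA -expRD -natr1; congr (expR _ * _); ring.
have e1 m t : 0 < t -> expR (- (m%:R * t)) <= 1.
  by move=> t0; rewrite -[leRHS]expR0 ler_expR oppr_le0 mulr_ge0// ltW.
have I k m N : pintegrable (fun t => (1 - expR (- (k%:R * t))) ^+ N * (expR (- (m%:R * t)) * h t)).
  apply: pintegrable_le (pintegrable_norm Ih) _.
    by apply: measurable_funM; [mf|apply: measurable_funM => //; mf].
  move=> t t0; rewrite !normrM mulrA ler_piMl// mulr_ile1//.
    have := e1 k t t0; have := expR_ge0 (- (k%:R * t)) => h1 h2.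
    by rewrite ger0_norm ?exprn_ile1 ?exprn_ge0//; lra.
  by rewrite ger0_norm ?expR_ge0// e1.
have Z k N : forall m, pint (fun t => (1 - expR (- (k%:R * t))) ^+ N * (expR (- (m%:R * t)) * h t)) = 0.
  elim: N => [|N IH] m.
    by rewrite -[RHS](h0 m); apply: eq_pint => t _; rewrite expr0 mul1r E.
  rewrite -[RHS](subrr 0) -[X in X - _](IH m) -[X in _ - X](IH (k + m)%N) -pintB//.
  apply: eq_pint => t _; rewrite exprS natrD.
  rewrite (_ : - ((k%:R + m%:R) * t) = - (k%:R * t) + - (m%:R * t)); last by ring.
  by rewrite expRD; ring.
(* The limit of the steps at [a] itself is left aside. *)
pose F n t := if t == a then 0 else laplace_step a n t * h t.
have mF n : pmeas (F n).
  apply: measurable_fun_if => //.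
  - exact: measurable_fun_eqr.
  - apply: (@measurable_funS _ _ _ _ [set` `](0 : R), +oo[]) => //.
    by apply: measurable_funM => //; rewrite /laplace_step; mf.
have mL : pmeas (fun t => if a < t then h t else 0).
  apply: measurable_fun_if => //.
  - exact: measurable_fun_ltr.
  - by apply: (@measurable_funS _ _ _ _ [set` `](0 : R), +oo[]).
pose L t := if t == a then 0 else if a < t then h t else 0.
have [||IL c] := @pint_dct R F L _ mF (pintegrable_norm Ih).
- move=> n t t0; rewrite /F; case: eqP => _; first by rewrite normr0.
  have /andP[s0 s1] := laplace_step_ge0 a n t0.
  by rewrite normrM ger0_norm// ler_piMl.
- move=> t t0; rewrite /F /L; case: eqP => ta; first exact: cvg_cst.
  have -> : (if a < t then h t else 0) = (if a < t then 1 else 0) * h t.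
    by case: ifP; rewrite ?mul1r ?mul0r.
  by apply: cvgM; [apply: laplace_step_cvg => //; exact/eqP|exact: cvg_cst].
rewrite (@pint_except_point _ _ L a mL); last first.
- by move=> t _ ta; rewrite /L (negbTE ta).
- exact: pintegrable_meas IL.
have F0 n : pint (F n) = 0.
  rewrite -[RHS](Z n (Num.truncn (expR (n%:R * a))) 0%N).
  apply: (@pint_except_point _ _ _ a (mF n)).
    exact: pintegrable_meas (I _ _ _).
  by move=> t t0 ta; rewrite /F (negbTE ta) mul0r oppr0 expR0 mul1r.
have e := cvg_lim (@Rhausdorff R) c.
rewrite (_ : (fun n => pint (F n)) = fun=> 0) in e; last exact/funext.
by rewrite -(e _) lim_cst//; exact: Rhausdorff.
Unshelve. all: by end_near. Qed.

(** If [g a > 0], then [g] stays above [g a / 2] on a short interval to the right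
  of [a], over which the integral is a difference of two vanishing tails. *)
Lemma laplace_nonpos g : pintegrable (fun t => expR (- t) * g t) ->
  (forall m : nat, pint (fun t => expR (- (m.+1%:R * t)) * g t) = 0) ->
  forall a, 0 < a -> g t @[t --> a^'+] --> g a -> g a <= 0.
Proof.
move=> Ih h0 a a0 ga; rewrite leNgt; apply/negP => gpos.
have g2 : g a / 2 < g a by lra.
have [/= e e0 he] : \forall t \near a^'+, g a / 2 < g t by exact: cvgr_gt ga _ g2.
pose b := a + e / 2; have ab : a < b by rewrite ltrDl divr_gt0.
have gab t : a < t -> t <= b -> g a / 2 <= g t.
  move=> at_ tb; apply/ltW/he => //=.
  by rewrite /ball/= distrC gtr0_norm ?subr_gt0//; move: tb; rewrite /b; lra.
pose h t := expR (- t) * g t; pose H c t := if c < t then h t else 0.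
have IH c : pintegrable (H c).
  apply: pintegrable_le (pintegrable_norm Ih) _.
    apply: measurable_fun_if => //; first exact: measurable_fun_ltr.
    by apply: (@measurable_funS _ _ _ _ [set` `](0 : R), +oo[]) => //; exact: pintegrable_meas.
  by move=> t t0; rewrite /H; case: ifP; rewrite ?normr0.
have H0 c : pint (H c) = 0 by exact: laplace_tail.
have D0 : pint (fun t => H a t - H b t) = 0 by rewrite pintB// !H0 subrr.
pose k := expR (- b) * (g a / 2).
have k0 : 0 < k by rewrite mulr_gt0 ?expR_gt0 ?divr_gt0.
have mI : measurable ([set` `]a, b]] : set (measurableTypeR R)) by exact: measurable_itv.
have sub : [set` `]a, b]] `<=` [set` `](0 : R), +oo[].
  by move=> t /=; rewrite !in_itv/= => /andP[h1 _]; rewrite (lt_trans a0).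
have le1 t : 0 < t -> k * \1_([set` `]a, b]]) t <= H a t - H b t.
  move=> t0; rewrite indicE /H; case: (boolP (_ \in _)) => [|/negP nin].
    rewrite inE/= in_itv/= => /andP[at_ tb]; rewrite at_ ltNge tb/= subr0 mulr1 /h.
    apply: ler_pM; rewrite ?expR_ge0 ?divr_ge0 ?(ltW gpos) ?gab//.
    by rewrite ler_expR lerN2.
  rewrite mulr0; case: ltP => at_; case: ltP => bt; rewrite ?subrr//.
    by exfalso; apply: nin; rewrite inE/= in_itv/= at_.
  by have := lt_le_trans ab (ltW bt); rewrite ltNge at_.
have m1 : pmeas (\1_([set` `]a, b]])).
  apply: (@measurable_funS _ _ (measurableTypeR R) _ setT) => //.
have I1 : pintegrable (fun t => k * \1_([set` `]a, b]]) t).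
  apply: pintegrable_le (pintegrable_norm (pintegrableB (IH a) (IH b))) _.
    by apply: measurable_funM => //; mf.
  move=> t t0; rewrite [leLHS]ger0_norm; last by apply: mulr_ge0; [exact: ltW|].
  by apply: le_trans (le1 t t0) (ler_norm _).
have := le_pint I1 (pintegrableB (IH a) (IH b)) le1; rewrite D0.
have -> : pint (fun t => k * \1_([set` `]a, b]]) t) = k * (b - a).
  have Ik := pintegrableZ k^-1 I1.
  have I1' : pintegrable (\1_([set` `]a, b]])).
    by apply: pintegrable_eq Ik => t _; rewrite mulKf ?gt_eqF.
  rewrite pintZ//; congr (_ * _); rewrite /pint /Rintegral.
  rewrite (@integral_indic _ (measurableTypeR R) R mu _ (measurable_itv _) _ mI).
  rewrite (_ : _ `&` _ = [set` `]a, b]]); last exact: setIidl.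
  have hm := @lebesgue_measure_itv R `]a, b]; rewrite /= lte_fin ab in hm.
  by transitivity (fine (b%:E - a%:E)%E); [congr fine; exact: hm|].
by rewrite leNgt mulr_gt0// subr_gt0.
Qed.

(** Apply [laplace_nonpos] to [g] and to [- g]. *)
Lemma laplace_eq0 g : pintegrable (fun t => expR (- t) * g t) ->
  (forall m : nat, pint (fun t => expR (- (m.+1%:R * t)) * g t) = 0) ->
  (forall a, 0 < a -> g t @[t --> a^'+] --> g a) ->
  forall a, 0 < a -> g a = 0.
Proof.
move=> Ih h0 cg a a0; apply/eqP; rewrite eq_le (laplace_nonpos Ih h0 a0 (cg a a0))/=.
rewrite -oppr_le0; apply: (@laplace_nonpos (fun t => - g t)) => //.
- by apply: pintegrable_eq (pintegrableN Ih) => t _; rewrite mulrN.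
- move=> m; transitivity (pint (fun t => -1 * (expR (- (m.+1%:R * t)) * g t))).
    by apply: eq_pint => t _; rewrite mulN1r mulrN.
  rewrite pintZ ?h0 ?mulr0//.
  apply: pintegrable_le (pintegrable_norm Ih) _.
    have -> : (fun t => expR (- (m.+1%:R * t)) * g t) =
        (fun t => expR (- (m%:R * t)) * (expR (- t) * g t)).
      by apply/funext => t; rewrite mulrA -expRD -natr1; congr (expR _ * _); ring.
    by apply: measurable_funM; [mf|exact: pintegrable_meas].
  move=> t t0; rewrite !normrM !(ger0_norm (expR_ge0 _)) ler_wpM2r// ler_expR lerN2.
  by rewrite ler_peMl ?(ltW t0)// ler1n.
- by apply: cvgN; exact: cg.
Qed.

End laplace_injective.

(** * The law of the inverse stable subordinator *)

Lemma pint_tail_expN (R : realType) (s c : R) : 0 < s -> 0 <= c ->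
  pint (fun t => if c <= t then expR (- (s * t)) else 0) = expR (- (s * c)) / s.
Proof.
move=> s0; rewrite le_eqVlt => /predU1P[<-|c0].
  rewrite mulr0 oppr0 expR0 mul1r -pint_expN//; apply: eq_pint => t t0.
  by rewrite (ltW t0).
rewrite /pint /Rintegral.
transitivity (fine (\int[lebesgue_measure]_(t in `[c, +oo[) (expR (- (s * t)))%:E)).
  congr fine; rewrite integral_mkcond [RHS]integral_mkcond; apply: eq_integral => t _.
  rewrite !patchE.
  have -> : (t \in [set` `[c, +oo[]) = (c <= t).
    by apply/idP/idP; rewrite inE/= in_itv/= andbT.
  rewrite in_posE.
  by have [ct|ct] := leP c t; [rewrite (lt_le_trans c0 ct)|case: ifP].
pose F (t : R) := - (expR (- (s * t)) / s).
have dF (t : R) : is_derive t (1 : R) F (expR (- (s * t))).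
  by rewrite /F; eapply dv_eq; [dv|]; field; rewrite gt_eqF.
rewrite (@ge0_continuous_FTC2y R _ F c 0).
- by rewrite sub0e -EFinN /F/= opprK.
- by move=> t _; exact: expR_ge0.
- by apply: continuous_subspaceT => t; eapply dv_cts; dv.
- apply: (@cvg_aty_le _ _ (s^-1 * s^-1) 1) => // t t1; have t0 : 0 < t by exact: lt_le_trans t1.
  rewrite /F normrN ger0_norm ?divr_ge0 ?expR_ge0 ?(ltW s0)// mulrC -mulrA.
  rewrite ler_wpM2l ?invr_ge0 ?(ltW s0)// powRN powRr1 ?(ltW t0)// -invfM expRN.
  rewrite lef_pV2 ?posrE ?expR_gt0 ?mulr_gt0//.
  by apply: le_trans (expR_ge1Dx _); rewrite lerDr.
- by move=> t _; exact: dv_derivable (dF t).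
- by apply: cvg_at_right_filter; exact: dv_cts (dF c).
- by move=> t _; rewrite (dv_derive1 (dF t)).
Qed.

Section subordinator_law.
Context d (T : measurableType d) (R : realType) (P : probability T R).
Variables (al th : R) (D : R -> {RV P >-> R}).
Hypothesis angle : contour_angle al th.
Hypothesis hD : stable_subordinator al D.
Implicit Types (x s t a : R).

Lemma subordinator_ge0 x : 0 <= x -> {ae P, forall w, 0 <= D x w}.
Proof.
move=> x0; have [[[D0 _ _ _ _] mono] _] := hD.
by apply: filterS2 D0 mono => w D0 mono; rewrite -D0; exact: mono.
Qed.

Lemma measurable_subordinator_le x t : measurable [set w | D x w <= t].
Proof.
rewrite (_ : [set w | _] = D x @^-1` [set` `]-oo, t]]); last first.
  by apply/seteqP; split=> w /=; rewrite in_itv.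
by rewrite -[X in measurable X]setTI; exact: measurable_funP.
Qed.

Let q x t : R := fine (P [set w | D x w <= t]).

Let qE x t : (q x t)%:E = P [set w | D x w <= t].
Proof. by rewrite fineK// fin_num_measure//; exact: measurable_subordinator_le. Qed.

Let q_ge0 x t : 0 <= q x t.
Proof. by rewrite -lee_fin qE. Qed.

Let q_le1 x t : q x t <= 1.
Proof. by rewrite -lee_fin qE probability_le1//; exact: measurable_subordinator_le. Qed.

Let q_cdf x t : (q x t)%:E = cdf (D x) t.
Proof.
rewrite qE /cdf /distribution /pushforward; congr (P _).
Qed.

Let mq x : measurable_fun setT (q x).
Proof.
by apply/measurable_EFinP; rewrite (_ : _ \o _ = cdf (D x)); [exact: cdf_measurable|apply/funext => t /=].
Qed.

Let rcq x t : q x u @[u --> t^'+] --> q x t.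
Proof.
have := @cdf_right_continuous _ _ _ _ (D x) t; rewrite -q_cdf => h.
have -> : q x = fine \o cdf (D x) by apply/funext => u /=; rewrite -q_cdf.
exact: fine_cvg h.
Qed.

Let Iq x s : 0 < s -> pintegrable (fun t => expR (- (s * t)) * q x t).
Proof.
move=> s0; apply: pintegrable_le (pintegrable_expN s0) _.
  by apply: measurable_funM; [mf|exact: measurable_funS (mq x)].
by move=> t _; rewrite normrM !ger0_norm ?expR_ge0// ler_piMr ?expR_ge0.
Qed.

(** Tonelli: integrating [exp (- s * t)] over [t >= D x] gives
  [exp (- s * D x) / s], whose mean is known. *)
Let laplace_q x s : 0 < x -> 0 < s ->
  pint (fun t => expR (- (s * t)) * q x t) = expR (- (x * s `^ al)) / s.
Proof.
move=> x0 s0; apply: EFin_inj; rewrite EFin_pint; last exact: Iq.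
pose A : set (R * T) := [set p | 0 < p.1 /\ D x p.2 <= p.1].
have mA : measurable (A : set (measurableTypeR R * T)).
  have m1 : measurable_fun setT (fun p : measurableTypeR R * T => p.1) by exact: measurable_fst.
  have m2 : measurable_fun setT (fun p : measurableTypeR R * T => D x p.2).
    by apply: measurableT_comp => //; exact: measurable_funP.
  rewrite (_ : A = [set p | 0 < p.1] `&` [set p | D x p.2 <= p.1])//.
  apply: measurableI; rewrite -[X in measurable X]setTI.
  - have := measurable_fun_ltr (@measurable_cst _ _ (measurableTypeR R * T)%type _ setT (0 : R)) m1.
    by move=> /(_ measurableT [set true]); apply.
  - by have := measurable_fun_ler m2 m1 => /(_ measurableT [set true]); apply.
pose f (p : measurableTypeR R * T) : \bar R := (expR (- (s * p.1)) * \1_A p)%:E.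
have mf_ : measurable_fun setT f.
  apply/measurable_EFinP; apply: measurable_funM; last exact: measurable_indic.
  by mf.
have f0 p : (0 <= f p)%E by rewrite lee_fin mulr_ge0 ?expR_ge0.
have := @fubini_tonelli _ _ (measurableTypeR R) T R lebesgue_measure P f mf_ f0.
have e1 : (\int[lebesgue_measure]_t \int[P]_w f (t, w))%E =
   (\int[lebesgue_measure]_(t in `]0%R, +oo[) (expR (- (s * t)) * q x t)%:E)%E.
  rewrite [RHS]integral_mkcond; apply: eq_integral => t _; rewrite patchE.
  rewrite in_posE.
  have [t0|t0] := ltP 0 t; last first.
    apply: integral0_eq => w _; rewrite /f/= indicE memNset ?mulr0//.
    by move=> [/=]; rewrite ltNge t0.
  have mB := measurable_subordinator_le x t.
  rewrite EFinM qE -[P _](_ : (\int[P]_w (\1_[set w | D x w <= t] w)%:E)%E = _); last first.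
    by rewrite integral_indic// setIT.
  rewrite -ge0_integralZl//.
  - apply: eq_integral => w _; rewrite /f/= EFinM; congr (_ * (_)%:E)%E.
    rewrite !indicE; congr (_%:R); congr nat_of_bool.
    by apply/idP/idP; rewrite !inE /A/= => // -[].
  - exact/measurable_EFinP/measurable_indic.
have e2 : (\int[P]_w \int[lebesgue_measure]_t f (t, w))%E =
   (\int[P]_w (s^-1 * expR (- s * D x w))%:E)%E.
  apply: ge0_ae_eq_integral => //.
  - exact: measurable_fun_fubini_tonelli_G.
  - apply/measurable_EFinP; apply: measurable_funM => //; apply: measurableT_comp => //.
    by apply: measurable_funM => //; exact: measurable_funP.
  - by move=> w _; exact: integral_ge0.
  - by move=> w _; rewrite lee_fin mulr_ge0 ?expR_ge0 ?invr_ge0 ?(ltW s0).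
  have := subordinator_ge0 (ltW x0); apply: filterS => w Dw _.
  have I : pintegrable (fun t => if D x w <= t then expR (- (s * t)) else 0).
    apply: pintegrable_le (pintegrable_expN s0) _.
      apply: measurable_fun_if => //; first exact: measurable_fun_ler.
      by mf.
    by move=> t _; case: ifP; rewrite ?normr0 ?expR_ge0// ger0_norm ?expR_ge0.
  rewrite mulNr mulrC -(pint_tail_expN s0 Dw) EFin_pint// [RHS]integral_mkcond.
  apply: eq_integral => t _; rewrite patchE /f /=.
  rewrite in_posE.
  have [t0|t0] := ltP 0 t; last first.
    by rewrite indicE memNset ?mulr0// => -[/=]; rewrite ltNge t0.
  case: ifPn => Dt; last by rewrite indicE memNset ?mulr0// => -[/= _]; rewrite (negbTE Dt).
  by rewrite indicE mem_set ?mulr1.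
rewrite e1 e2 => ->.
have [_ hL] := hD; have := hL x s (ltW x0) s0; rewrite unlock => hl.
under eq_integral do rewrite EFinM.
rewrite ge0_integralZl//.
- by rewrite hl -EFinM mulrC mulNr.
- apply/measurable_EFinP; apply: measurableT_comp => //.
  by apply: measurable_funM => //; exact: measurable_funP.
- by rewrite lee_fin invr_ge0 ltW.
Qed.

(** Both sides have the same Laplace transform in [t] and are continuous from
  the right. *)
Lemma subordinator_cdfE x t : 0 < x -> 0 < t ->
  P [set w | D x w <= t] = (subcdf al th x t)%:E.
Proof.
move=> x0 t0; rewrite -qE; congr (_%:E); apply/eqP; rewrite -subr_eq0; apply/eqP.
have I s : 0 < s -> pintegrable (fun t => expR (- (s * t)) * (q x t - subcdf al th x t)).
  move=> s0; have [h _] := laplace_subcdf angle x0 s0.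
  by apply: pintegrable_eq (pintegrableB (Iq x s0) h) => u _; rewrite mulrBr.
apply: (@laplace_eq0 _ (fun t => q x t - subcdf al th x t)) => //.
- by apply: pintegrable_eq (I 1 ltr01) => u _; rewrite mul1r.
- move=> m; have m0 : 0 < m.+1%:R :> R by [].
  have [h e] := laplace_subcdf angle x0 m0.
  under eq_pint do rewrite mulrBr.
  by rewrite pintB// ?laplace_q// ?e ?subrr//; exact: Iq.
- move=> a a0; apply: cvgB; first exact: rcq.
  by apply: cvg_at_right_filter; exact: cts_subcdf_time.
Qed.

Lemma subordinator_gtE x t : 0 < x -> 0 < t ->
  P [set w | t < D x w] = (1 - subcdf al th x t)%:E.
Proof.
move=> x0 t0; have m := measurable_subordinator_le x t.
rewrite EFinB -subordinator_cdfE// -probability_setC//.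
by congr (P _); apply/seteqP; split=> w /=; [rewrite ltNge => /negP|move=> /negP; rewrite -ltNge].
Qed.

Let mexpD x : measurable_fun setT (fun w => (expR (- D x w))%:E).
Proof.
by apply/measurable_EFinP; apply: measurableT_comp => //; apply: measurableT_comp => //; exact: measurable_funP.
Qed.

Let int_expD x : 0 < x -> (\int[P]_w (expR (- D x w))%:E)%E = (expR (- x))%:E.
Proof.
move=> x0; have [_ /(_ x 1 (ltW x0) ltr01)] := hD; rewrite unlock powR1 mulr1 => <-.
by apply: eq_integral => w _; rewrite mulN1r.
Qed.

Let mind x t : measurable_fun setT (fun w => (\1_[set w | D x w <= t] w)%:E : \bar R).
Proof.
by apply/measurable_EFinP; apply: measurable_indic; exact: measurable_subordinator_le.
Qed.

Let int_ind x t : 0 < x -> 0 < t ->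
  (\int[P]_w (\1_[set w | D x w <= t] w)%:E)%E = (subcdf al th x t)%:E.
Proof.
move=> x0 t0; have m := measurable_subordinator_le x t.
rewrite -(subordinator_cdfE x0 t0).
by rewrite integral_indic// setIT.
Qed.

(** Markov's inequality for [exp (- D x)]. *)
Lemma subcdf_le x t : 0 < x -> 0 < t -> subcdf al th x t <= expR (t - x).
Proof.
move=> x0 t0; rewrite -[subcdf _ _ _ _]mul1r -(expRxMexpNx_1 t) -mulrA expRD.
rewrite ler_wpM2l ?expR_ge0// -lee_fin EFinM -int_ind// -[leRHS]int_expD//.
rewrite -ge0_integralZl//.
apply: ge0_le_integral => //.
- by apply: measurable_funeM; exact: mind.
move=> w _; rewrite -EFinM lee_fin indicE; case: (boolP (_ \in _)) => [|_].
  by rewrite inE/= mulr1 ler_expR lerN2.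
by rewrite mulr0 expR_ge0.
Qed.

(** [1 - exp (- x)] is the mean of [1 - exp (- D x)], which is at least
  [1 - exp (- t)] when [D x > t]. *)
Lemma subcdf_ge x t : 0 < x -> 0 < t -> (1 - expR (- t)) * (1 - subcdf al th x t) <= x.
Proof.
move=> x0 t0; have et : expR (- t) <= 1 by rewrite -[leRHS]expR0 ler_expR oppr_le0 ltW.
suff h : expR (- x) <= expR (- t) + (1 - expR (- t)) * subcdf al th x t.
  by have := oneBexp_le x; lra.
rewrite -lee_fin EFinD EFinM -int_ind// -int_expD//.
rewrite -ge0_integralZl//; last by rewrite lee_fin subr_ge0.
rewrite -[(expR (- t))%:E](_ : (\int[P]_w (cst (expR (- t))%:E w) = _)%E); last first.
  by rewrite integral_cst// [X in (_ * X)%E]probability_setT mule1.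
rewrite -ge0_integralD//; last 3 first.
- by move=> w _; rewrite /= lee_fin expR_ge0.
- by move=> w _; rewrite mule_ge0 ?lee_fin ?subr_ge0.
- by apply: measurable_funeM; exact: mind.
apply: ae_ge0_le_integral => //.
- by move=> w _; rewrite adde_ge0 ?mule_ge0 ?lee_fin ?subr_ge0 ?expR_ge0.
- by apply: emeasurable_funD => //; apply: measurable_funeM; exact: mind.
have := subordinator_ge0 (ltW x0); apply: filterS => w Dw _.
rewrite /= -EFinM -EFinD lee_fin indicE; case: (boolP (_ \in _)) => [_|].
  by rewrite mulr1 addrC subrK -[leRHS]expR0 ler_expR oppr_le0.
rewrite notin_setE/= => /negP; rewrite -ltNge mulr0 addr0 ler_expR lerN2; exact: ltW.
Qed.

End subordinator_law.

Lemma ae_le_measure d (T : measurableType d) (R : realType) (P : probability T R)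
    (A B : set T) : measurable A -> measurable B ->
  {ae P, forall w, A w -> B w} -> (P A <= P B)%E.
Proof.
move=> mA mB [N [mN PN AB]]; rewrite -[leRHS]adde0 -PN.
apply: le_trans (measureU2 _ mB mN); apply: le_measure; rewrite ?inE//.
  exact: measurableU.
move=> w Aw; have [Bw|nB] := pselect (B w); [by left|right].
by apply: AB => /(_ Aw).
Qed.

Section inverse_law.
Context d (T : measurableType d) (R : realType) (P : probability T R).
Variables (al th : R) (E : R -> {RV P >-> \bar R}).
Hypothesis angle : contour_angle al th.
Hypothesis hE : inverse_stable_subordinator al E.
Implicit Types (x s t a : R).

Lemma measurable_inverse_le t a : measurable [set w | (E t w <= a%:E)%E].
Proof.
rewrite (_ : [set w | _] = E t @^-1` [set` `]-oo, a%:E]]); last first.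
  by apply/seteqP; split=> w /=; rewrite in_itv.
rewrite -[X in measurable X]setTI; apply: (measurable_funP (E t)) => //.
exact: emeasurable_itv.
Qed.

(** [t < D a] implies [E t <= a], which implies [t < D b] almost surely for every
  [b > a] by monotonicity; the gap closes since the law of [D a] at [t] is
  continuous in [a]. *)
Lemma inverse_cdfE t a : 0 < t -> 0 < a ->
  P [set w | (E t w <= a%:E)%E] = (1 - subcdf al th a t)%:E.
Proof.
move=> t0 a0; have [D [hD ED]] := hE; have [[_ mono] _] := hD.
have mE := measurable_inverse_le t a.
have mD b : measurable [set w | t < D b w].
  rewrite (_ : [set w | _] = ~` [set w | D b w <= t]).
    by apply: measurableC; exact: measurable_subordinator_le.
  by apply/seteqP; split=> w /=; [rewrite ltNge => /negP|move=> /negP; rewrite -ltNge].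
apply/eqP; rewrite eq_le; apply/andP; split; last first.
  rewrite -(subordinator_gtE angle hD a0 t0); apply: le_measure; rewrite ?inE//.
  move=> w /= Da; rewrite ED ?(ltW t0)//; apply: ereal_inf_lbound.
  by exists a.
have pE : (fine (P [set w | (E t w <= a%:E)%E]))%:E = P [set w | (E t w <= a%:E)%E].
  by rewrite fineK// fin_num_measure.
rewrite -pE lee_fin; set p := fine _ in pE *.
have pb b : a < b -> p <= 1 - subcdf al th b t.
  move=> ab; rewrite -lee_fin pE -(subordinator_gtE angle hD (lt_trans a0 ab) t0).
  apply: ae_le_measure => //.
  apply: filterS mono => w mono; rewrite /= ED ?(ltW t0)// => Ea.
  have abE : (a%:E < b%:E)%E by rewrite lte_fin.
  have [_ [v [v0 tv] <-]] := ereal_inf_lt (le_lt_trans Ea abE).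
  by rewrite lte_fin => vb; apply: lt_le_trans tv (mono _ _ _ _); exact: ltW.
have c : 1 - subcdf al th b t @[b --> a^'+] --> 1 - subcdf al th a t.
  apply: cvgB; first exact: cvg_cst.
  apply: cvg_at_right_filter; exact: dv_cts (dv_subcdf angle t0 a0).
apply: (cvgr_to_ge c); near=> b; apply: pb; near: b; exact: nbhs_right_gt.
Unshelve. all: by end_near. Qed.
End inverse_law.

(** * Probability laws with a density *)

Section density_law.
Context {R : realType}.
Local Notation lam := (@lebesgue_measure R).
Local Notation RR := (measurableTypeR R).
Variable f : R -> R.
Hypothesis mf_ : measurable_fun setT f.
Hypothesis f_ge0 : forall x, 0 <= f x.

Let undergraph : set (RR * RR) := [set p | 0 < p.2 < f p.1].

Let measurable_undergraph : measurable undergraph.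
Proof.
have m1 : measurable_fun setT (fun p : RR * RR => p.2 : R) by exact: measurable_snd.
have m2 : measurable_fun setT (fun p : RR * RR => f p.1).
  by apply: measurableT_comp => //; exact: measurable_fst.
rewrite (_ : undergraph = [set p | 0 < p.2] `&` [set p | p.2 < f p.1]); last first.
  by apply/seteqP; split=> p /=; rewrite /undergraph/=; [move=> /andP|move=> [-> ->]].
apply: measurableI; rewrite -[X in measurable X]setTI.
- have := measurable_fun_ltr (@measurable_cst _ _ (RR * RR)%type _ setT (0 : R)) m1.
  by move=> /(_ measurableT [set true]); apply.
- by have := measurable_fun_ltr m1 m2 => /(_ measurableT [set true]); apply.
Qed.

Let emb (p : RR * RR) : \bar R := p.1%:E.

Let measurable_emb : measurable_fun setT emb.
Proof. by apply/measurable_EFinP; exact: measurable_fst. Qed.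

Let area := mrestr (lam \x lam)%E measurable_undergraph.

Let area_integral (phi : RR * RR -> \bar R) : measurable_fun setT phi ->
  (forall p, 0 <= phi p)%E ->
  (\int[area]_p phi p = \int[lam \x lam]_(p in undergraph) phi p)%E.
Proof.
move=> mphi phi0.
have mC : measurable (~` undergraph) by apply: measurableC; exact: measurable_undergraph.
have N0 : area (~` undergraph) = 0%E by rewrite /area /mrestr setICl measure0.
rewrite (ge0_negligible_integral mC measurableT mphi (fun p _ => phi0 p) N0).
rewrite setTD setCK; apply: eq_measure_integral => A mA Au.
have e : A `&` undergraph = A by exact: setIidl.
exact: (congr1 (lam \x lam)%E e).
Qed.

(** The law with density [f] is the image, under the first projection, of the
  area measure under the graph of [f]. *)
Let lawf := pushforward area emb.

Let lawf_integral (phi : \bar R -> \bar R) : measurable_fun setT phi ->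
  (forall u, 0 <= phi u)%E ->
  (\int[lawf]_u phi u = \int[lam]_x (phi x%:E * (f x)%:E))%E.
Proof.
move=> mphi phi0.
rewrite (@ge0_integral_pushforward _ _ _ _ _ _ measurable_emb area setT phi)//.
rewrite preimage_setT area_integral; [|exact: measurableT_comp mphi measurable_emb|by move=> p; exact: phi0].
rewrite integral_mkcond fubini_tonelli1//.
- apply: eq_integral => x _; rewrite /fubini_F.
  transitivity (\int[lam]_y (phi x%:E * (\1_([set` `]0, f x[]) y)%:E))%E.
    apply: eq_integral => y _; rewrite patchE indicE.
    have -> : ((x, y) \in undergraph) = (y \in [set` `]0, f x[]).
      by apply/idP/idP => /set_mem h; apply/mem_set; move: h; rewrite /undergraph /= in_itv.
    by case: ifP => _; rewrite ?mule1 ?mule0.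
  rewrite ge0_integralZl//; last first.
  + by apply/measurable_EFinP; apply: measurable_indic; exact: measurable_itv.
  have mI : measurable ([set` `]0, f x[] : set RR) by exact: measurable_itv.
  rewrite (@integral_indic _ RR R lam setT measurableT _ mI).
  rewrite setIT; congr (_ * _)%E.
  have := @lebesgue_measure_itv R `]0, f x[; rewrite /= lte_fin.
  case: ltP => [_ ->|fx ->]; first by rewrite oppr0 adde0.
  by congr EFin; apply/le_anti; rewrite fx f_ge0.
- apply/(measurable_restrict _ _ _).1 => //; apply: measurable_funTS; exact: measurableT_comp.
- by move=> p; rewrite patchE; case: ifP => _; [exact: phi0|exact: lexx].
Qed.

(** [Q] and [lawf] agree on the upper half-lines, which are stable under
  intersection and generate the Borel sets of the extended line. *)
Lemma integral_law_density (Q : probability (\bar R) R) (phi : \bar R -> \bar R) :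
  (\int[lam]_x (f x)%:E = 1)%E ->
  (forall r, Q [set` `]r%:E, +oo[] = \int[lam]_(x in `]r, +oo[) (f x)%:E)%E ->
  measurable_fun setT phi -> (forall u, 0 <= phi u)%E ->
  (\int[Q]_u phi u = \int[lam]_x (phi x%:E * (f x)%:E))%E.
Proof.
move=> f1 tails mphi phi0; rewrite -lawf_integral//.
have lawE A : measurable A -> lawf A = (\int[lam]_(x in EFin @^-1` A) (f x)%:E)%E.
  move=> mA; transitivity (\int[lawf]_u (\1_A u)%:E)%E.
    by rewrite integral_indic// setIT.
  rewrite lawf_integral; [|by apply/measurable_EFinP; exact: measurable_indic|].
    2: by move=> u; rewrite lee_fin.
  rewrite [RHS]integral_mkcond; apply: eq_integral => x _; rewrite patchE indicE.
  have -> : (x%:E \in A) = (x \in EFin @^-1` A) by apply/idP/idP; rewrite !inE.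
  by case: ifP => _; rewrite ?mul1e ?mul0e.
apply: eq_measure_integral => A mA _.
pose G : set (set (\bar R)) := [set A | A = setT \/ exists r, A = [set` `]r%:E, +oo[]].
apply: (@measure_unique _ _ _ G (fun=> setT)) => //.
- transitivity (@ErealGenOInfty.G R).-sigma.-measurable; first exact: ErealGenOInfty.measurableE.
  apply/seteqP; split; first by apply: sub_sigma_algebra2 => B hB; right.
  apply: smallest_sub; first exact: smallest_sigma_algebra.
  move=> B [->|hB]; last exact: sub_sigma_algebra.
  exact: (@measurableT _ (g_sigma_algebraType (@ErealGenOInfty.G R))).
- move=> B C [->|[r ->]] [->|[s ->]]; rewrite ?setIT ?setTI.
  + by left.
  + by right; exists s.
  + by right; exists r.
  + right; exists (Num.max r s); apply/seteqP; split=> x /=; rewrite !in_itv/= !andbT.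
      by move=> [rx sx]; rewrite EFin_max gt_max rx.
    by rewrite EFin_max gt_max => /andP.
- by move=> n; left.
- by apply/seteqP; split=> // x _; exists 0%N.
- move=> B [->|[r ->]].
    by rewrite -[RHS]/(lawf setT) lawE// preimage_setT f1; exact: probability_setT.
  rewrite -[RHS]/(lawf _) lawE; last exact: emeasurable_itv.
  transitivity (\int[lam]_(x in `]r, +oo[) (f x)%:E)%E; first exact: tails.
  congr (integral _ _ _); by apply/seteqP; split=> x /=; rewrite !in_itv/= lte_fin.
- by move=> n; rewrite (le_lt_trans (probability_le1 _ _)) ?ltry.
Qed.

End density_law.

(** The perturbation [e * y] makes the function strictly increasing. *)
Lemma nondecreasing_derive_ge0 (R : realType) (F : R -> R) (a x m : R) : a < x ->
  (forall y, a < y -> derivable F y 1) -> is_derive x (1 : R) F m ->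
  (forall y z, a < y -> y <= z -> F y <= F z) -> 0 <= m.
Proof.
move=> ax dF Fx ndF; apply/ler_addgt0Pr => e e0; rewrite -[leRHS]addrC.
have dG y : a < y -> derivable (fun y => F y + e * y) y (1 : R).
  by move=> ay; apply: derivableD; [exact: dF|exact: derivableM].
have dGx : is_derive x (1 : R) (fun y => F y + e * y) (m + e).
  have dl : is_derive x (1 : R) (fun y => e * y) e.
    by eapply dv_eq; [dv|rewrite mul0r add0r mulr1].
  exact: (dvD Fx dl).
have := @incr_derive1_ge0_itvy R (fun y => F y + e * y) false a x.
rewrite (dv_derive1 dGx) addrC; apply.
- by move=> y; rewrite inE/= in_itv/= andbT; exact: dG.
- move=> y z; rewrite !in_itv/= !andbT => ay az yz.
  by rewrite ler_ltD ?ltr_pM2l// ndF// ltW.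
- by rewrite in_itv/= ax.
Qed.

Section inverse_density.
Context d (T : measurableType d) (R : realType) (P : probability T R).
Variables (al th t : R) (E : R -> {RV P >-> \bar R}).
Hypothesis angle : contour_angle al th.
Hypothesis hE : inverse_stable_subordinator al E.
Hypothesis t0 : 0 < t.
Implicit Types (x s a : R).
Local Notation phi := (al * (th + pi)).

(** Minus the [x]-derivative of [subcdf], extended by [0] so that it can serve as
  a density on the whole line. *)
Definition invpdf x : R := if 0 < x then pi^-1 * pint (ker al th t al x phi) else 0.

Let F x : R := - subcdf al th x t.

Let dF x : 0 < x -> is_derive x (1 : R) F (invpdf x).
Proof.
move=> x0; have h := dv_subcdf angle t0 x0; rewrite /F /invpdf x0.
by eapply dv_eq; [eapply dvN; exact: h|rewrite opprK].
Qed.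

Let F_bounds x : 0 < x -> -1 <= F x <= 0.
Proof.
move=> x0; have h : 0 <= 1 - subcdf al th x t <= 1.
  by rewrite -!lee_fin -(inverse_cdfE angle hE t0 x0) measure_ge0 probability_le1//;
    exact: measurable_inverse_le.
by rewrite /F; case/andP: h => *; apply/andP; split; lra.
Qed.

Let F_nd x y : 0 < x -> x <= y -> F x <= F y.
Proof.
move=> x0 xy; rewrite /F -(lerD2l 1) -lee_fin.
rewrite -(inverse_cdfE angle hE t0 x0) -(inverse_cdfE angle hE t0 (lt_le_trans x0 xy)).
apply: le_measure; rewrite ?inE//; try exact: measurable_inverse_le.
by move=> w /= /le_trans; apply; rewrite lee_fin.
Qed.

Lemma invpdf_ge0 x : 0 <= invpdf x.
Proof.
have [x0|x0] := ltP 0 x; last by rewrite /invpdf ltNge x0.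
apply: (nondecreasing_derive_ge0 x0 _ (dF x0) F_nd).
by move=> y y0; exact: dv_derivable (dF y0).
Qed.

Lemma cts_invpdf x : 0 < x -> {for x, continuous (fun x => pi^-1 * pint (ker al th t al x phi))}.
Proof.
move=> x0; have h := dv_pint_ker angle phi t0 (al_gt0 angle) x0.
by eapply dv_cts; eapply dvM; [dv|exact: h].
Qed.

Lemma cts_invpdf_at x : 0 < x -> {for x, continuous invpdf}.
Proof.
move=> x0; have c := cts_invpdf x0.
rewrite /prop_for /continuous_at (_ : invpdf x = pi^-1 * pint (ker al th t al x phi)); last first.
  by rewrite /invpdf x0.
apply: cvg_trans c; apply: near_eq_cvg; near=> y.
by rewrite /invpdf ifT//; near: y; exact: lt_nbhsr.
Unshelve. all: by end_near. Qed.

Lemma pmeas_invpdf : pmeas invpdf.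
Proof.
apply: (@pmeas_eq _ (fun x => pi^-1 * pint (ker al th t al x phi))).
  by move=> x x0; rewrite /invpdf x0.
by apply: pmeas_cts; exact: cts_invpdf.
Qed.

Lemma measurable_invpdf : measurable_fun setT invpdf.
Proof.
have mD : measurable ([set` `](0 : R), +oo[] : set (measurableTypeR R)) by exact: measurable_itv.
have -> : invpdf = invpdf \_ [set` `](0 : R), +oo[].
  apply/funext => x; rewrite patchE; case: ifPn => // /negP h.
  rewrite /invpdf; case: ifP => // x0; exfalso; apply: h.
  by rewrite inE /= in_itv/= x0.
by apply/(measurable_restrictT _ mD); exact: pmeas_invpdf.
Qed.

Let cvgF0 : F x @[x --> 0^'+] --> (-1 : R).
Proof.
have c : 0 < 1 - expR (- t) by rewrite subr_gt0 -[ltRHS]expR0 ltr_expR oppr_lt0.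
have h : 1 + F x @[x --> 0^'+] --> (0 : R).
  apply: (@cvg_at0_le _ _ ((1 - expR (- t))^-1) 1) => // x x0 _.
  have /andP[h1 h2] := F_bounds x0.
  rewrite powRr1 ?(ltW x0)// ger0_norm; last by lra.
  by rewrite mulrC ler_pdivlMr// mulrC; have [D [hD _]] := hE; exact: (subcdf_ge angle hD x0 t0).
have e : F = (fun x => (1 + F x) - 1) by apply/funext => x; ring.
rewrite e -[Z in _ --> Z](sub0r 1); apply: cvgB h _; exact: cvg_cst.
Qed.

Let cvgFy : F x @[x --> +oo%R] --> (0 : R).
Proof.
have [C C0 hC] := expR_pow_bound (@ltr01 R) (@ler01 R).
apply: (@cvg_aty_le _ _ (expR t * C) 1) => // x x1; have x0 : 0 < x by exact: lt_le_trans x1.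
have /andP[h1 h2] := F_bounds x0.
rewrite ler0_norm// /F opprK -mulrA; have [D [hD _]] := hE.
apply: le_trans (subcdf_le angle hD x0 t0) _.
by rewrite expRD ler_wpM2l ?expR_ge0//; have := hC x x0; rewrite mul1r.
Qed.

Let tail_integral r : 0 < r ->
  (\int[lebesgue_measure]_(x in `]r, +oo[) (invpdf x)%:E = (subcdf al th r t)%:E)%E.
Proof.
move=> r0; rewrite integral_itv_obnd_cbnd; last first.
  by apply/measurable_EFinP; apply: measurable_funS measurable_invpdf.
transitivity (0%:E - (F r)%:E)%E; last by rewrite sub0e /F -EFinN opprK.
apply: ge0_continuous_FTC2y.
- by move=> x _; exact: invpdf_ge0.
- apply: continuous_in_subspaceT => x; rewrite inE/= in_itv/= andbT => rx.
  by apply: cts_invpdf_at; exact: lt_le_trans rx.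
- exact: cvgFy.
- by move=> x rx; apply: dv_derivable (dF _); exact: lt_trans rx.
- by apply: cvg_at_right_filter; exact: dv_cts (dF r0).
- by move=> x; rewrite in_itv/= andbT => rx; rewrite (dv_derive1 (dF (lt_trans r0 rx))).
Qed.

Let pintegrable_invpdf : pintegrable invpdf.
Proof.
apply: (@pintegrable_ftc R F invpdf 1).
- by move=> x x0; exact: dF.
- exact: cts_invpdf_at.
- by move=> x _; exact: invpdf_ge0.
- by move=> x x0; have := F_bounds x0; rewrite ler_norml => /andP[-> ?]; lra.
Qed.

Let pint_invpdf : pint invpdf = 1.
Proof.
have dF' x (x0 : 0 < x) := dF x0.
have e := @pint_ftc R F invpdf (-1) 0 dF' cts_invpdf_at pintegrable_invpdf cvgF0 cvgFy.
by rewrite e sub0r opprK.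
Qed.

Let positive_part (D : set R) (phi : \bar R -> \bar R) : (forall x, 0 < x -> D x) ->
  (\int[lebesgue_measure]_(x in D) (phi x%:E * (invpdf x)%:E) =
   \int[lebesgue_measure]_(x in `]0%R, +oo[) (phi x%:E * (invpdf x)%:E))%E.
Proof.
move=> hD; rewrite integral_mkcond [RHS]integral_mkcond; apply: eq_integral => x _.
rewrite !patchE; rewrite in_posE.
have [x0|x0] := ltP 0 x; first by rewrite mem_set//; exact: hD.
by rewrite /invpdf ltNge x0 /= mule0; case: ifP.
Qed.

Let mass (D : set R) : (forall x, 0 < x -> D x) ->
  (\int[lebesgue_measure]_(x in D) (invpdf x)%:E = 1)%E.
Proof.
move=> hD; have := positive_part (fun=> 1%E) hD.
under eq_integral do rewrite mul1e.
under [X in _ = X -> _]eq_integral do rewrite mul1e.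
by move=> ->; rewrite -(EFin_pint pintegrable_invpdf) pint_invpdf.
Qed.

Let tails r : P [set w | (r%:E < E t w)%E] = (\int[lebesgue_measure]_(x in `]r, +oo[) (invpdf x)%:E)%E.
Proof.
have m := measurable_inverse_le E t r.
have -> : [set w | (r%:E < E t w)%E] = ~` [set w | (E t w <= r%:E)%E].
  by apply/seteqP; split=> w /=; [rewrite ltNge => /negP|move=> /negP; rewrite -ltNge].
rewrite probability_setC//; have [r0|r0] := ltP 0 r.
  by rewrite tail_integral// (inverse_cdfE angle hE t0 r0) -EFinB opprB addrC subrK.
rewrite mass; last by move=> x x0; rewrite /= in_itv/= andbT; exact: le_lt_trans x0.
suff -> : P [set w | (E t w <= r%:E)%E] = 0%E by rewrite sube0.
have pE : (fine (P [set w | (E t w <= r%:E)%E]))%:E = P [set w | (E t w <= r%:E)%E].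
  by rewrite fineK// fin_num_measure.
rewrite -pE; congr EFin; set p := fine _ in pE *; apply/le_anti/andP; split; last first.
  by rewrite -lee_fin pE.
have h : 1 + F x @[x --> 0^'+] --> (1 - 1 : R) by apply: cvgD cvgF0; exact: cvg_cst.
rewrite subrr in h; apply: (cvgr_to_ge h); near=> x.
have x0 : 0 < x by near: x; exact: nbhs_right_gt.
rewrite -lee_fin pE /F -(inverse_cdfE angle hE t0 x0).
apply: le_measure; rewrite ?inE//; first exact: measurable_inverse_le.
by move=> w /= /le_trans; apply; rewrite lee_fin (le_trans r0)// ltW.
Unshelve. all: by end_near. Qed.

(** The total mass is [1] because the distribution function runs from [0] to [1]
  by [subcdf_ge] and [subcdf_le]: no mass escapes to [0] or to infinity. *)
Lemma integral_inverse (phi : \bar R -> \bar R) :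
  measurable_fun setT phi -> (forall u, 0 <= phi u)%E ->
  (\int[distribution P (E t)]_u phi u =
   \int[lebesgue_measure]_(x in `]0%R, +oo[) (phi x%:E * (invpdf x)%:E))%E.
Proof.
move=> mphi phi0; rewrite -(@positive_part setT)//.
apply: integral_law_density => //.
- exact: measurable_invpdf.
- exact: invpdf_ge0.
- exact: mass.
move=> r; rewrite -tails /distribution /pushforward; congr (P _).
by apply/seteqP; split=> w /=; rewrite in_itv/= andbT.
Qed.

End inverse_density.

(** * The law of a product of independent variables with densities *)

Section product_law.
Context d (T : measurableType d) (R : realType) (P : probability T R).
Variables (al1 al2 th1 th2 t : R) (E1 E2 : R -> {RV P >-> \bar R}).
Hypothesis angle1 : contour_angle al1 th1.
Hypothesis angle2 : contour_angle al2 th2.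
Hypothesis hE1 : inverse_stable_subordinator al1 E1.
Hypothesis hE2 : inverse_stable_subordinator al2 E2.
Hypothesis indep : independent_processes E1 E2.
Hypothesis t0 : 0 < t.
Local Notation f1 := (invpdf al1 th1 t).
Local Notation f2 := (invpdf al2 th2 t).
Local Notation lam := (@lebesgue_measure R).
Local Notation RR := (measurableTypeR R).

Definition mulconv (z : R) : R :=
  if 0 < z then pint (fun x => f1 x * f2 (z / x) / x) else 0.

Hypothesis integrable_conv : forall z, 0 < z -> pintegrable (fun x => f1 x * f2 (z / x) / x).

Let f1_ge0 := invpdf_ge0 angle1 hE1 t0.
Let f2_ge0 := invpdf_ge0 angle2 hE2 t0.
Let mf1 := measurable_invpdf angle1 t0.
Let mf2 := measurable_invpdf angle2 t0.

Let K (p : RR * RR) : R := f1 p.1 * f2 (p.2 / p.1) / p.1.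

Let f1_npos x : x <= 0 -> f1 x = 0.
Proof. by move=> x0; rewrite /invpdf ltNge x0. Qed.
Let f2_npos x : x <= 0 -> f2 x = 0.
Proof. by move=> x0; rewrite /invpdf ltNge x0. Qed.

Let K_ge0 p : 0 <= K p.
Proof.
rewrite /K; have [x0|x0] := ltP 0 p.1; last by rewrite f1_npos// !mul0r.
by rewrite divr_ge0 ?mulr_ge0 ?f1_ge0 ?f2_ge0// ltW.
Qed.

Let measurable_K : measurable_fun setT K.
Proof.
have m1 : measurable_fun setT (fun p : RR * RR => p.1 : R) by exact: measurable_fst.
have m2 : measurable_fun setT (fun p : RR * RR => p.2 : R) by exact: measurable_snd.
apply: measurable_funM; last by mf.
apply: measurable_funM; first exact: measurableT_comp mf1 m1.
apply: (measurableT_comp mf2); mf.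
Qed.

Let K_conv z : (\int[lam]_x (K (x, z))%:E = (mulconv z)%:E)%E.
Proof.
rewrite /mulconv; have [z0|z0] := ltP 0 z.
  rewrite EFin_pint; last exact: integrable_conv.
  rewrite [RHS]integral_mkcond; apply: eq_integral => x _; rewrite patchE.
  rewrite in_posE.
  by case: ifP => // /negbT; rewrite -leNgt => x0; rewrite /K /= f1_npos// !mul0r.
apply: integral0_eq => x _; rewrite /K /=; congr EFin.
have [x0|x0] := ltP 0 x; last by rewrite f1_npos// !mul0r.
by rewrite f2_npos ?mulr0 ?mul0r// pmulr_lle0 ?invr_gt0.
Qed.

Lemma mulconv_ge0 z : 0 <= mulconv z.
Proof. by rewrite -lee_fin -K_conv; apply: integral_ge0 => x _; rewrite lee_fin. Qed.

Lemma measurable_mulconv : measurable_fun setT mulconv.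
Proof.
apply/measurable_EFinP.
have -> : EFin \o mulconv = (fun z => \int[lam]_x (K (x, z))%:E)%E.
  by apply/funext => z /=; rewrite K_conv.
have mK : measurable_fun setT (EFin \o K) by exact/measurable_EFinP.
have K0 p : (0 <= (EFin \o K) p)%E by rewrite lee_fin.
exact: (@measurable_fun_fubini_tonelli_G _ _ RR RR R lam (EFin \o K) mK K0).
Qed.

Let joint_law (A B : set (\bar R)) : measurable A -> measurable B ->
  P ((fun w => (E1 t w, E2 t w)) @^-1` (A `*` B)) =
  (distribution P (E1 t) A * distribution P (E2 t) B)%E.
Proof.
move=> mA mB; rewrite -[LHS]/(P ((E1 t @^-1` A) `&` (E2 t @^-1` B))).
apply: indep; apply: sub_sigma_algebra; exists t; rewrite /= ?(ltW t0)//.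
- by exists A => //; rewrite setTI.
- by exists B => //; rewrite setTI.
Qed.

Let mpair : measurable_fun setT (fun w => (E1 t w, E2 t w)).
Proof. by apply: measurable_fun_pair; exact: measurable_funP. Qed.

Let scaled (x : R) (B : set R) : 0 < x -> measurable B ->
  (\int[lam]_(y in `]0%R, +oo[) ((\1_B (x * y))%:E * (f2 y)%:E) =
   x^-1%:E * \int[lam]_(z in `]0%R, +oo[) ((\1_B z)%:E * (f2 (z / x))%:E))%E.
Proof.
move=> x0 mB; have k0 : 0 < x^-1 by rewrite invr_gt0.
pose g y : \bar R := ((\1_B (x * y))%:E * (f2 y)%:E)%E.
have mg : measurable_fun [set` `](0 : R), +oo[] g.
  apply: measurable_funTS; apply: emeasurable_funM; last exact/measurable_EFinP.
  apply/measurable_EFinP; apply: (measurableT_comp (measurable_indic mB)).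
  by mf.
have g0 y : [set` `](0 : R), +oo[] y -> (0 <= g y)%E.
  by move=> _; rewrite /g mule_ge0 ?lee_fin.
have := ge0_integral_scale k0 (measurable_itv _) mg g0.
rewrite invrK (_ : _ @^-1` _ = [set` `](0 : R), +oo[]); last first.
  by apply/seteqP; split=> z /=; rewrite !in_itv/= !andbT pmulr_rgt0.
move=> h.
have -> : (\int[lam]_(z in `]0%R, +oo[) ((\1_B z)%:E * (f2 (z / x))%:E) =
   \int[lam]_(z in `]0%R, +oo[) g (x^-1 * z)%R)%E.
  by apply: eq_integral => z _; rewrite /g mulrA divff ?gt_eqF// mul1r [z / x]mulrC.
by rewrite h muleA -EFinM mulVf ?gt_eqF// mul1e.
Qed.

(** The joint law is a product measure; on the section at [x] of the event, the
  second density is rescaled by [x], and Tonelli exchanges the integrals. *)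
Lemma product_law (B : set (\bar R)) : measurable B ->
  P [set w | B (E1 t w * E2 t w)%E] = (\int[lam]_(z in EFin @^-1` B) (mulconv z)%:E)%E.
Proof.
move=> mB; pose C : set (\bar R * \bar R) := [set p | B (p.1 * p.2)%E].
have mC : measurable C.
  rewrite -[X in measurable X]setTI.
  have mm : measurable_fun setT (fun p : \bar R * \bar R => (p.1 * p.2)%E).
    by apply: emeasurable_funM; [exact: measurable_fst|exact: measurable_snd].
  exact: mm.
pose joint := pushforward P (fun w => (E1 t w, E2 t w)).
have e1 : P [set w | B (E1 t w * E2 t w)%E] =
    (distribution P (E1 t) \x distribution P (E2 t))%E C.
  rewrite -[LHS]/(joint C); apply/esym.
  apply: (@product_measure_unique _ _ _ _ _ (distribution P (E1 t)) (distribution P (E2 t)) joint).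
  - by move=> A1 A2 mA1 mA2; exact: joint_law.
  - exact: mC.
pose B' : set R := EFin @^-1` B.
have mB' : measurable B'.
  have mE : measurable_fun setT (EFin : R -> \bar R) by apply/measurable_EFinP; exact: measurable_id.
  by rewrite -[X in measurable X]setTI; exact: mE.
rewrite e1 /product_measure1 (integral_inverse angle1 hE1 t0)//=; last first.
  by apply: measurable_fun_xsection.
have e2 x : 0 < x -> distribution P (E2 t) (xsection C x%:E) =
   (x^-1%:E * \int[lam]_(z in `]0%R, +oo[) ((\1_B' z)%:E * (f2 (z / x))%:E))%E.
  move=> x0; have mx : measurable (xsection C x%:E) by exact: measurable_xsection.
  rewrite -scaled// -[LHS](_ : (\int[distribution P (E2 t)]_u (\1_(xsection C x%:E) u)%:E)%E = _); last first.
    by rewrite integral_indic// setIT.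
  rewrite (integral_inverse angle2 hE2 t0)//; last by apply/measurable_EFinP; exact: measurable_indic.
  apply: eq_integral => y _; rewrite !indicE; congr (_%:R%:E * _)%E; congr nat_of_bool.
  apply/idP/idP => /set_mem h; apply/mem_set; move: h.
    by rewrite /xsection/= inE.
  by move=> h; rewrite /xsection/= inE.
pose G (p : RR * RR) : \bar R := ((\1_B' p.2)%:E * (K p)%:E)%E.
have mG : measurable_fun setT G.
  apply: emeasurable_funM; last exact/measurable_EFinP.
  by apply/measurable_EFinP; apply: (measurableT_comp (measurable_indic mB')); exact: measurable_snd.
have G0 p : (0 <= G p)%E by rewrite /G mule_ge0 ?lee_fin.
transitivity (\int[lam]_x \int[lam]_z G (x, z))%E.
  rewrite integral_mkcond; apply: eq_integral => x _; rewrite patchE.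
  rewrite in_posE.
  have [x0|x0] := ltP 0 x; last first.
    by apply/esym/integral0_eq => z _; rewrite /G /K /= f1_npos// !mul0r mule0.
  rewrite e2// muleC muleA -EFinM.
  have c0 : 0 <= f1 x * x^-1 by rewrite mulr_ge0 ?f1_ge0// invr_ge0 ltW.
  have mg : measurable_fun [set` `](0 : R), +oo[] (fun z => (\1_B' z)%:E * (f2 (z / x))%:E)%E.
    apply: measurable_funTS; apply: emeasurable_funM.
      by apply/measurable_EFinP; exact: measurable_indic.
    by apply/measurable_EFinP; apply: (measurableT_comp mf2); mf.
  rewrite -ge0_integralZl//; last by move=> z _; rewrite mule_ge0 ?lee_fin.
  rewrite integral_mkcond; apply: eq_integral => z _; rewrite patchE.
  rewrite in_posE.
  rewrite /G /K /=; have [z0|z0] := ltP 0 z.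
    by rewrite -!EFinM; congr EFin; ring.
  by rewrite f2_npos ?mulr0 ?mul0r ?mule0// pmulr_lle0 ?invr_gt0.
rewrite (@fubini_tonelli _ _ RR RR R lam lam G mG G0).
rewrite [RHS]integral_mkcond; apply: eq_integral => z _; rewrite patchE /G /=.
rewrite ge0_integralZl//.
- rewrite K_conv indicE; have -> : (z \in B') = (z \in EFin @^-1` B) by [].
  by case: ifP => _; rewrite ?mul1e ?mul0e.
- apply/measurable_EFinP; apply: (measurableT_comp measurable_K).
  exact: pair2_measurable.
- by move=> x _; rewrite lee_fin.
Qed.

End product_law.

(** * Change of variables on the half-line *)

Section exponential_substitution.
Context {R : realType}.
Implicit Types (f F : R -> R) (x y u : R).
Local Notation mu := (@lebesgue_measure R).

Lemma pint_truncation f (u : nat -> R) (b : bool) : pintegrable f ->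
  (forall x, 0 < x -> \forall n \near \oo, (x <= u n) = b) ->
  pint (fun y => if y <= u n then f y else 0) @[n --> \oo] --> (if b then pint f else 0).
Proof.
move=> If ub; have mf_ := pintegrable_meas If.
have m n : pmeas (fun y => if y <= u n then f y else 0).
  apply: measurable_fun_if => //; first exact: measurable_fun_ler.
  by apply: (@measurable_funS _ _ _ _ [set` `](0 : R), +oo[]).
have -> : (if b then pint f else 0) = pint (fun y => if b then f y else 0).
  by case: b {ub} => //; rewrite pint0.
have [||_ //] := @pint_dct R (fun n y => if y <= u n then f y else 0)
  (fun y => if b then f y else 0) _ m (pintegrable_norm If).
- by move=> n y y0; case: ifP => _; rewrite ?normr0.
- move=> y y0; apply: cvg_near_cst; apply: filterS (ub y y0) => n ->.
  by case: b {ub}.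
Qed.

(** [F x] is the integral over ]0, x], written as an integral over the half-line
  so that both limits are instances of dominated convergence. *)
Lemma pint_antiderivative f : pintegrable f -> (forall x, 0 < x -> {for x, continuous f}) ->
  exists F : R -> R, [/\ forall x, 0 < x -> is_derive x (1 : R) F (f x),
    F x @[x --> 0^'+] --> (0 : R), F x @[x --> +oo%R] --> pint f &
    forall x, `|F x| <= pint (fun y => `|f y|)].
Proof.
move=> If cf; have mf_ := pintegrable_meas If.
pose F x := pint (fun y => if y <= x then f y else 0).
have E x : F x = \int[mu]_(y in [set` Interval (BRight 0) (BRight x)]) f y.
  rewrite /F /pint /Rintegral; congr fine.
  rewrite integral_mkcond [RHS]integral_mkcond; apply: eq_integral => y _.
  rewrite !patchE.
  rewrite in_posE.
  have -> : (y \in [set` `](0 : R), x]]) = (0 < y) && (y <= x).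
    by apply/idP/idP; rewrite inE/= in_itv/=.
  by case: ltP => //= _; case: ifP.
exists F; split.
- move=> x x0; have sub : [set` Interval (BRight (0 : R)) (BRight (x + 1))] `<=` [set` `](0 : R), +oo[].
    by move=> y /=; rewrite !in_itv/= => /andP[->].
  have I : mu.-integrable [set` Interval (BRight (0 : R)) (BRight (x + 1))] (EFin \o f).
    by apply: integrableS If => //; exact: measurable_itv.
  have x1 : x < x + 1 by rewrite ltrDl.
  have hb : (BRight (0 : R) < BRight x)%O by rewrite bnd_simp.
  have [] := @continuous_FTC1 R f (BRight 0) x (x + 1) x1 I hb (cf x x0).
  have -> : (fun x0 : R => \int[mu]_(t in [set` Interval (BRight 0) (BRight x0)]) f t) = F.
    by apply/funext => z; rewrite E.
  by move=> d1 d2; split => //; rewrite -derive1E.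
- apply/cvg_at_rightP => u [u0 uc].
  apply: (@pint_truncation f u false If) => x x0.
  near=> n; apply/negbTE; rewrite -ltNge; near: n; exact: cvgr_lt uc _ x0.
- apply/cvg_pinftyP => u uc.
  apply: (@pint_truncation f u true If) => x x0.
  near=> n; near: n; exact: (cvgryPge u).1 uc x.
- move=> x; apply: norm_pint_le; last by move=> y _; case: ifP; rewrite ?normr0.
    apply: pintegrable_le (pintegrable_norm If) _.
      apply: measurable_fun_if => //; first exact: measurable_fun_ler.
      by apply: (@measurable_funS _ _ _ _ [set` `](0 : R), +oo[]).
    by move=> y _; case: ifP; rewrite ?normr0.
  exact: pintegrable_norm.
Unshelve. all: by end_near. Qed.

Let cts_comp f g g' x : is_derive x (1 : R) g g' -> {for g x, continuous f} ->
  {for x, continuous (fun u => f (g u))}.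
Proof. by move=> dg cf; apply: continuous_comp => //; exact: dv_cts dg. Qed.

Let d_up u : is_derive u (1 : R) (fun u : R => expR u) (expR u).
Proof. by eapply dv_eq; [dv|rewrite mul1r]. Qed.
Let d_dn u : is_derive u (1 : R) (fun u : R => expR (- u)) (- expR (- u)).
Proof. by eapply dv_eq; [dv|rewrite mulN1r]. Qed.

Let c_up f u : (forall x, 0 < x -> {for x, continuous f}) ->
  {for u, continuous (fun u => f (expR u) * expR u)}.
Proof.
move=> cf; apply: continuousM; last exact: dv_cts (d_up u).
by apply: cts_comp (d_up u) _; apply: cf; exact: expR_gt0.
Qed.
Let c_dn f u : (forall x, 0 < x -> {for x, continuous f}) ->
  {for u, continuous (fun u => f (expR (- u)) * expR (- u))}.
Proof.
move=> cf; apply: continuousM; last exact: dv_cts (d_dn u).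
by apply: cts_comp (d_dn u) _; apply: cf; exact: expR_gt0.
Qed.

Let D_up f F u : (forall x, 0 < x -> is_derive x (1 : R) F (f x)) ->
  is_derive u (1 : R) (fun u => F (expR u)) (f (expR u) * expR u).
Proof. by move=> dF; exact: (dv_comp (dF _ (expR_gt0 u)) (d_up u)). Qed.
Let D_dn f F u : (forall x, 0 < x -> is_derive x (1 : R) F (f x)) ->
  is_derive u (1 : R) (fun u => - F (expR (- u))) (f (expR (- u)) * expR (- u)).
Proof.
move=> dF; have h := dvN (@dv_comp R F (fun u => expR (- u)) _ _ _ (dF _ (expR_gt0 (- u))) (d_dn u)).
by apply: dv_eq h _; rewrite mulrN opprK.
Qed.

Lemma pintegrable_exp_up f : pintegrable f -> (forall x, 0 < x -> {for x, continuous f}) ->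
  pintegrable (fun u => f (expR u) * expR u).
Proof.
move=> If cf; have cN x (x0 : 0 < x) : {for x, continuous (fun y => `|f y|)}.
  by apply: continuous_comp; [exact: cf|exact: norm_continuous].
have [F [dF _ _ FM]] := pint_antiderivative (pintegrable_norm If) cN.
have I : pintegrable (fun u => `|f (expR u)| * expR u).
  apply: (@pintegrable_ftc R (fun u => F (expR u)) _ (pint (fun y => `| `|f y| |))).
  - by move=> u _; exact: (D_up u dF).
  - move=> u _; exact: (@c_up _ u cN).
  - by move=> u _; rewrite mulr_ge0 ?expR_ge0.
  - by move=> u _; exact: FM.
apply: pintegrable_le I _; first by apply: pmeas_cts => u _; exact: (@c_up f u cf).
by move=> u _; rewrite normrM (ger0_norm (expR_ge0 _)).
Qed.

Lemma pintegrable_exp_dn f : pintegrable f -> (forall x, 0 < x -> {for x, continuous f}) ->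
  pintegrable (fun u => f (expR (- u)) * expR (- u)).
Proof.
move=> If cf; have cN x (x0 : 0 < x) : {for x, continuous (fun y => `|f y|)}.
  by apply: continuous_comp; [exact: cf|exact: norm_continuous].
have [F [dF _ _ FM]] := pint_antiderivative (pintegrable_norm If) cN.
have I : pintegrable (fun u => `|f (expR (- u))| * expR (- u)).
  apply: (@pintegrable_ftc R (fun u => - F (expR (- u))) _ (pint (fun y => `| `|f y| |))).
  - by move=> u _; exact: (D_dn u dF).
  - by move=> u _; exact: (@c_dn _ u cN).
  - by move=> u _; rewrite mulr_ge0 ?expR_ge0.
  - by move=> u _; rewrite normrN; exact: FM.
apply: pintegrable_le I _; first by apply: pmeas_cts => u _; exact: (@c_dn f u cf).
by move=> u _; rewrite normrM (ger0_norm (expR_ge0 _)).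
Qed.

(** Splitting at [1] and substituting [y = exp u] and [y = exp (- u)]. *)
Lemma pint_exp_split f : pintegrable f -> (forall x, 0 < x -> {for x, continuous f}) ->
  pint f = pint (fun u => f (expR u) * expR u) + pint (fun u => f (expR (- u)) * expR (- u)).
Proof.
move=> If cf; have [F [dF F0 Fy _]] := pint_antiderivative If cf.
have cF1 : {for 1, continuous F} by exact: dv_cts (dF 1 ltr01).
have e1 : pint (fun u => f (expR u) * expR u) = pint f - F 1.
  apply: (@pint_ftc R (fun u => F (expR u))).
  - by move=> u _; exact: (D_up u dF).
  - by move=> u _; exact: (@c_up _ u cf).
  - exact: pintegrable_exp_up.
  - rewrite -expR0; apply: cvg_at_right_filter.
    exact: dv_cts (D_up 0 dF).
  - apply/cvg_pinftyP => v vy; move/cvg_pinftyP: Fy; apply.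
    apply/cvgryPge => M; near=> n; apply: (@le_trans _ _ (v n)).
      by near: n; exact: (cvgryPge v).1 vy M.
    by apply: le_trans (expR_ge1Dx _); rewrite lerDr.
have e2 : pint (fun u => f (expR (- u)) * expR (- u)) = 0 - - F 1.
  apply: (@pint_ftc R (fun u => - F (expR (- u)))).
  - by move=> u _; exact: (D_dn u dF).
  - by move=> u _; exact: (@c_dn _ u cf).
  - exact: pintegrable_exp_dn.
  - rewrite -expR0 -[in - F _]oppr0; apply: cvg_at_right_filter.
    exact: dv_cts (D_dn 0 dF).
  - rewrite -[Z in _ --> Z]oppr0; apply: cvgN.
    apply/cvg_pinftyP => v vy; move/cvg_at_rightP: F0; apply; split.
      by move=> n; exact: expR_gt0.
    by move/cvg_pinftyP: (@cvgr_expR R); apply.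
by rewrite e1 e2; ring.
Unshelve. all: by end_near. Qed.

End exponential_substitution.

(** * Finite parts of integrals of entire functions *)

Section power_series_integral.
Context {R : realType}.
Implicit Types (w s : R -> R) (p : nat -> R) (u C : R).

Lemma geometric_half_le N : \sum_(0 <= m < N) (2^-1 : R) ^+ m <= 2.
Proof.
suff -> : \sum_(0 <= m < N) (2^-1 : R) ^+ m = 2 - 2 * 2^-1 ^+ N.
  by rewrite gerBl mulr_ge0// exprn_ge0// invr_ge0.
elim: N => [|N IH]; first by rewrite big_nil expr0 mulr1 subrr.
by rewrite big_nat_recr//= IH exprS; field.
Qed.

Lemma expN_itv u : 0 < u -> 0 <= expR (- u) <= 1.
Proof. by move=> u0; rewrite expR_ge0 -[leRHS]expR0 ler_expR oppr_le0 ltW. Qed.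

(** Integration term by term, on the half-line, of a power series in
  [exp (- u)] whose coefficients are summable. *)
Lemma pint_power_series w p s C : pintegrable w -> 0 <= C ->
  (forall m, `|p m| <= C * 2^-1 ^+ m) ->
  (forall u, 0 < u -> \sum_(0 <= m < N) p m * expR (- u) ^+ m @[N --> \oo] --> s u) ->
  \sum_(0 <= m < N) p m * pint (fun u => w u * expR (- u) ^+ m) @[N --> \oo] -->
    pint (fun u => w u * s u).
Proof.
move=> Iw C0 pC ps.
have Iwm m : pintegrable (fun u => w u * expR (- u) ^+ m).
  apply: pintegrable_le (pintegrable_norm Iw) _.
    by apply: measurable_funM; [exact: pintegrable_meas|mf].
  move=> u /expN_itv/andP[e0 e1].
  by rewrite normrM ler_piMr// ger0_norm ?exprn_ge0// exprn_ile1.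
pose F N u := \sum_(0 <= m < N) p m * (w u * expR (- u) ^+ m).
have E N : \sum_(0 <= m < N) p m * pint (fun u => w u * expR (- u) ^+ m) = pint (F N).
  rewrite pint_sum; last by move=> m; exact: pintegrableZ.
  by apply: eq_bigr => m _; rewrite pintZ.
under eq_fun do rewrite E.
have Ig : pintegrable (fun u => (C * 2) * `|w u|) by apply/pintegrableZ/pintegrable_norm.
have FE N u : F N u = w u * \sum_(0 <= m < N) p m * expR (- u) ^+ m.
  by rewrite /F mulr_sumr; apply: eq_bigr => m _; rewrite mulrCA.
have [|||_ //] := @pint_dct R F (fun u => w u * s u) _ _ Ig.
- by move=> N; apply: pintegrable_meas; apply: pintegrable_sum => m; exact: pintegrableZ.
- move=> N u u0; have /andP[e0 e1] := expN_itv u0.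
  rewrite FE normrM mulrC ler_wpM2r//.
  apply: le_trans (ler_norm_sum _ _ _) _.
  apply: (@le_trans _ _ (\sum_(0 <= m < N) C * 2^-1 ^+ m)).
    apply: ler_sum => m _; rewrite normrM; apply: le_trans (pC m).
    by rewrite ler_piMr// ger0_norm ?exprn_ge0// exprn_ile1.
  by rewrite -mulr_sumr ler_wpM2l// geometric_half_le.
- move=> u u0; under eq_fun do rewrite FE.
  by apply: cvgM; [exact: cvg_cst|exact: ps].
Qed.

End power_series_integral.

Definition taylor_coef (R : realType) (c : nat -> R) (n m : nat) : R := c (n + m)%N / m`!%:R.

(** [f 0] is an entire function restricted to the half-line, [f n] its
  derivatives and [c] the derivatives at the origin; [L n] is the logarithmic
  moment of [f n.+1]. The rate [4^-1] is chosen so that, after the loss of a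
  binomial coefficient in [taylor_coef_le], the Taylor coefficients of every
  derivative are summable at [1]. *)
Definition decaying_entire (R : realType) (f : nat -> R -> R) (c L : nat -> R) : Prop :=
  [/\ forall (n : nat) (x : R), 0 < x -> is_derive x (1 : R) (f n) (f n.+1 x),
      forall (n : nat) (r : R), 0 <= r -> r < n.+1%:R ->
        exists2 C, 0 <= C & forall x, 0 < x -> `|f n x| <= C * x `^ (- r),
      forall (n : nat) (x : R), 0 < x -> \sum_(0 <= m < N) taylor_coef c n m * x ^+ m @[N --> \oo] --> f n x,
      exists2 C, 0 <= C & forall j, `|c j| <= C * 4^-1 ^+ j * j`!%:R &
      forall n, pintegrable (fun y => f n.+1 y * ln y) /\
        pint (fun y => f n.+1 y * ln y) = L n].

Section finite_part.
Context {R : realType}.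
Variables (f : nat -> R -> R) (c L : nat -> R).
Hypothesis hf : decaying_entire f c L.
Local Notation a := (taylor_coef c).
Implicit Types (u x : R) (n m k : nat).

Let df n x : 0 < x -> is_derive x (1 : R) (f n) (f n.+1 x).
Proof. by case: hf => h _ _ _ _; exact: h. Qed.

Let cts n x : 0 < x -> {for x, continuous (f n)}.
Proof. by move=> x0; exact: dv_cts (df n x0). Qed.

Lemma taylor_coefS n m : a n.+1 m = m.+1%:R * a n m.+1.
Proof.
rewrite /taylor_coef addSnnS factS natrM; have h : m`!%:R != 0 :> R by rewrite pnatr_eq0 -lt0n fact_gt0.
by field; rewrite h /= nat1r pnatr_eq0.
Qed.

Lemma taylor_coef_le n : exists2 C, 0 <= C & forall m, `|a n m| <= C * 2^-1 ^+ m.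
Proof.
have [_ _ _ [C C0 hC] _] := hf; exists (C * n`!%:R); first by rewrite mulr_ge0.
move=> m; have fm : 0 < m`!%:R :> R by rewrite ltr0n fact_gt0.
rewrite /taylor_coef normrM [`|_^-1|]gtr0_norm ?invr_gt0// ler_pdivrMr//.
apply: le_trans (hC _) _.
have hb : (n + m)`!%:R = 'C(n + m, n)%:R * n`!%:R * m`!%:R :> R.
  by have := bin_fact (leq_addr m n); rewrite addKn mulnA => <-; rewrite !natrM.
have h2 : 'C(n + m, n)%:R <= 2 ^+ (n + m) :> R.
  rewrite -natrX ler_nat -[in leqRHS](addn1 1) Pascal.
  rewrite (bigD1 (inord n)) //= inordK ?ltnS ?leq_addr// !exp1n !muln1.
  exact: leq_addr.
have -> : (4^-1 : R) = 2^-1 * 2^-1 by field.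
rewrite exprMn hb.
have q : (2^-1 : R) ^+ (n + m) * 'C(n + m, n)%:R <= 1.
  by rewrite exprVn mulrC ler_pdivrMr ?exprn_gt0// mul1r.
have q2 : (2^-1 : R) ^+ (n + m) <= 2^-1 ^+ m.
  by rewrite exprD ler_piMl ?exprn_ge0 ?invr_ge0// exprn_ile1 ?invr_ge0// invf_le1// ler1n.
rewrite [leLHS](_ : _ = (C * n`!%:R * m`!%:R) * ((2^-1 ^+ (n + m) * 'C(n + m, n)%:R) * 2^-1 ^+ (n + m))); last by ring.
rewrite [leRHS](_ : _ = (C * n`!%:R * m`!%:R) * (1 * 2^-1 ^+ m)); last by ring.
rewrite ler_wpM2l ?mulr_ge0//; by apply: ler_pM.
Qed.

(** The integral of [f n y / y ^ k.+1] over [y > 1], after [y = exp u]. *)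
Definition upper_moment n k : R := pint (fun u => f n (expR u) * expR (- u) ^+ k).
Local Notation A := upper_moment.

Lemma f_exp_le n r : 0 <= r -> r < n.+1%:R -> exists2 C, 0 <= C &
  forall u, `|f n (expR u)| <= C * expR (- (r * u)).
Proof.
move=> r0 rn; have [_ h _ _ _] := hf; have [C C0 hC] := h n r r0 rn.
exists C => // u; apply: le_trans (hC _ (expR_gt0 u)) _.
by rewrite -expRM le_eqVlt; apply/orP; left; apply/eqP; congr (C * expR _); ring.
Qed.

Let d_exp u : is_derive u (1 : R) (fun u : R => expR u) (expR u).
Proof. by eapply dv_eq; [dv|rewrite mul1r]. Qed.

Let df_exp n u : is_derive u (1 : R) (fun u => f n (expR u)) (f n.+1 (expR u) * expR u).
Proof. exact: (@dv_comp R (f n) (fun u => expR u) _ _ _ (df n (expR_gt0 u)) (d_exp u)). Qed.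

Let half_lt n : 2^-1 < n.+1%:R :> R.
Proof. by apply: (@lt_le_trans _ _ 1); [rewrite invf_lt1 ?ltr1n|rewrite ler1n]. Qed.

Let half0 : 0 < 2^-1 :> R. Proof. by rewrite invr_gt0. Qed.

Let pmeas_f_exp n : pmeas (fun u => f n (expR u)).
Proof. by apply: pmeas_cts => u _; exact: dv_cts (df_exp n u). Qed.

Lemma pintegrable_f_exp n : pintegrable (fun u => f n (expR u)).
Proof.
have [C C0 hC] := f_exp_le (ltW half0) (half_lt n).
apply: pintegrable_le (pmeas_f_exp n) (pintegrableZ C (pintegrable_expN half0)) _ => u _.
exact: hC.
Qed.

Let pintegrable_moment n k : pintegrable (fun u => f n (expR u) * expR (- u) ^+ k).
Proof.
apply: pintegrable_le (pintegrable_norm (pintegrable_f_exp n)) _.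
  by apply: measurable_funM; [exact: pmeas_f_exp|mf].
move=> u /expN_itv/andP[e0 e1].
by rewrite normrM ler_piMr// ger0_norm ?exprn_ge0// exprn_ile1.
Qed.

Let f_exp_bound n (d : R) : 0 <= d -> exists K, forall u, 1 <= u ->
  `|f n (expR u)| * u `^ d <= K * u `^ (- 1).
Proof.
move=> d0; have [C C0 hC] := f_exp_le (ltW half0) (half_lt n).
have d1 : 0 <= d + 1 by lra.
have [K K0 hK] := expR_pow_bound half0 d1.
exists (C * K) => u u1; have u0 : 0 < u by exact: lt_le_trans u1.
apply: (@le_trans _ _ (C * (K * u `^ (- (d + 1))) * u `^ d)).
  rewrite ler_wpM2r ?powR_ge0//; apply: le_trans (hC u) _.
  by rewrite ler_wpM2l// hK.
rewrite -!mulrA -powR_add// le_eqVlt; apply/orP; left; apply/eqP.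
by congr (C * (K * _ `^ _)); ring.
Qed.

Let cts_moment n k u : {for u, continuous (fun u => f n (expR u) * expR (- u) ^+ k)}.
Proof. by eapply dv_cts; eapply dvM; [exact: df_exp|dv]. Qed.

(** Integration by parts. *)
Lemma upper_momentS n k : A n.+1 k - k.+1%:R * A n k.+1 = - f n 1.
Proof.
have I0 := pintegrable_moment n k.+1; have I1 := pintegrable_moment n.+1 k.
rewrite /upper_moment -(pintZ k.+1%:R I0) -(pintB I1 (pintegrableZ k.+1%:R I0)).
have I := pintegrableB (pintegrable_moment n.+1 k) (pintegrableZ k.+1%:R (pintegrable_moment n k.+1)).
have D u : is_derive u (1 : R) (fun u => f n (expR u) * expR (- u) ^+ k.+1)
    (f n.+1 (expR u) * expR (- u) ^+ k - k.+1%:R * (f n (expR u) * expR (- u) ^+ k.+1)).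
  have e : is_derive u (1 : R) (fun u : R => expR (- u) ^+ k.+1)
      (- (k.+1%:R * expR (- u) ^+ k.+1)).
    by eapply dv_eq; [dv|rewrite /= exprS; ring].
  apply: dv_eq (dvM (df_exp n u) e) _.
  have h := expRxMexpNx_1 u.
  rewrite [expR (- u) ^+ k.+1 in X in X + _]exprS mulrN [in LHS]mulrA -[f n.+1 _ * expR u * _]mulrA h.
  by ring.
have F0 : f n (expR u) * expR (- u) ^+ k.+1 @[u --> 0^'+] --> f n 1.
  have e : f n 1 = f n (expR 0) * expR (- 0) ^+ k.+1 by rewrite oppr0 expR0 expr1n mulr1.
  by rewrite e; apply: cvg_at_right_filter; exact: dv_cts (D 0).
have Fy : f n (expR u) * expR (- u) ^+ k.+1 @[u --> +oo%R] --> (0 : R).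
  have [K hK] := f_exp_bound n (lexx 0).
  apply: (@cvg_aty_le _ _ K 1) => // u u1; apply: le_trans (hK u u1).
  have /andP[e0 e1] := expN_itv (lt_le_trans ltr01 u1).
  by rewrite powRr0 mulr1 normrM ler_piMr// ger0_norm ?exprn_ge0// exprn_ile1.
have ci u (_ : 0 < u) : {for u, continuous (fun u => f n.+1 (expR u) * expR (- u) ^+ k -
    k.+1%:R * (f n (expR u) * expR (- u) ^+ k.+1))}.
  apply: continuousB; first exact: cts_moment.
  by apply: continuousM; [exact: cst_continuous|exact: cts_moment].
by have := @pint_ftc R _ _ (f n 1) 0 (fun u _ => D u) ci I F0 Fy; rewrite sub0r.
Qed.

(** The integral over ]0, 1[ of the [m]-th term of the expansion of
  [f n y / y ^ k.+1], by its analytic continuation when it diverges; the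
  logarithmic term [m = k] is left out. *)
Definition off_diagonal n k m : R := if m == k then 0 else a n m / (m%:R - k%:R).
Local Notation s := off_diagonal.

Let gamma2 : Gamma (2 : R) = 1.
Proof. by have := Gamma_rec (@ltr01 R); rewrite Gamma1 mulr1. Qed.

Let pint_u_exp m : pint (fun u => (u * expR (- u)) * expR (- u) ^+ m) = (m.+1%:R ^+ 2)^-1.
Proof.
have m0 : 0 < m.+1%:R :> R by [].
transitivity (pint (fun u => u `^ (2 - 1) * expR (- (m.+1%:R * u)))).
  apply: eq_pint => u u0; rewrite (_ : 2 - 1 = 1 :> R); last by ring.
  by rewrite powRr1 ?(ltW u0)// -mulrA -exprS -expRM_natl mulrN.
by rewrite pint_gamma// gamma2 mulr1 powRN powR_mulrn.
Qed.

Let pintegrable_u_exp : pintegrable (fun u => u * expR (- u)).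
Proof.
have two : 0 < 2 :> R by [].
apply: pintegrable_eq (pintegrable_gamma1 two) => u u0.
by rewrite (_ : 2 - 1 = 1 :> R) ?powRr1 ?(ltW u0)//; ring.
Qed.

Let lower_log n : \sum_(0 <= m < N) a n.+1 m / m.+1%:R ^+ 2 @[N --> \oo] -->
  pint (fun u => u * expR (- u) * f n.+1 (expR (- u))).
Proof.
have [C C0 hC] := taylor_coef_le n.+1; have [_ _ hs _ _] := hf.
have := pint_power_series pintegrable_u_exp C0 hC (fun u _ => hs n.+1 _ (expR_gt0 (- u))).
apply: cvg_trans; apply: near_eq_cvg; near=> N; apply: eq_bigr => m _; congr (_ * _).
exact: pint_u_exp.
Unshelve. all: by end_near. Qed.

Let upper_log n : pint (fun u => f n.+1 (expR u) * expR u * u) = - A n 0.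
Proof.
have r32 : 0 <= 1 + 2^-1 :> R by rewrite addr_ge0.
have r32n : 1 + 2^-1 < n.+2%:R :> R.
  have h2 : 2 <= n.+2%:R :> R by rewrite ler_nat.
  by lra.
have [C C0 hC] := f_exp_le r32 r32n.
have two : 0 < 2 :> R by [].
have I1 : pintegrable (fun u => f n.+1 (expR u) * expR u * u).
  apply: pintegrable_le _ (pintegrableZ C (pintegrable_gamma two half0)) _.
    apply: (@mfM _ _ _ _ (fun u => f n.+1 (expR u) * expR u) (fun u => u)); last by mf.
    apply: (@mfM _ _ _ _ (fun u => f n.+1 (expR u)) (fun u => expR u)); first exact: pmeas_f_exp.
    exact: (measurable_funTS (@measurable_expR R)).
  move=> u u0; rewrite !normrM (ger0_norm (expR_ge0 _)) (gtr0_norm u0).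
  apply: le_trans (ler_wpM2r (ltW u0) (ler_wpM2r (expR_ge0 u) (hC u))) _.
  rewrite (_ : 2 - 1 = 1 :> R); last by ring.
  rewrite powRr1 ?(ltW u0)// le_eqVlt; apply/orP; left; apply/eqP.
  have -> : - (2^-1 * u) = - ((1 + 2^-1) * u) + u by ring.
  by rewrite expRD; ring.
have I0 := pintegrable_moment n 0.
have D u : is_derive u (1 : R) (fun u => f n (expR u) * u)
    (f n.+1 (expR u) * expR u * u + f n (expR u) * expR (- u) ^+ 0).
  apply: dv_eq (dvM (df_exp n u) (dv_id u)) _.
  by rewrite expr0 !mulr1.
have F0 : f n (expR u) * u @[u --> 0^'+] --> (0 : R).
  have e : 0 = f n (expR 0) * 0 by rewrite mulr0.
  by rewrite [Z in _ --> Z]e; apply: cvg_at_right_filter; exact: dv_cts (D 0).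
have Fy : f n (expR u) * u @[u --> +oo%R] --> (0 : R).
  have [K hK] := f_exp_bound n (@ler01 R).
  apply: (@cvg_aty_le _ _ K 1) => // u u1; apply: le_trans (hK u u1).
  have u0 := lt_le_trans ltr01 u1.
  by rewrite powRr1 ?(ltW u0)// normrM (gtr0_norm u0).
have ci u (_ : 0 < u) : {for u, continuous (fun u => f n.+1 (expR u) * expR u * u +
    f n (expR u) * expR (- u) ^+ 0)}.
  apply: continuousD; last exact: cts_moment.
  by eapply dv_cts; eapply dvM; [eapply dvM; [exact: df_exp|dv]|dv].
have := @pint_ftc R _ _ 0 0 (fun u _ => D u) ci (pintegrableD I1 I0) F0 Fy.
by rewrite pintD// subrr => /eqP; rewrite addr_eq0 => /eqP.
Qed.

(** Split the logarithmic moment at [1]. Above [1], integrate by parts; below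
  [1], expand, the integral of [u * exp (- u * m.+1)] being [1 / m.+1 ^ 2]. *)
Lemma finite_part0 n : \sum_(0 <= m < N) s n 0 m @[N --> \oo] --> - L n - A n 0.
Proof.
have [_ _ _ _ /(_ n)[IL eL]] := hf.
have cl x : 0 < x -> {for x, continuous (fun y => f n.+1 y * ln y)}.
  by move=> x0; exact: dv_cts (dvM (df n.+1 x0) (dv_ln x0 (dv_id x))).
have := pint_exp_split IL cl; rewrite eL.
rewrite (_ : pint (fun u => f n.+1 (expR u) * ln (expR u) * expR u) = - A n 0); last first.
  by rewrite -upper_log; apply: eq_pint => u _; rewrite expRK; ring.
set B := pint _ => e; have -> : - L n - A n 0 = - B by rewrite e; ring.
have -> : - B = pint (fun u => u * expR (- u) * f n.+1 (expR (- u))).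
  rewrite /B -pintN; last exact: pintegrable_exp_dn IL cl.
  by apply: eq_pint => u _; rewrite expRK; ring.
have sh : \sum_(0 <= m < N.+1) s n 0 m @[N --> \oo] -->
    pint (fun u => u * expR (- u) * f n.+1 (expR (- u))).
  apply: cvg_trans (@lower_log n); apply: near_eq_cvg; near=> N.
  rewrite [RHS]big_nat_recl// [X in _ = X + _]/off_diagonal eqxx add0r; apply: eq_bigr => m _.
  rewrite /off_diagonal/= subr0 taylor_coefS.
  have m0 : m.+1%:R != 0 :> R by rewrite pnatr_eq0.
  by field; rewrite nat1r.
by rewrite (cvg_shiftS (fun N => \sum_(0 <= m < N) s n 0 m)) in sh.
Unshelve. all: by end_near. Qed.

Definition harmonic_sum k : R := \sum_(0 <= j < k) j.+1%:R^-1.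

Lemma off_diagonalS n k m : m != k ->
  s n k.+1 m.+1 = k.+1%:R^-1 * (s n.+1 k m - a n m.+1).
Proof.
move=> mk; rewrite /off_diagonal eqSS (negbTE mk) taylor_coefS.
have h : m%:R - k%:R != 0 :> R by rewrite subr_eq0 eqr_nat.
have k0 : k.+1%:R != 0 :> R by rewrite pnatr_eq0.
rewrite (_ : m.+1%:R - k.+1%:R = m%:R - k%:R :> R); last by rewrite -!natr1; ring.
rewrite -!natr1 in k0 *; field.
by rewrite h k0.
Qed.

(** Integrating by parts once turns [f n y / y ^ k.+2] into
  [f n.+1 y / y ^ k.+1]; term by term the exceptional index [m = k] produces
  the increment of the harmonic sum. After [k] steps the logarithmic moment is
  reached. *)
Lemma finite_part k : forall n, \sum_(0 <= m < N) s n k m @[N --> \oo] -->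
  - L (n + k)%N / k`!%:R + a n k * harmonic_sum k - A n k.
Proof.
elim: k => [|k IH] n.
  rewrite addn0 fact0 divr1 /harmonic_sum big_nil mulr0 addr0; exact: finite_part0.
have k0 : k.+1%:R != 0 :> R by rewrite pnatr_eq0.
have [_ _ hs _ _] := hf.
have hs1 : \sum_(0 <= m < N.+1) a n m @[N --> \oo] --> f n 1.
  rewrite (cvg_shiftS (fun N => \sum_(0 <= m < N) a n m)).
  apply: cvg_trans (hs n 1 ltr01); apply: near_eq_cvg; near=> N.
  by apply: eq_bigr => m _; rewrite expr1n mulr1.
rewrite -(cvg_shiftS (fun N => \sum_(0 <= m < N) s n k.+1 m)).
have -> : - L (n + k.+1) / (k.+1)`!%:R + a n k.+1 * harmonic_sum k.+1 - A n k.+1 =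
    k.+1%:R^-1 * (- L (n.+1 + k) / k`!%:R + a n.+1 k * harmonic_sum k - A n.+1 k - f n 1 + a n k.+1).
  have fk : k`!%:R != 0 :> R by rewrite pnatr_eq0 -lt0n fact_gt0.
  have e := upper_momentS n k.
  have -> : f n 1 = k.+1%:R * A n k.+1 - A n.+1 k by rewrite -[f n 1]opprK -e; ring.
  rewrite /harmonic_sum big_nat_recr//= taylor_coefS factS natrM addSnnS.
  by field; rewrite fk nat1r.
have lim : k.+1%:R^-1 * (\sum_(0 <= m < N) s n.+1 k m - \sum_(0 <= m < N.+1) a n m + a n k.+1)
   @[N --> \oo] -->
   k.+1%:R^-1 * (- L (n.+1 + k) / k`!%:R + a n.+1 k * harmonic_sum k - A n.+1 k - f n 1 + a n k.+1).
  apply: cvgM; first exact: cvg_cst.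
  by apply: cvgD; [exact: cvgB (IH n.+1) hs1|exact: cvg_cst].
apply: cvg_trans lim; apply: near_eq_cvg; near=> N.
have kN : (k < N)%N by near: N; exact: nbhs_infty_gt.
rewrite [RHS]big_nat_recl//= [X in _ - X]big_nat_recl//=.
have -> : s n k.+1 0 = - (k.+1%:R^-1 * a n 0).
  by rewrite /off_diagonal /= sub0r invrN; ring.
have -> : a n k.+1 = \sum_(0 <= m < N) (if m == k then a n m.+1 else 0).
  by rewrite -big_mkcond big_nat1_eq kN.
have -> : \sum_(0 <= m < N) s n k.+1 m.+1 = k.+1%:R^-1 * (\sum_(0 <= m < N) s n.+1 k m -
    \sum_(0 <= m < N) a n m.+1 + \sum_(0 <= m < N) (if m == k then a n m.+1 else 0)).
  rewrite -sumrB -big_split mulr_sumr; apply: eq_bigr => m _ /=.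
  have [->|mk] := eqVneq m k; last by rewrite addr0 off_diagonalS.
  by rewrite /off_diagonal !eqxx sub0r addNr mulr0.
by ring.
Unshelve. all: by end_near. Qed.

(** Finite part at the origin of the divergent integral of [f 0 y / y ^ k.+1]
  over the half-line: by [finite_part], the sum of [upper_moment] and of the
  [off_diagonal] terms. *)
Definition finite_part_coef k : R := - L k / k`!%:R + a 0 k * harmonic_sum k.

(** Uniformly in [k], which the double sum in [pint_conv_series] requires. *)
Lemma finite_part_tail : exists2 e : nat -> R, e N @[N --> \oo] --> (0 : R) &
  forall k N, (k < N)%N -> 0 <= e N /\
  `|finite_part_coef k - A 0 k - \sum_(0 <= m < N) s 0 k m| <= e N.
Proof.
have [C C0 hC] := taylor_coef_le 0.
exists (fun N => C * 2 * 2^-1 ^+ N).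
  rewrite -[Z in _ --> Z](mulr0 (C * 2)); apply: cvgM; first exact: cvg_cst.
  by apply: cvg_expr; rewrite ger0_norm ?invr_ge0// invf_lt1 ?ltr1n.
move=> k N kN; split; first by rewrite !mulr_ge0// exprn_ge0// invr_ge0.
have h := @finite_part k 0.
have h' : \sum_(0 <= m < M) s 0 k m - \sum_(0 <= m < N) s 0 k m @[M --> \oo] -->
    finite_part_coef k - A 0 k - \sum_(0 <= m < N) s 0 k m.
  by apply: cvgB; [rewrite /finite_part_coef -[k in L k]add0n|exact: cvg_cst].
have hn : `|\sum_(0 <= m < M) s 0 k m - \sum_(0 <= m < N) s 0 k m| @[M --> \oo] -->
  `|finite_part_coef k - A 0 k - \sum_(0 <= m < N) s 0 k m| by exact: cvg_norm.
apply: (cvgr_to_le hn); near=> M.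
have NM : (N <= M)%N by near: M; exact: nbhs_infty_ge.
have -> : \sum_(0 <= m < M) s 0 k m =
    \sum_(0 <= m < N) s 0 k m + \sum_(N <= m < M) s 0 k m by rewrite -big_cat_nat.
rewrite addrAC subrr add0r.
apply: le_trans (ler_norm_sum _ _ _) _.
apply: (@le_trans _ _ (\sum_(N <= m < M) C * 2^-1 ^+ m)).
  rewrite big_nat_cond [leRHS]big_nat_cond; apply: ler_sum => m /andP[/andP[Nm _] _].
  rewrite /off_diagonal; case: eqP => _; first by rewrite normr0 mulr_ge0// exprn_ge0// invr_ge0.
  have km : (k < m)%N by exact: leq_trans Nm.
  rewrite normrM -[leRHS]mulr1; apply: ler_pM => //.
  rewrite -natrB; last exact: ltnW.
  by rewrite ger0_norm ?invr_ge0// invf_le1 ?ler1n ?ltr0n subn_gt0.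
rewrite -mulr_sumr -mulrA ler_wpM2l//.
rewrite -{1}(add0n N) big_addn (eq_bigr (fun m => 2^-1 ^+ m * 2^-1 ^+ N)); last first.
  by move=> m _; rewrite exprD.
by rewrite -mulr_suml ler_wpM2r ?exprn_ge0 ?invr_ge0// geometric_half_le.
Unshelve. all: by end_near. Qed.

End finite_part.

Section parseval.
Context {R : realType}.
Variables (f g : nat -> R -> R) (cf cg Lf Lg : nat -> R).
Hypothesis hf : decaying_entire f cf Lf.
Hypothesis hg : decaying_entire g cg Lg.
Local Notation a := (taylor_coef cf 0).
Local Notation b := (taylor_coef cg 0).
Local Notation Wf := (finite_part_coef cf Lf).
Local Notation Wg := (finite_part_coef cg Lg).

(** The cross terms of the two expansions are antisymmetric and cancel. *)
Lemma off_diagonal_antisym N :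
  \sum_(0 <= k < N) (b k * \sum_(0 <= m < N) off_diagonal cf 0 k m +
    a k * \sum_(0 <= m < N) off_diagonal cg 0 k m) = 0.
Proof.
rewrite big_split /=.
have -> : \sum_(0 <= k < N) a k * \sum_(0 <= m < N) off_diagonal cg 0 k m =
    - \sum_(0 <= k < N) b k * \sum_(0 <= m < N) off_diagonal cf 0 k m.
  under eq_bigr do rewrite mulr_sumr.
  rewrite exchange_big /= -sumrN; apply: eq_bigr => m _.
  rewrite mulr_sumr -sumrN; apply: eq_bigr => k _.
  rewrite /off_diagonal eq_sym; case: eqP => km; first by rewrite !mulr0 oppr0.
  have h : m%:R - k%:R != 0 :> R by rewrite subr_eq0 eqr_nat; apply/eqP => mk; apply: km.
  have h' : k%:R - m%:R != 0 :> R by rewrite -opprB oppr_eq0.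
  by field; rewrite h h'.
by rewrite subrr.
Qed.

Let cf_ x : 0 < x -> {for x, continuous (f 0)}.
Proof. by move=> x0; have [h _ _ _ _] := hf; exact: dv_cts (h 0 x x0). Qed.

Let cg_ x : 0 < x -> {for x, continuous (fun y : R => g 0 y^-1)}.
Proof.
move=> x0; have [h _ _ _ _] := hg; have xn : x != 0 by rewrite gt_eqF.
have xi : 0 < x^-1 by rewrite invr_gt0.
have di : is_derive x (1 : R) (fun y => y^-1) (- (1 / x ^+ 2)) by exact: dv_inv (dv_id x).
exact: dv_cts (@dv_comp R (g 0) (fun y => y^-1) _ _ _ (h 0 _ xi) di).
Qed.

Let ci x : 0 < x -> {for x, continuous (fun y : R => f 0 y * g 0 y^-1 / y)}.
Proof.
move=> x0; apply: continuousM; first by apply: continuousM; [exact: cf_|exact: cg_].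
by eapply dv_cts; apply: dv_inv (dv_id x); rewrite gt_eqF.
Qed.

Lemma pintegrable_conv : pintegrable (fun y : R => f 0 y * g 0 y^-1 / y).
Proof.
have [_ df _ _ _] := hf; have [_ dg _ _ _] := hg.
have h0 : 0 <= 2^-1 :> R by rewrite invr_ge0.
have h1 : 2^-1 < 1 :> R by rewrite invf_lt1 ?ltr1n.
have [C1 C10 f1] := df 0%N 0 (lexx _) ltr01; have [C2 C20 f2] := df 0%N 2^-1 h0 h1.
have [D1 D10 g1] := dg 0%N 0 (lexx _) ltr01; have [D2 D20 g2] := dg 0%N 2^-1 h0 h1.
have e x : 0 < x -> (x^-1) `^ (- 2^-1) = x `^ 2^-1.
  by move=> x0; rewrite -[x^-1](powR_inv1 (ltW x0)) -powRrM; congr (_ `^ _); ring.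
apply: (@pintegrable_two_sided _ _ (C1 * D2 + C2 * D1) 2^-1).
- by rewrite invr_gt0.
- by apply: pmeas_cts => x x0; exact: ci.
- move=> x x0 _; rewrite !normrM [`|x^-1|]gtr0_norm ?invr_gt0//.
  have hf1 := f1 x x0; rewrite oppr0 powRr0 mulr1 in hf1.
  have xi : 0 < x^-1 by rewrite invr_gt0.
  have hg2 := g2 _ xi; rewrite e// in hg2.
  apply: (@le_trans _ _ (C1 * (D2 * x `^ 2^-1) / x)).
    by rewrite ler_wpM2r ?(ltW xi)// ler_pM.
  rewrite (powR_mulB1 _ x0) [leLHS](_ : _ = C1 * D2 * x `^ (2^-1 - 1)); last by field; rewrite gt_eqF.
  by rewrite ler_wpM2r ?powR_ge0// lerDl mulr_ge0.
- move=> x x1; have x0 : 0 < x by exact: lt_le_trans x1.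
  rewrite !normrM [`|x^-1|]gtr0_norm ?invr_gt0//.
  have xi : 0 < x^-1 by rewrite invr_gt0.
  have hf2 := f2 x x0; have hg1 := g1 _ xi; rewrite oppr0 powRr0 mulr1 in hg1.
  apply: (@le_trans _ _ (C2 * x `^ (- 2^-1) * D1 / x)).
    by rewrite ler_wpM2r ?(ltW xi)// ler_pM.
  rewrite (powR_mulB1 _ x0) [leLHS](_ : _ = C2 * D1 * x `^ (- 2^-1 - 1)); last by field; rewrite gt_eqF.
  by rewrite ler_wpM2r ?powR_ge0// lerDr mulr_ge0.
Qed.

Let half_sum (p q : nat -> R -> R) (cp cq Lp Lq : nat -> R) :
  decaying_entire p cp Lp -> decaying_entire q cq Lq ->
  \sum_(0 <= k < N) taylor_coef cq 0 k * upper_moment p 0 k @[N --> \oo] -->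
  pint (fun u => p 0%N (expR u) * q 0%N (expR (- u))).
Proof.
move=> hp hq; have [C C0 hC] := taylor_coef_le hq 0; have [_ _ hs _ _] := hq.
exact: (pint_power_series (pintegrable_f_exp hp 0) C0 hC (fun u _ => hs 0%N _ (expR_gt0 (- u)))).
Qed.

Lemma pint_conv_split : pint (fun y : R => f 0 y * g 0 y^-1 / y) =
  pint (fun u => f 0 (expR u) * g 0 (expR (- u))) + pint (fun u => g 0 (expR u) * f 0 (expR (- u))).
Proof.
rewrite (pint_exp_split pintegrable_conv ci); congr (_ + _); apply: eq_pint => u _.
  by rewrite expRN divfK ?gt_eqF ?expR_gt0.
rewrite divfK; last by rewrite gt_eqF ?expR_gt0.
by rewrite -expRN opprK mulrC.
Qed.

(** Split at [y = 1]; expand [g 0 y^-1] for [y > 1] and [f 0 y] for [y < 1]. The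
  moments over [y > 1] are finite parts minus off-diagonal sums, and the
  latter cancel between the two halves, so that only finite parts survive. *)
Theorem pint_conv_series : \sum_(0 <= k < N) (b k * Wf k + a k * Wg k) @[N --> \oo] -->
  pint (fun y : R => f 0 y * g 0 y^-1 / y).
Proof.
rewrite pint_conv_split; have sf := half_sum hf hg; have sg := half_sum hg hf.
have [ef ef0 hef] := finite_part_tail hf; have [eg eg0 heg] := finite_part_tail hg.
have [Ca Ca0 ha] := taylor_coef_le hf 0; have [Cb Cb0 hb] := taylor_coef_le hg 0.
pose r N := \sum_(0 <= k < N) (
  b k * (Wf k - upper_moment f 0 k - \sum_(0 <= m < N) off_diagonal cf 0 k m) +
  a k * (Wg k - upper_moment g 0 k - \sum_(0 <= m < N) off_diagonal cg 0 k m)).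
have rE N : \sum_(0 <= k < N) (b k * Wf k + a k * Wg k) =
    (\sum_(0 <= k < N) b k * upper_moment f 0 k + \sum_(0 <= k < N) a k * upper_moment g 0 k) + r N.
  transitivity (\sum_(0 <= k < N) (b k * Wf k + a k * Wg k) -
    \sum_(0 <= k < N) (b k * \sum_(0 <= m < N) off_diagonal cf 0 k m +
      a k * \sum_(0 <= m < N) off_diagonal cg 0 k m)).
    by rewrite off_diagonal_antisym subr0.
  rewrite -sumrB /r -!big_split /=.
  by apply: eq_bigr => k _; ring.
suff lim0 : (\sum_(0 <= k < N) b k * upper_moment f 0 k +
    \sum_(0 <= k < N) a k * upper_moment g 0 k) + r N @[N --> \oo] -->
    (pint (fun u : R => f 0 (expR u) * g 0 (expR (- u))) +
     pint (fun u : R => g 0 (expR u) * f 0 (expR (- u)))) + 0.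
  rewrite addr0 in lim0; apply: cvg_trans lim0; apply: near_eq_cvg; near=> N.
  by rewrite rE.
apply: cvgD; first exact: cvgD.
apply/norm_cvg0P.
have lim : (Cb * 2) * ef N + (Ca * 2) * eg N @[N --> \oo] --> (0 : R).
  rewrite (_ : 0 = (Cb * 2) * 0 + (Ca * 2) * 0 :> R); last by ring.
  by apply: cvgD; apply: cvgM => //; exact: cvg_cst.
apply: (@squeeze_cvgr _ _ _ _ (fun=> 0) (fun N => (Cb * 2) * ef N + (Ca * 2) * eg N)) => //.
  2: exact: cvg_cst.
near=> N; rewrite normr_ge0 /=.
have N0 : (0 < N)%N by near: N; exact: nbhs_infty_gt.
have [efN _] := hef 0%N N N0; have [egN _] := heg 0%N N N0.
apply: le_trans (ler_norm_sum _ _ _) _.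
apply: (@le_trans _ _ (\sum_(0 <= k < N) (Cb * ef N * 2^-1 ^+ k + Ca * eg N * 2^-1 ^+ k))).
  rewrite big_nat_cond [leRHS]big_nat_cond; apply: ler_sum => k /andP[/andP[_ kN] _].
  have [_ hefk] := hef k N kN; have [_ hegk] := heg k N kN.
  apply: le_trans (ler_normD _ _) _; apply: lerD; rewrite normrM [leRHS]mulrAC.
    by apply: ler_pM.
  by apply: ler_pM.
rewrite big_split /= -!mulr_sumr; apply: lerD.
  by rewrite [leRHS]mulrAC ler_wpM2l ?geometric_half_le// mulr_ge0.
by rewrite [leRHS]mulrAC ler_wpM2l ?geometric_half_le// mulr_ge0.
Unshelve. all: by end_near. Qed.

End parseval.

(** * The density of the inverse stable subordinator as an entire function *)

(** In Euler's integral, [(X * r `^ al) ^+ j / j`!] is at most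
  [exp (X * r `^ al)], which the factor [exp (- r)] absorbs since [al < 1]. *)
Lemma Gamma_growth (R : realType) (al X : R) : 0 < al -> al < 1 -> 0 <= X ->
  exists2 M, 0 <= M & forall j, X ^+ j * Gamma (al * j.+1%:R) <= M * j`!%:R.
Proof.
move=> al0 al1 X0; have k0 : 0 < 2^-1 :> R by rewrite invr_gt0.
have [M0 hM] := powR_sublinear al0 al1 X0 k0.
have I := pintegrable_gamma al0 k0.
exists (expR M0 * pint (fun r => r `^ (al - 1) * expR (- (2^-1 * r)))).
  by rewrite mulr_ge0 ?expR_ge0// pint_ge0// => r _; rewrite mulr_ge0 ?powR_ge0 ?expR_ge0.
move=> j; have a0 : 0 < al * j.+1%:R by rewrite mulr_gt0.
have fj : 0 < j`!%:R :> R by rewrite ltr0n fact_gt0.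
rewrite GammaE -pintZ; last exact: pintegrable_gamma1.
rewrite [leRHS]mulrC mulrA -pintZ//; apply: le_pint.
- exact/pintegrableZ/pintegrable_gamma1.
- exact: pintegrableZ.
move=> r r0; rewrite (_ : al * j.+1%:R - 1 = al * j%:R + (al - 1)); last by rewrite -natr1; ring.
rewrite (powR_add (al * j%:R) (al - 1) r0) -powR_natX.
have y0 : 0 <= X * r `^ al by rewrite mulr_ge0 ?powR_ge0.
have hj : (X * r `^ al) ^+ j <= j`!%:R * expR (X * r `^ al).
  rewrite [leRHS]mulrC -ler_pdivrMr//.
  apply: le_trans (partial_sum_le_expR j.+1 y0).
  by rewrite big_nat_recr//= lerDr sumr_ge0// => i _; rewrite divr_ge0// exprn_ge0.
rewrite [leLHS](_ : _ = (X * r `^ al) ^+ j * (r `^ (al - 1) * expR (- r))); last first.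
  by rewrite exprMn; ring.
apply: le_trans (ler_wpM2r _ hj) _; first by rewrite mulr_ge0 ?powR_ge0 ?expR_ge0.
rewrite -!mulrA ler_wpM2l ?(ltW fj)// mulrCA [leRHS]mulrCA ler_wpM2l ?powR_ge0//.
by rewrite -!expRD ler_expR; have := hM r r0; lra.
Qed.

Section inverse_family.
Context {R : realType}.
Variables (al th t : R).
Hypothesis angle : contour_angle al th.
Hypothesis t0 : 0 < t.
Implicit Types (x y s v : R) (n m j k : nat).
Local Notation phi := (al * (th + pi)).
Let al0 := al_gt0 angle.

(** The [n]-th derivative of the density [invpdf]. *)
Definition invfam n x : R :=
  (-1) ^+ n / pi * pint (ker al th t (al * n.+1%:R) x (phi * n.+1%:R)).
(** Interpolates, up to sign and a factor [pi], the derivatives of the density at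
  the origin; up to the same factors, the Mellin transform of [invfam n] at [s]
  is [Gamma s * Gsin (n.+1 - s)]. *)
Definition Gsin v : R := t `^ (- (al * v)) * Gamma (al * v) * sin (pi * al * v).
Definition dGsin v : R :=
  t `^ (- (al * v)) * (al * Gamma' (al * v) * sin (pi * al * v) +
    Gamma (al * v) * (pi * al * cos (pi * al * v) - al * ln t * sin (pi * al * v))).
Definition invcoef j : R := (-1) ^+ j * Gsin j.+1%:R / pi.
Definition invlog n : R := (-1) ^+ n.+1 / pi * (Gamma' 1 * Gsin n.+1%:R - dGsin n.+1%:R).

Lemma invfam0 x : 0 < x -> invfam 0 x = invpdf al th t x.
Proof. by move=> x0; rewrite /invfam /invpdf x0 expr0 mul1r !mulr1. Qed.

Let an0 n : 0 < al * n.+1%:R. Proof. by rewrite mulr_gt0. Qed.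

Lemma dv_Gsin v : 0 < v -> is_derive v (1 : R) Gsin (dGsin v).
Proof.
move=> v0; have av : 0 < al * v by rewrite mulr_gt0.
have dl : is_derive v (1 : R) (fun v => al * v) al.
  by eapply dv_eq; [dv|rewrite mul0r add0r mulr1].
have dG : is_derive v (1 : R) (fun v => Gamma (al * v)) (Gamma' (al * v) * al).
  exact: (@dv_comp R (@Gamma R) (fun v => al * v) _ _ _ (dv_Gamma av) dl).
have dt : is_derive v (1 : R) (fun v => t `^ (- (al * v))) (- (al * ln t) * t `^ (- (al * v))).
  rewrite (_ : (fun v => t `^ (- (al * v))) = (fun v => expR (- (al * v) * ln t))); last first.
    by apply/funext => w; rewrite /powR gt_eqF.
  eapply dv_eq; first by dv.
  by rewrite [t `^ _]/powR gt_eqF//; ring.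
have ds : is_derive v (1 : R) (fun v => sin (pi * al * v)) (pi * al * cos (pi * al * v)).
  by eapply dv_eq; [dv|ring].
by apply: dv_eq (dvM (dvM dt dG) ds) _; rewrite /dGsin /=; ring.
Qed.

Lemma dv_invfam n x : 0 < x -> is_derive x (1 : R) (invfam n) (invfam n.+1 x).
Proof.
move=> x0; have h := dv_pint_ker angle (phi * n.+1%:R) t0 (an0 n) x0.
rewrite /invfam; apply: dv_eq (dvM (dv_cst x _) h) _.
rewrite (_ : al * n.+2%:R = al * n.+1%:R + al); last by rewrite -[n.+2%:R]natr1; ring.
rewrite (_ : phi * n.+2%:R = phi * n.+1%:R + phi); last by rewrite -[n.+2%:R]natr1; ring.
by rewrite /= exprS; ring.
Qed.

Lemma invfam_decay n (r : R) : 0 <= r -> r < n.+1%:R ->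
  exists2 C, 0 <= C & forall x, 0 < x -> `|invfam n x| <= C * x `^ (- r).
Proof.
move=> r0 rn; have h : al * r < al * n.+1%:R by rewrite ltr_pM2l.
have [C C0 hC] := pint_ker_decay angle t0 r0 h; have pi0 := pi_gt0 R.
exists (pi^-1 * C) => [|x x0]; first by rewrite mulr_ge0// invr_ge0 ltW.
rewrite /invfam normrM normrM normrX normrN1 expr1n mul1r gtr0_norm ?invr_gt0// -[leRHS]mulrA.
by rewrite ler_wpM2l ?invr_ge0 ?(ltW pi0)// hC.
Qed.

Lemma invfam_series n x : 0 < x ->
  \sum_(0 <= m < N) taylor_coef invcoef n m * x ^+ m @[N --> \oo] --> invfam n x.
Proof.
move=> x0; have h := @pint_ker_series R al th angle t (al * n.+1%:R) x (phi * n.+1%:R) t0 (an0 n) (ltW x0).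
pose K : R := (-1) ^+ n / pi.
have lim : K * \sum_(0 <= m < N) ((- x) ^+ m / m`!%:R *
    pint (ker al th t (al * n.+1%:R + al * m%:R) 0 (phi * n.+1%:R + phi * m%:R))) @[N --> \oo]
    --> invfam n x.
  by apply: cvgM; [exact: cvg_cst|exact: h].
apply: cvg_trans lim; apply: near_eq_cvg; near=> N.
rewrite /= mulr_sumr; apply: eq_bigr => m _.
have am : 0 < al * n.+1%:R + al * m%:R by rewrite ltr_wpDr// mulr_ge0// ltW.
rewrite pint_ker0// /taylor_coef /invcoef /Gsin.
have e : (n + m).+1%:R = n.+1%:R + m%:R :> R by rewrite -natrD addSn.
rewrite (_ : phi * n.+1%:R + phi * m%:R - (al * n.+1%:R + al * m%:R) * th = pi * al * (n + m).+1%:R); last first.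
  by rewrite e; ring.
rewrite (_ : al * n.+1%:R + al * m%:R = al * (n + m).+1%:R); last by rewrite e; ring.
by rewrite /K exprD [(- x) ^+ m]exprNn; ring.
Unshelve. all: by end_near. Qed.

Lemma invcoef_growth : exists2 C, 0 <= C & forall j, `|invcoef j| <= C * 4^-1 ^+ j * j`!%:R.
Proof.
have ta : 0 < t `^ (- al) by exact: powR_gt0.
have pi0 := pi_gt0 R.
have X0 : 0 <= 4 * t `^ (- al) by rewrite mulr_ge0// ltW.
have [M M_ge0 hM] := Gamma_growth al0 (al_lt1 angle) X0.
exists (t `^ (- al) * M / pi) => [|j]; first by rewrite divr_ge0 ?mulr_ge0// ltW.
have g0 : 0 < Gamma (al * j.+1%:R) by exact: Gamma_gt0.
rewrite /invcoef /Gsin !normrM normrX normrN1 expr1n mul1r [`|pi^-1|]gtr0_norm ?invr_gt0//.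
rewrite (gtr0_norm g0) (ger0_norm (powR_ge0 _ _)).
apply: (@le_trans _ _ (t `^ (- (al * j.+1%:R)) * Gamma (al * j.+1%:R) / pi)).
  rewrite ler_wpM2r ?invr_ge0 ?(ltW pi0)// ler_piMr ?mulr_ge0 ?powR_ge0 ?(ltW g0)//.
  exact: sin_max.
rewrite (_ : - (al * j.+1%:R) = - al * j%:R + - al); last by rewrite -natr1; ring.
rewrite (powR_add (- al * j%:R) (- al) t0) -powR_natX.
rewrite [leRHS](_ : _ = t `^ (- al) / pi * (4^-1 ^+ j * (M * j`!%:R))); last by ring.
rewrite [leLHS](_ : _ = t `^ (- al) / pi * (4^-1 ^+ j * ((4 * t `^ (- al)) ^+ j * Gamma (al * j.+1%:R)))); last first.
  have f4 : (4 : R) ^+ j != 0 by rewrite expf_neq0.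
  by rewrite exprMn exprVn -[4 ^+ j * _ * _]mulrA mulKf//; ring.
rewrite ler_wpM2l ?divr_ge0 ?(ltW ta) ?(ltW pi0)//.
by rewrite ler_wpM2l// exprn_ge0// invr_ge0.
Qed.

Lemma pintegrable_invfam n s : 0 < s -> s < n.+1%:R ->
  pintegrable (fun x => x `^ (s - 1) * invfam n x).
Proof.
move=> s0 sn; have [C1 C10 h1] := invfam_decay (lexx 0) (ltr0Sn R n).
have rn : (s + n.+1%:R) / 2 < n.+1%:R by lra.
have r0 : 0 <= (s + n.+1%:R) / 2 by lra.
have [C2 C20 h2] := invfam_decay r0 rn.
pose d := Num.min s ((n.+1%:R - s) / 2).
have d0 : 0 < d by rewrite lt_min s0; lra.
have d1 : d <= s by rewrite ge_min lexx.
have d2 : d <= (n.+1%:R - s) / 2 by rewrite ge_min lexx orbT.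
apply: (@pintegrable_two_sided _ _ (C1 + C2) d) => //.
- apply: measurable_funM; first by mf.
  by apply: pmeas_cts => x x0; exact: dv_cts (dv_invfam n x0).
- move=> x x0 x1; have := h1 x x0; rewrite oppr0 powRr0 mulr1 => hf.
  rewrite normrM (ger0_norm (powR_ge0 _ _)) mulrC.
  apply: ler_pM => //; first exact: powR_ge0.
    by apply: le_trans hf _; rewrite lerDl.
  by have x01 : 0 < x <= 1; [rewrite x0|apply: (ger_powR x01); lra].
- move=> x x1; have x0 : 0 < x by exact: lt_le_trans x1.
  rewrite normrM (ger0_norm (powR_ge0 _ _)).
  apply: le_trans (ler_wpM2l (powR_ge0 _ _) (h2 x x0)) _.
  rewrite mulrCA -powR_add//; apply: ler_pM => //; first exact: powR_ge0.
    by rewrite lerDr.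
  by apply: (ler_powR x1); lra.
Qed.

Lemma invfam_mellin n s : 0 < s -> s < n.+1%:R ->
  pint (fun x => x `^ (s - 1) * invfam n x) = (-1) ^+ n / pi * (Gamma s * Gsin (n.+1%:R - s)).
Proof.
move=> s0 sn; have I := pintegrable_invfam s0 sn.
have h : al * s < al * n.+1%:R by rewrite ltr_pM2l.
pose K : R := (-1) ^+ n / pi; have K0 : K != 0.
  by rewrite /K mulf_neq0 ?signr_eq0// invr_eq0 gt_eqF// pi_gt0.
have E x : x `^ (s - 1) * invfam n x =
    K * (x `^ (s - 1) * pint (ker al th t (al * n.+1%:R) x (phi * n.+1%:R))).
  by rewrite /invfam -/K; ring.
under eq_pint do rewrite E.
rewrite pintZ; last first.
  by apply: pintegrable_eq (pintegrableZ K^-1 I) => x _; rewrite E mulKf.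
rewrite mellin_ker// /Gsin.
rewrite (_ : al * n.+1%:R - al * s = al * (n.+1%:R - s)); last by ring.
rewrite (_ : phi * n.+1%:R - s * phi - _ = pi * al * (n.+1%:R - s)); last by ring.
by [].
Qed.

(** The logarithmic moment is the derivative of the Mellin transform at [1]. *)
Lemma invfam_log n : pintegrable (fun y => invfam n.+1 y * ln y) /\
  pint (fun y => invfam n.+1 y * ln y) = invlog n.
Proof.
have [C1 C10 h1] := invfam_decay (lexx 0) (ltr0Sn R n.+1).
have r74 : 7 / 4 < n.+2%:R :> R.
  by have h : 2 <= n.+2%:R :> R; [rewrite ler_nat|lra].
have r740 : 0 <= 7 / 4 :> R by lra.
have [C2 C20 h2] := invfam_decay r740 r74.
(* [w] bounds [x `^ (s - 1) * ln x] for [1 / 2 < s < 3 / 2], as in [powR_ln_le]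
  with [e = 1 / 8]. Near [0] boundedness of the family suffices; near infinity a
  decay of order more than [3 / 2 + 1 / 8] is needed, and [7 / 4 < n + 2]. *)
pose w x : R := (x `^ (1 / 2 + 1 / 8 - 1) + x `^ (1 / 2 - 1 / 8 - 1)) +
  (x `^ (3 / 2 + 1 / 8 - 1) + x `^ (3 / 2 - 1 / 8 - 1)).
pose dom x := (1 / 8)^-1 * w x * `|invfam n.+1 x|.
have cfam x : 0 < x -> {for x, continuous (invfam n.+1)} by move=> x0; exact: dv_cts (dv_invfam n.+1 x0).
have mfam : pmeas (invfam n.+1) by exact: pmeas_cts.
have w0 x : 0 <= w x by rewrite /w !addr_ge0 ?powR_ge0.
have e8 : 0 <= (1 / 8)^-1 :> R by rewrite invr_ge0 divr_ge0.
have Idom : pintegrable dom.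
  apply: (@pintegrable_two_sided _ _ (32 * C1 + 32 * C2) (1 / 8)); first by lra.
  - rewrite /dom /w; apply: measurable_funM; first by mf.
    exact: measurableT_comp mfam.
  - move=> x x0 x1; have hw : w x <= 4 * x `^ (1 / 8 - 1).
      have x01 : 0 < x <= 1 by rewrite x0.
      have h := ger_powR x01; have h3 : x `^ (1 / 2 + 1 / 8 - 1) <= x `^ (1 / 8 - 1) by apply: h; lra.
      have h4 : x `^ (1 / 2 - 1 / 8 - 1) <= x `^ (1 / 8 - 1) by apply: h; lra.
      have h5 : x `^ (3 / 2 + 1 / 8 - 1) <= x `^ (1 / 8 - 1) by apply: h; lra.
      have h6 : x `^ (3 / 2 - 1 / 8 - 1) <= x `^ (1 / 8 - 1) by apply: h; lra.
      by rewrite /w; lra.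
    have := h1 x x0; rewrite oppr0 powRr0 mulr1 => hf.
    rewrite /dom ger0_norm ?mulr_ge0//.
    apply: (@le_trans _ _ ((1 / 8)^-1 * (4 * x `^ (1 / 8 - 1)) * C1)).
      by rewrite ler_pM ?mulr_ge0// ler_wpM2l.
    rewrite [leLHS](_ : _ = 32 * C1 * x `^ (1 / 8 - 1)); last by field.
    by rewrite ler_wpM2r ?powR_ge0// lerDl mulr_ge0.
  - move=> x x1; have x0 : 0 < x by exact: lt_le_trans x1.
    have hw : w x <= 4 * x `^ (5 / 8).
      have h := @ler_powR R x x1; have h3 : x `^ (1 / 2 + 1 / 8 - 1) <= x `^ (5 / 8) by apply: h; lra.
      have h4 : x `^ (1 / 2 - 1 / 8 - 1) <= x `^ (5 / 8) by apply: h; lra.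
      have h5 : x `^ (3 / 2 + 1 / 8 - 1) <= x `^ (5 / 8) by apply: h; lra.
      have h6 : x `^ (3 / 2 - 1 / 8 - 1) <= x `^ (5 / 8) by apply: h; lra.
      by rewrite /w; lra.
    rewrite /dom ger0_norm ?mulr_ge0//.
    apply: (@le_trans _ _ ((1 / 8)^-1 * (4 * x `^ (5 / 8)) * (C2 * x `^ (- (7 / 4))))).
      by rewrite ler_pM ?mulr_ge0// ?h2// ler_wpM2l.
    rewrite (_ : - (1 / 8) - 1 = 5 / 8 + - (7 / 4)); last by field.
    rewrite (powR_add (5 / 8) (- (7 / 4)) x0).
    rewrite [leLHS](_ : _ = 32 * C2 * (x `^ (5 / 8) * x `^ (- (7 / 4)))); last by field.
    by rewrite ler_wpM2r ?mulr_ge0 ?powR_ge0// lerDr mulr_ge0.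
have hdom s x : 1 / 2 < s -> s < 3 / 2 -> 0 < x ->
    `|x `^ (s - 1) * ln x * invfam n.+1 x| <= dom x.
  move=> s1 s2 x0; rewrite normrM /dom ler_wpM2r//.
  have e0 : 0 < 1 / 8 :> R by lra.
  exact: (powR_ln_le x0 e0 (ltW s1) (ltW s2)).
have n2 : 2 <= n.+2%:R :> R by rewrite ler_nat.
have D1 : is_derive (1 : R) (1 : R) (fun s : R => pint (fun x : R => x `^ (s - 1) * invfam n.+1 x))
    (pint (fun x => x `^ (1 - 1) * ln x * invfam n.+1 x)).
  apply: (@pint_dv R (fun s x => x `^ (s - 1) * invfam n.+1 x)
    (fun s x => x `^ (s - 1) * ln x * invfam n.+1 x) 1 (1 / 2) (3 / 2) dom) => //.
  - by lra.
  - by lra.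
  - by move=> s s1 s2; apply: pintegrable_invfam; lra.
  - move=> s x s1 s2 x0; apply: dv_eq (dvM (dv_powR_exponent s x0) (dv_cst s _)) _.
    by rewrite mulr0 addr0.
have D2 : is_derive (1 : R) (1 : R) (fun s : R => pint (fun x : R => x `^ (s - 1) * invfam n.+1 x)) (invlog n).
  apply: (@dv_congr R (fun s => (-1) ^+ n.+1 / pi * (Gamma s * Gsin (n.+2%:R - s)))).
    near=> s; rewrite invfam_mellin//.
      by near: s; exact: lt_nbhsr.
    apply: (@lt_le_trans _ _ 2) => //.
    by near: s; apply: lt_nbhsl; lra.
  have n1 : 0 < n.+2%:R - 1 :> R by lra.
  have dl : is_derive (1 : R) (1 : R) (fun s => n.+2%:R - s) (-1).
    by eapply dv_eq; [dv|rewrite add0r].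
  have dG := @dv_comp R Gsin (fun s => n.+2%:R - s) 1 _ _ (dv_Gsin n1) dl.
  apply: dv_eq (dvM (dv_cst 1 _) (dvM (dv_Gamma (@ltr01 R)) dG)) _.
  rewrite /= Gamma1 /invlog (_ : n.+2%:R - 1 = n.+1%:R :> R); last by rewrite -natr1 addrK.
  by ring.
have e : pint (fun x => x `^ (1 - 1) * ln x * invfam n.+1 x) = pint (fun y => invfam n.+1 y * ln y).
  by apply: eq_pint => y y0; rewrite subrr powRr0 mul1r mulrC.
split; last by rewrite -e -(dv_derive1 D1) (dv_derive1 D2).
apply: pintegrable_le Idom _; first exact: measurable_funM mfam (measurable_funTS (@measurable_ln R)).
move=> x x0; have h12 : 1 / 2 < 1 :> R by lra.
have h32 : 1 < 3 / 2 :> R by lra.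
by have := hdom 1 x h12 h32 x0; rewrite subrr powRr0 mul1r mulrC.
Unshelve. all: by end_near. Qed.

Lemma invfam_entire : decaying_entire invfam invcoef invlog.
Proof.
split.
- exact: dv_invfam.
- exact: invfam_decay.
- by move=> n x; exact: invfam_series.
- exact: invcoef_growth.
- exact: invfam_log.
Qed.

End inverse_family.

(** * The digamma function at the integers *)

Section digamma.
Context {R : realType}.
Implicit Types (a s : R) (k : nat).

Lemma Gamma'_rec a : 0 < a -> Gamma' (a + 1) = Gamma a + a * Gamma' a.
Proof.
move=> a0; have a1 : 0 < a + 1 by rewrite addr_gt0.
have dl : is_derive a (1 : R) (fun s : R => s + 1) 1 by eapply dv_eq; [dv|rewrite addr0].
have D1 := @dv_comp R (@Gamma R) (fun s : R => s + 1) a _ _ (dv_Gamma a1) dl.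
have D2 : is_derive a (1 : R) (fun s : R => Gamma (s + 1)) (1 * Gamma a + a * Gamma' a).
  apply: (@dv_congr R (fun s : R => s * Gamma s)); last by apply: dv_eq (dvM (dv_id a) (dv_Gamma a0)) _.
  by near=> s; rewrite Gamma_rec//; near: s; exact: lt_nbhsr.
by have := dv_derive1 D1; rewrite (dv_derive1 D2) mulr1 mul1r => <-.
Unshelve. all: by end_near. Qed.

Lemma GammaS k : Gamma (k.+1%:R : R) = k`!%:R.
Proof.
elim: k => [|k IH]; first by rewrite Gamma1.
by rewrite -natr1 Gamma_rec// IH factS natrM.
Qed.

Lemma Gamma'S k : Gamma' (k.+1%:R : R) = k`!%:R * (Gamma' 1 + harmonic_sum k).
Proof.
elim: k => [|k IH]; first by rewrite /harmonic_sum big_nil addr0 mul1r.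
rewrite -natr1 Gamma'_rec// IH GammaS factS natrM /harmonic_sum big_nat_recr//=.
by have h : k.+1%:R != 0 :> R by []; field.
Qed.

Lemma digammaE s : 0 < s -> digamma s = Gamma' s / Gamma s.
Proof. by move=> s0; rewrite /digamma (dv_derive1 (dv_Gamma s0)). Qed.

Lemma digammaS k : digamma (k.+1%:R : R) = Gamma' 1 + harmonic_sum k.
Proof.
have h : k`!%:R != 0 :> R by rewrite pnatr_eq0 -lt0n fact_gt0.
by rewrite digammaE// GammaS Gamma'S mulrC mulKf.
Qed.

End digamma.

(** * Self-similarity *)

Section self_similarity.
Context {R : realType}.
Variables (al t x : R).
Hypothesis al0 : 0 < al.
Hypothesis t0 : 0 < t.
Hypothesis x0 : 0 < x.
Implicit Types (z v : R) (j : nat).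

(** The density of [E t / x] at [z] is that of [E t'] at [z]: changing the scale
  of the variable amounts to changing time. *)
Definition rescaled_time : R := t * x `^ (- al^-1).
Local Notation t' := rescaled_time.

Lemma rescaled_time_gt0 : 0 < t'.
Proof. by rewrite mulr_gt0// powR_gt0. Qed.

Lemma powR_rescaled_time v : t' `^ (- (al * v)) = x `^ v * t `^ (- (al * v)).
Proof.
rewrite powRM ?powR_ge0 ?ltW// -powRrM mulrC; congr (_ `^ _ * _).
by have h := gt_eqF al0; field; rewrite h.
Qed.

Lemma Gsin_rescaled v : Gsin al t' v = x `^ v * Gsin al t v.
Proof. by rewrite /Gsin powR_rescaled_time !mulrA. Qed.

Lemma dGsin_rescaled v :
  dGsin al t' v = x `^ v * (dGsin al t v + ln x * Gsin al t v).
Proof.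
have l : al * ln t' = al * ln t - ln x.
  rewrite lnM ?posrE ?powR_gt0// ln_powR; have h := gt_eqF al0.
  by field; rewrite h.
by rewrite /dGsin /Gsin powR_rescaled_time l; ring.
Qed.

Lemma invcoef_rescaled j : invcoef al t' j = x ^+ j.+1 * invcoef al t j.
Proof. by rewrite /invcoef Gsin_rescaled powR_mulrn ?(ltW x0)//; ring. Qed.

Lemma invfam_rescaled th z : contour_angle al th -> 0 < z ->
  invfam al th t' 0 z = x * invfam al th t 0 (x * z).
Proof.
move=> angle z0; have xz : 0 < x * z by rewrite mulr_gt0.
have h1 := @invfam_series R al th t' angle rescaled_time_gt0 0 z z0.
have h2 := @invfam_series R al th t angle t0 0 (x * z) xz.
have h3 : x * \sum_(0 <= m < N) taylor_coef (invcoef al t) 0 m * (x * z) ^+ m @[N --> \oo] -->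
    x * invfam al th t 0 (x * z) by apply: cvgM; [exact: cvg_cst|exact: h2].
apply: (@cvg_unique _ (@Rhausdorff R) _ _ _ _ h1) => //.
apply: cvg_trans h3; apply: near_eq_cvg; near=> N.
rewrite /= mulr_sumr; apply: eq_bigr => m _.
by rewrite /taylor_coef invcoef_rescaled add0n exprS exprMn; ring.
Unshelve. all: by end_near. Qed.

End self_similarity.

(** * The series for the density of the product *)

Section product_series.
Context {R : realType}.
Variables (al1 al2 th1 th2 t : R).
Hypothesis angle1 : contour_angle al1 th1.
Hypothesis angle2 : contour_angle al2 th2.
Hypothesis t0 : 0 < t.
Implicit Types (x y : R) (k N : nat).
Let a10 := al_gt0 angle1.
Let a20 := al_gt0 angle2.
Local Notation f1 := (invpdf al1 th1 t).
Local Notation f2 := (invpdf al2 th2 t).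

(** This brings the convolution at [x] to the form treated by
  [pint_conv_series], where the product of the two arguments is [1]. *)
Lemma conv_rescaled x y : 0 < x -> 0 < y ->
  invfam al1 th1 t 0 y * invfam al2 th2 (rescaled_time al2 t x) 0 y^-1 / y =
  x * (f1 y * f2 (x / y) / y).
Proof.
move=> x0 y0; have yV : 0 < y^-1 by rewrite invr_gt0.
rewrite (invfam0 _ _ _ y0) (invfam_rescaled a20 t0 x0 angle2 yV) invfam0 ?mulr_gt0//.
by ring.
Qed.

Lemma integrable_conv x : 0 < x -> pintegrable (fun y => f1 y * f2 (x / y) / y).
Proof.
move=> x0; have t'0 := rescaled_time_gt0 al2 t0 x0.
have I := pintegrable_conv (invfam_entire angle1 t0) (invfam_entire angle2 t'0).
apply: pintegrable_eq (pintegrableZ x^-1 I) => y y0.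
by rewrite conv_rescaled// mulKf// gt_eqF.
Qed.

(** The derivative of [Gamma s * Gsin (k.+1 - s)] at [1] contributes
  [Gamma' 1]; with the harmonic sum it makes up the digamma function. *)
Lemma finite_part_invfam (al s : R) k :
  finite_part_coef (invcoef al s) (invlog al s) k =
  (-1) ^+ k / (pi * k`!%:R) * (digamma k.+1%:R * Gsin al s k.+1%:R - dGsin al s k.+1%:R).
Proof.
rewrite /finite_part_coef /invlog /taylor_coef /invcoef add0n digammaS exprS.
have h : k`!%:R != 0 :> R by rewrite pnatr_eq0 -lt0n fact_gt0.
have p : pi != 0 :> R by rewrite gt_eqF// pi_gt0.
move: (@pi R) p => q p.
by field; rewrite p h.
Qed.

Lemma dGsinE (al s v : R) : 0 < al -> 0 < v -> dGsin al s v =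
  s `^ (- (al * v)) * Gamma (al * v) * (al * digamma (al * v) * sin (pi * al * v) +
    (pi * al * cos (pi * al * v) - al * ln s * sin (pi * al * v))).
Proof.
move=> al0 v0; have av : 0 < al * v by rewrite mulr_gt0.
have g := gt_eqF (Gamma_gt0 av); rewrite /dGsin digammaE//.
by field; rewrite g.
Qed.

Lemma sine_product (u v a b : R) :
  (a + b) * sin (u + v) - (a - b) * sin (u - v) = 2 * (b * sin u * cos v + a * cos u * sin v).
Proof. by rewrite sinB sinD; ring. Qed.

(** The derivatives of the two Gamma factors and of the two powers give
  [log_term]; the derivatives of the sines give [sine_term] after the addition
  formulas. *)
Lemma series_term x k : 0 < x ->
  let t' := rescaled_time al2 t x in
  taylor_coef (invcoef al2 t') 0 k * finite_part_coef (invcoef al1 t) (invlog al1 t) k +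
  taylor_coef (invcoef al1 t) 0 k * finite_part_coef (invcoef al2 t') (invlog al2 t') k =
  x * (log_term al1 al2 t x k.+1 - 1 / (2 * pi) * sine_term al1 al2 t x k.+1).
Proof.
move=> x0 /=; rewrite !finite_part_invfam Gsin_rescaled// dGsin_rescaled//.
rewrite /taylor_coef add0n invcoef_rescaled// /invcoef.
rewrite powR_mulrn ?(ltW x0)// !dGsinE//.
rewrite /log_term /sine_term.
rewrite (_ : (al1 + al2) * k.+1%:R * pi = pi * al1 * k.+1%:R + pi * al2 * k.+1%:R); last by ring.
rewrite (_ : (al1 - al2) * k.+1%:R * pi = pi * al1 * k.+1%:R - pi * al2 * k.+1%:R); last by ring.
rewrite sine_product.
rewrite (_ : - k.+1%:R * (al1 + al2) = - (al1 * k.+1%:R) + - (al2 * k.+1%:R)); last by ring.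
rewrite (powR_add _ _ t0) [k.+1%:R * al1]mulrC [k.+1%:R * al2]mulrC /Gsin /= exprS.
have h : k`!%:R != 0 :> R by rewrite pnatr_eq0 -lt0n fact_gt0.
have p : pi != 0 :> R by rewrite gt_eqF// pi_gt0.
move: (sin (pi * al1 * k.+1%:R)) (sin (pi * al2 * k.+1%:R)) => s1 s2.
move: (cos (pi * al1 * k.+1%:R)) (cos (pi * al2 * k.+1%:R)) => c1 c2.
move: (digamma (al1 * k.+1%:R)) (digamma (al2 * k.+1%:R)) (digamma k.+1%:R) => d1 d2 d.
move: (Gamma (al1 * k.+1%:R)) (Gamma (al2 * k.+1%:R)) => g1 g2.
move: (t `^ (- (al1 * k.+1%:R))) (t `^ (- (al2 * k.+1%:R))) (ln t) (ln x) => p1 p2 lt lx.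
move: (k`!%:R) h => f h; move: (@pi R) p => q p.
(* The two alternating signs enter through their product only. *)
have e : (-1) ^+ k * (-1) ^+ k = 1 :> R by rewrite -expr2 sqrr_sign.
move: ((-1) ^+ k) e (x ^+ k) => e ee xk.
transitivity (e * e * (x * xk / (q * f) ^+ 2 * (g1 * g2 * p1 * p2) *
   ((2 * d - al1 * d1 - al2 * d2 - lx + (al1 + al2) * lt) * s1 * s2 -
    q * (al1 * c1 * s2 + al2 * s1 * c2)))); first by field; rewrite p h.
by rewrite ee; field; rewrite p h.
Qed.

Lemma cvg_sum_from1 (F : nat -> R) (l : R) : \sum_(0 <= k < N) F k.+1 @[N --> \oo] --> l ->
  (fun n => \sum_(1 <= k < n) F k) @ \oo --> l.
Proof.
move=> h; rewrite -(cvg_shiftS (fun n => \sum_(1 <= k < n) F k)).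
apply: cvg_trans h; apply: near_eq_cvg; near=> N.
by rewrite /= big_add1.
Unshelve. all: by end_near. Qed.

(** The two Gamma factors grow more slowly than [k`! ^+ 2] by any geometric
  factor: the weights in [X1] and [X2] leave a geometric series of ratio
  one half. *)
Lemma cvg_sine x : 0 < x -> cvgn (fun n => \sum_(1 <= k < n) sine_term al1 al2 t x k).
Proof.
move=> x0.
have X1 : 0 <= 2 * x * t `^ (- al1) by rewrite !mulr_ge0 ?powR_ge0// ltW.
have [M1 M10 h1] := Gamma_growth a10 (al_lt1 angle1) X1.
have [M2 M20 h2] := Gamma_growth a20 (al_lt1 angle2) (powR_ge0 t (- al2)).
pose C := (`|al1 + al2| + `|al1 - al2|) * (t `^ (- al1) * t `^ (- al2)) * (M1 * M2).
have C0 : 0 <= C by rewrite !mulr_ge0 ?powR_ge0 ?addr_ge0.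
have bound k : `|sine_term al1 al2 t x k.+1| <= C * 2^-1 ^+ k.
  have fk : 0 < k`!%:R :> R by rewrite ltr0n fact_gt0.
  have g1 : 0 < Gamma (al1 * k.+1%:R) by rewrite Gamma_gt0// mulr_gt0.
  have g2 : 0 < Gamma (al2 * k.+1%:R) by rewrite Gamma_gt0// mulr_gt0.
  rewrite /sine_term /=.
  rewrite (_ : - k.+1%:R * (al1 + al2) = (- al1 * k%:R + - al1) + (- al2 * k%:R + - al2)); last first.
    by rewrite -natr1; ring.
  rewrite (powR_add (- al1 * k%:R + - al1) (- al2 * k%:R + - al2) t0).
  rewrite (powR_add (- al1 * k%:R) (- al1) t0) (powR_add (- al2 * k%:R) (- al2) t0) -!powR_natX.
  rewrite [k.+1%:R * al1]mulrC [k.+1%:R * al2]mulrC.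
  set s := _ - _.
  have hs : `|s| <= `|al1 + al2| + `|al1 - al2|.
    rewrite (le_trans (ler_normB _ _))//; apply: lerD; rewrite normrM ler_piMr//; exact: sin_max.
  have hg := ler_pM (mulr_ge0 (exprn_ge0 k X1) (ltW g1)) (mulr_ge0 (exprn_ge0 k (powR_ge0 t (- al2))) (ltW g2)) (h1 k) (h2 k).
  have f2 : 0 < k`!%:R ^+ 2 :> R by rewrite exprn_gt0.
  have hg' : ((2 * x * t `^ (- al1)) ^+ k * Gamma (al1 * k.+1%:R) *
     (t `^ (- al2) ^+ k * Gamma (al2 * k.+1%:R))) / k`!%:R ^+ 2 <= M1 * M2.
    by rewrite ler_pdivrMr//; apply: le_trans hg _; rewrite expr2 mulrACA.
  rewrite normrM [X in X * _]ger0_norm; last first.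
    by rewrite !mulr_ge0 ?exprn_ge0 ?powR_ge0 ?invr_ge0 ?(ltW g1) ?(ltW g2) ?(ltW f2)// ltW.
  have p2 : (2 : R) ^+ k != 0 by rewrite expf_neq0.
  rewrite [leLHS](_ : _ = `|s| * (t `^ (- al1) * t `^ (- al2)) * (((2 * x * t `^ (- al1)) ^+ k * Gamma (al1 * k.+1%:R) *
     (t `^ (- al2) ^+ k * Gamma (al2 * k.+1%:R))) / k`!%:R ^+ 2) * 2^-1 ^+ k); last first.
    by rewrite !exprMn exprVn; field; rewrite p2 gt_eqF.
  rewrite ler_wpM2r ?exprn_ge0 ?invr_ge0// /C; apply: ler_pM => //.
  - by rewrite !mulr_ge0 ?powR_ge0.
  - by rewrite divr_ge0 ?(ltW f2)// !mulr_ge0 ?exprn_ge0 ?powR_ge0 ?(ltW g1) ?(ltW g2)// ltW.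
  - by rewrite ler_wpM2r ?mulr_ge0 ?powR_ge0.
have c : cvgn (series (fun k => sine_term al1 al2 t x k.+1)).
  apply: normed_cvg; apply: (@series_le_cvg R _ (geometric C 2^-1)) => //.
  - by move=> n /=.
  - by move=> n; rewrite /geometric/= mulr_ge0// exprn_ge0// invr_ge0.
  - by apply: is_cvg_geometric_series; rewrite gtr0_norm ?invr_gt0// invf_lt1// ltr1n.
by apply/cvg_ex; exists (limn (series (fun k => sine_term al1 al2 t x k.+1))); apply: cvg_sum_from1; exact: c.
Qed.

Lemma mulconv_series x : 0 < x ->
  (fun n => \sum_(1 <= k < n) (log_term al1 al2 t x k - 1 / (2 * pi) * sine_term al1 al2 t x k))
    @ \oo --> mulconv al1 al2 th1 th2 t x.
Proof.
move=> x0; apply: cvg_sum_from1; have t'0 := rescaled_time_gt0 al2 t0 x0.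
have h := @pint_conv_series R _ _ _ _ _ _ (invfam_entire angle1 t0) (invfam_entire angle2 t'0).
have e : pint (fun y => invfam al1 th1 t 0 y * invfam al2 th2 (rescaled_time al2 t x) 0 y^-1 / y) =
    x * mulconv al1 al2 th1 th2 t x.
  under eq_pint do rewrite conv_rescaled//.
  by rewrite pintZ ?/mulconv ?x0//; exact: integrable_conv.
rewrite e in h; have xn : x != 0 by rewrite gt_eqF.
rewrite -[mulconv _ _ _ _ _ _](mulKf xn).
have h' : x^-1 * \sum_(0 <= k < N) (
    taylor_coef (invcoef al2 (rescaled_time al2 t x)) 0 k * finite_part_coef (invcoef al1 t) (invlog al1 t) k +
    taylor_coef (invcoef al1 t) 0 k *
      finite_part_coef (invcoef al2 (rescaled_time al2 t x)) (invlog al2 (rescaled_time al2 t x)) k)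
    @[N --> \oo] --> x^-1 * (x * mulconv al1 al2 th1 th2 t x) by apply: cvgM; [exact: cvg_cst|exact: h].
apply: cvg_trans h'; apply: near_eq_cvg; near=> N.
by rewrite /= mulr_sumr; apply: eq_bigr => k _; rewrite series_term// mulKf.
Unshelve. all: by end_near. Qed.

End product_series.
Theorem proposition3p3 (d : measure_display) (T : measurableType d)
    (R : realType) (P : probability T R) (alpha1 alpha2 t : R)
    (E1 E2 : R -> {RV P >-> \bar R})
    (halpha1 : 0 < alpha1 < 1) (halpha2 : 0 < alpha2 < 1) (ht : 0 < t)
    (hE1 : inverse_stable_subordinator alpha1 E1)
    (hE2 : inverse_stable_subordinator alpha2 E2)
    (hindep : independent_processes E1 E2) :
  (forall x : R, 0 < x ->
     cvgn (fun n => \sum_(1 <= k < n) log_term alpha1 alpha2 t x k) /\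
     cvgn (fun n => \sum_(1 <= k < n) sine_term alpha1 alpha2 t x k)) /\
  exists h : R -> R,
    has_density P (fun w => E1 t w * E2 t w)%E h /\
    (forall x : R, x <= 0 -> h x = 0) /\
    (forall x : R, 0 < x ->
       h x = limn (fun n => \sum_(1 <= k < n) log_term alpha1 alpha2 t x k)
             - 1 / (2 * pi)
               * limn (fun n => \sum_(1 <= k < n) sine_term alpha1 alpha2 t x k)).
Proof.
have [th1 angle1] := contour_angle_exists halpha1.
have [th2 angle2] := contour_angle_exists halpha2.
have I := integrable_conv angle1 angle2 ht.
have cs x : 0 < x -> cvgn (fun n => \sum_(1 <= k < n) sine_term alpha1 alpha2 t x k).
  by move=> x0; exact: (@cvg_sine R _ _ _ _ _ angle1 angle2 ht).
pose S x n := \sum_(1 <= k < n) sine_term alpha1 alpha2 t x k.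
pose h := mulconv alpha1 alpha2 th1 th2 t.
(* The series of [log_term] converges because the total and the sine series do. *)
have cl x : 0 < x -> (fun n => \sum_(1 <= k < n) log_term alpha1 alpha2 t x k) @ \oo -->
    h x + 1 / (2 * pi) * limn (S x).
  move=> x0; have c1 := @mulconv_series R _ _ _ _ _ angle1 angle2 ht x x0.
  have c2 : 1 / (2 * pi) * S x n @[n --> \oo] --> 1 / (2 * pi) * limn (S x).
    by apply: cvgM; [exact: cvg_cst|exact: cs].
  have c3 : \sum_(1 <= k < n) (log_term alpha1 alpha2 t x k - 1 / (2 * pi) * sine_term alpha1 alpha2 t x k) +
      1 / (2 * pi) * S x n @[n --> \oo] --> h x + 1 / (2 * pi) * limn (S x) by exact: cvgD.
  apply: cvg_trans c3; apply: near_eq_cvg; near=> n.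
  by rewrite /= /S mulr_sumr -big_split/=; apply: eq_bigr => k _; rewrite subrK.
split=> [x x0|].
  by split; [apply/cvg_ex; eexists; exact: cl x x0|exact: cs].
exists h; split; [split|split].
- by apply: emeasurable_funM; exact: measurable_funP.
- exact: measurable_mulconv angle1 angle2 hE1 hE2 ht I.
- exact: mulconv_ge0 angle1 angle2 hE1 hE2 ht I.
- by move=> B mB; exact: product_law angle1 angle2 hE1 hE2 hindep ht I _ mB.
- by move=> x x0; rewrite /h /mulconv ltNge x0.
- by move=> x x0; rewrite (cvg_lim (@Rhausdorff R) (cl x x0)) addrK.
Unshelve. all: by end_near. Qed.
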